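(* Let $H:[0,\infty)\times\mathbb{T}^d\times\mathcal{P}(\mathbb{T}^d)\times\mathbb{R}^d\to\mathbb{R}$ be continuous and assume there exists $C>0$ such that for all $p\in\mathbb{R}^d$, $s,t\ge 0$, $\mu,\nu\in\mathcal{P}(\mathbb{T}^d)$, $x,y\in\mathbb{T}^d$, $$|H(t,x,\mu,p)-H(s,y,\nu,p)|\le C(1+|p|)\big(|t-s|+W_2(\mu,\nu)+|x-y|\big).$$ Let $U_0:\mathcal{P}(\mathbb{T}^d)\to\mathbb{R}$ be continuous. Then there exists at most one viscosity solution $U$ of $$\partial_tU(t,\mu)+\int_{\mathbb{T}^d}H(t,x,\mu,D_\mu U(t,\mu,x))\,\mu(dx)=0\quad\text{in }(0,\infty)\times\mathcal{P}(\mathbb{T}^d)$$ such that $U^*(0,\mu)=U_0(\mu)=U_*(0,\mu)$ for all $\mu\in\mathcal{P}(\mathbb{T}^d)$.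
   Context: $\mathbb{T}^d=\mathbb{R}^d/\mathbb{Z}^d$; $\mathcal{P}(\mathbb{T}^d)$ is the set of Borel probability measures on $\mathbb{T}^d$ with the weak topology. For $x,y\in\mathbb{T}^d$, $|x-y|$ is the torus distance and $y-x\in\mathbb{R}^d$ denotes a (fixed, measurably chosen) representative of minimal norm. $\Pi(\mu,\mu')$ is the set of couplings, and $W_2(\mu,\mu')^2=\inf_{\gamma\in\Pi(\mu,\mu')}\int|x-y|^2\gamma(dx,dy)$. $U^*$ and $U_*$ are the usc and lsc envelopes of a locally bounded function $U$. Super-differential. For $U:[0,\infty)\times\mathcal{P}(\mathbb{T}^d)\to\mathbb{R}$ usc, $(\theta,\psi)\in\partial^+U(t,\mu)$ means: $\theta\in\mathbb{R}$; $\psi:\mathbb{T}^d\to\mathcal{P}(\mathbb{R}^d)$ is measurable and there is $R>0$ such that for all $x$ the support of $\psi(x,\cdot)$ is contained in $B(0,R)$; and for all $s\le t$, $\mu'\in\mathcal{P}(\mathbb{T}^d)$, $\gamma\in\Pi(\mu,\mu')$, $$U(s,\mu')\le U(t,\mu)+\theta(s-t)+\int_{\mathbb{T}^{2d}}\int_{\mathbb{R}^d}z\cdot(y-x)\,\psi(x,dz)\gamma(dx,dy)+o\Big(|s-t|+\Big(\int|x-y|^2d\gamma\Big)^{1/2}\Big),$$ where $o(\cdot)$ is uniform in $(s,\mu',\gamma)$. For $U$ lsc, $\partial^-U(t,\mu)=\{(-\theta,\,x\mapsto(-\mathrm{Id})_\#\psi(x,\cdot)):(\theta,\psi)\in\partial^+(-U)(t,\mu)\}$.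 Set $\bar{\mathcal H}(t,\mu,\psi)=\int_{\mathbb{T}^d\times\mathbb{R}^d}H(t,x,\mu,z)\,\psi(x,dz)\mu(dx)$. A usc (resp. lsc) function $U$ is a viscosity sub-solution (resp. super-solution) if for all $t>0$, $\mu$ and $(\theta,\psi)\in\partial^+U(t,\mu)$ (resp. $\partial^-U(t,\mu)$): $\theta+\bar{\mathcal H}(t,\mu,\psi)\le0$ (resp. $\ge0$). A viscosity solution is a locally bounded function $U:[0,\infty)\times\mathcal{P}(\mathbb{T}^d)\to\mathbb{R}$ such that $U^*$ is a viscosity sub-solution and $U_*$ a viscosity super-solution. *)

(* Defs.v *)
From HB Require Import structures.
From mathcomp Require Import all_boot all_order all_algebra.
From mathcomp Require Import all_classical all_reals all_analysis.

Set Implicit Arguments.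
Unset Strict Implicit.
Unset Printing Implicit Defensive.

Import Order.TTheory GRing.Theory Num.Theory.
Import numFieldNormedType.Exports.

Local Open Scope classical_set_scope.
Local Open Scope ring_scope.

Section euclidean.
Context {R : realType} {d : nat}.

Definition dotp (u v : 'rV[R]_d) : R := \sum_i u ord0 i * v ord0 i.

(* The library norm of row vectors is the sup norm. *)
Definition enorm (v : 'rV[R]_d) : R := Num.sqrt (dotp v v).

End euclidean.

HB.instance Definition _ (R : realType) (d : nat) :=
  @isMeasurable.Build (sigma_display (@open 'rV[R]_d)) 'rV[R]_d
    <<s @open 'rV[R]_d >> (@sigma_algebra0 _ setT _) (@sigma_algebraC _ _)
    (@sigma_algebra_bigcup _ setT _).

Section torus_def.
Context (R : realType) (d : nat).
Local Open Scope quotient_scope.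

Definition Zd_congr : rel 'rV[R]_d :=
  fun a b => [forall i, (b ord0 i - a ord0 i) \is a Num.int].

Lemma Zd_congr_equiv : equiv_class_of Zd_congr.
Proof.
split=> [a|a b|b a c].
- by apply/forallP => i; rewrite subrr rpred0.
- by apply: eq_forallb => i; rewrite -opprB rpredN.
- move=> /forallP ab /forallP bc; apply/forallP => i.
  by rewrite -(subrKA (b ord0 i)) rpredD.
Qed.

Canonical Zd_congr_equiv_rel := EquivRelPack Zd_congr_equiv.

Definition torus : Type := quotient_topology {eq_quot Zd_congr}.

HB.instance Definition _ := PointedTopological.on torus.
HB.instance Definition _ := Quotient.on torus.
HB.instance Definition _ :=
  @isMeasurable.Build (sigma_display (@open torus)) torus
    <<s @open torus >> (@sigma_algebra0 _ setT _) (@sigma_algebraC _ _)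
    (@sigma_algebra_bigcup _ setT _).

End torus_def.
Section torus_theory.
Context {R : realType} {d : nat}.
Local Notation T := (torus R d).
Local Open Scope quotient_scope.

(* The representatives of y - x in R^d. *)
Definition displacements (x y : T) : set 'rV[R]_d :=
  [set b - a | b in [set b | \pi_T b = y] & a in [set a | \pi_T a = x]].

Definition tdist (x y : T) : R := inf [set enorm v | v in displacements x y].

(* [delta (x, y)] is the chosen representative of y - x. *)
Definition min_displacement (delta : T * T -> 'rV[R]_d) :=
  measurable_fun setT delta /\
  forall x y : T, displacements x y (delta (x, y)) /\
    forall v, displacements x y v -> enorm (delta (x, y)) <= enorm v.

End torus_theory.

Definition time (R : realType) : topologicalType := [set t : R | 0 <= t].

Definition time_val (R : realType) (t : time R) : R := \val t.

Definition time0 (R : realType) : time R :=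
  exist _ (0 : R) (mem_set (lexx (0 : R))).

Section wasserstein_space.
Context (R : realType) (d : nat).
Local Notation T := (torus R d).

Definition prob_torus : Type := probability T R.

Definition test_integrals (mu : probability T R) :
    {ptws continuousType T R -> R} :=
  fun f => (\int[mu]_x f x)%R.

(* The weak topology: the coarsest one making mu |-> \int f dmu continuous for
   every continuous f. Measures that agree on the Borel sets but not as
   functions on [set T] are topologically indistinguishable. *)
HB.instance Definition _ :=
  Topological.copy prob_torus (initial_topology test_integrals).

End wasserstein_space.

Section wasserstein_distance.
Context {R : realType} {d : nat}.
Local Notation T := (torus R d).
Local Notation P := (prob_torus R d).

Definition coupling (mu nu : P) (gamma : probability (T * T)%type R) :=
  forall A : set T, measurable A ->
    gamma (A `*` setT) = mu A /\ gamma (setT `*` A) = nu A.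

Definition transport_cost (gamma : probability (T * T)%type R) : R :=
  (\int[gamma]_xy (tdist xy.1 xy.2) ^+ 2)%R.

Definition W2 (mu nu : P) : R :=
  Num.sqrt (inf [set transport_cost gamma | gamma in coupling mu nu]).

End wasserstein_distance.

Section semicontinuity.
Context {X : topologicalType} {R : realType}.
Implicit Type f : X -> R.

Definition lsc f := lower_semicontinuous (fun x => (f x)%:E).
Definition usc f := lsc (\- f).

Definition locally_bounded f :=
  forall x : X, exists M : R, \forall y \near x, `|f y| <= M.

(* The envelopes are finite for locally bounded functions. *)
Definition usc_envelope f (x : X) : R :=
  fine (limf_esup (fun y => (f y)%:E) (nbhs x)).
Definition lsc_envelope f (x : X) : R :=
  fine (limf_einf (fun y => (f y)%:E) (nbhs x)).

End semicontinuity.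

Section viscosity.
Context {R : realType} {d : nat}.
Local Notation T := (torus R d).
Local Notation P := (prob_torus R d).
Local Notation E := 'rV[R]_d.

Definition msupport (m : {measure set E -> \bar R}) : set E :=
  [set z | forall V, open V -> V z -> (0 < m V)%E].

Variables (delta : T * T -> E) (H : time R -> T -> P -> E -> R).

Implicit Types (U : time R * P -> R) (t : time R) (mu : P)
  (theta : R) (psi : R.-pker T ~> E).

(* A measurable map from T to the Borel probability measures on E is a
   probability kernel. The uniform o(h) is a single modulus [omega] that serves
   for all (s, mu', gamma). *)
Definition superdiff U t mu theta psi :=
  (exists2 r : R, 0 < r &
    forall x, msupport (psi x) `<=` [set z | enorm z < r]) /\
  exists2 omega : R -> R, omega h / h @[h --> 0^'+] --> 0 &
    forall (s : time R) (mu' : P) (gamma : probability (T * T)%type R),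
      time_val s <= time_val t -> coupling mu mu' gamma ->
      U (s, mu') <= U (t, mu) + theta * (time_val s - time_val t)
        + (\int[gamma]_xy \int[psi xy.1]_z dotp z (delta xy))%R
        + omega (`|time_val s - time_val t| + Num.sqrt (transport_cost gamma)).

(* psi is the image of psi' under -Id; the two are compared on Borel sets only. *)
Definition subdiff U t mu theta psi :=
  exists theta' psi', [/\ superdiff (\- U) t mu theta' psi',
    theta = - theta' &
    forall x (A : set E), measurable A ->
      psi x A = pushforward (psi' x) (fun z : E => - z) A].

Definition mean_hamiltonian t mu psi : R :=
  (\int[mu]_x \int[psi x]_z H t x mu z)%R.

Definition viscosity_subsolution U :=
  usc U /\ forall t mu theta psi, 0 < time_val t ->
    superdiff U t mu theta psi -> theta + mean_hamiltonian t mu psi <= 0.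

Definition viscosity_supersolution U :=
  lsc U /\ forall t mu theta psi, 0 < time_val t ->
    subdiff U t mu theta psi -> 0 <= theta + mean_hamiltonian t mu psi.

Definition viscosity_solution U :=
  [/\ locally_bounded U, viscosity_subsolution (usc_envelope U) &
      viscosity_supersolution (lsc_envelope U)].

End viscosity.

(* Main.v *)
(* Comparison is by doubling variables, with couplings as the doubled variable.
   Given a subsolution A and a supersolution -B, maximize over times t, s and
   plans g on T x T with marginals mu, nu the function
     A(t, mu) + B(s, nu) - lam (t + s) - K (\int |x - y|^2 dg + |t - s|^2).
   Plans form a compact space: the limit of an ultrafilter of plans is a positive
   linear functional, which a Daniell construction represents by a plan. Any plan
   from mu to mu' glued to the maximizing g along mu is an admissible competitor, so
   a kernel whose barycentre at x is - 2K E_g[y - x | x] is a superdifferential at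
   the maximum. The definition sees only barycentres, so the kernel can be taken
   with finite support, its weights being conditional expectations
   (Radon-Nikodym); and an approximate gluing along finite labels replaces the
   disintegration of measures. The two viscosity inequalities and the Lipschitz
   bound on H give 2 lam <= C \int (1 + 2 K d |x - y|)
   (|t - s| + sqrt cost + |x - y|) dg, and the right-hand side tends to 0 along
   some K -> oo because the penalty vanishes. *)

(* [H] is not assumed convex or Lipschitz in the momentum, so the two viscosity inequalities can
   only be subtracted at equal momenta. The maximizing plan g0 proposes one momentum per pair (x,
   y), whereas the subsolution sees x alone and the supersolution y alone, and the two conditional
   means would be different momenta. Kernels resolve this: each pair gets a law on a fixed finite
   set of momenta, and conditioning its weights on x and on y yields the two kernels. Integrated
   against g0, both Hamiltonians carry the same weights at the same atoms; only time, point and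
   measure differ.

   A competitor for the superdifferential is an arbitrary coupling out of mu, so the cost of a glued
   plan is expanded to second order: the cross term is linear in the competitor, and the remainder
   is at most K h^2. Approximate gluing is enough because its error tends to 0 while the competitor
   stays fixed.

   Competitors have times at most t. A maximum over [0, T0] at the final time is therefore as good
   as an interior one, and only the initial time has to be excluded, through the initial
   condition. *)
From HB Require Import structures.
Require Import Defs.
From mathcomp Require Import all_boot all_order all_algebra.
From mathcomp Require Import all_classical all_reals all_analysis measurable_realfun.
From mathcomp Require Import ring lra.

Set Implicit Arguments.
Unset Strict Implicit.
Unset Printing Implicit Defensive.

Import Order.TTheory GRing.Theory Num.Theory.
Import numFieldNormedType.Exports.

Local Open Scope classical_set_scope.
Local Open Scope ring_scope.

(** * Integrals of bounded measurable functions *)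

Section bounded_measurable.
Context {disp : measure_display} {X : measurableType disp} {R : realType}.
Implicit Types (f g : X -> R) (P : probability X R).

(** The bound holds everywhere, so integrability is available under every probability at once, and
    sums and products inherit it without side conditions. *)
Definition bmeas f :=
  measurable_fun setT f /\ exists M : R, forall x, `|f x| <= M.

Lemma bmeas_bound f : bmeas f -> exists2 M : R, 0 < M & forall x, `|f x| <= M.
Proof.
move=> [_ [M fM]]; exists (`|M| + 1); first by rewrite ltr_wpDl.
by move=> x; rewrite (le_trans (fM x))// (le_trans (ler_norm M))// lerDl.
Qed.

Lemma bmeas_cst (c : R) : bmeas (fun=> c).
Proof. by split; [exact: measurable_cst|exists `|c|]. Qed.

Lemma bmeasD f g : bmeas f -> bmeas g -> bmeas (fun x => f x + g x).
Proof.
move=> [mf [M fM]] [mg [N gN]]; split; first exact: measurable_funD.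
by exists (M + N) => x; rewrite (le_trans (ler_normD _ _))// lerD.
Qed.

Lemma bmeasM f g : bmeas f -> bmeas g -> bmeas (fun x => f x * g x).
Proof.
move=> [mf [M fM]] [mg [N gN]]; split; first exact: measurable_funM.
by exists (M * N) => x; rewrite normrM ler_pM.
Qed.

Lemma bmeasZ c f : bmeas f -> bmeas (fun x => c * f x).
Proof. by move=> bf; exact: bmeasM (bmeas_cst c) bf. Qed.

Lemma bmeasN f : bmeas f -> bmeas (fun x => - f x).
Proof.
move=> [mf [M fM]]; split; first exact: measurable_funN.
by exists M => x; rewrite normrN.
Qed.

Lemma bmeasB f g : bmeas f -> bmeas g -> bmeas (fun x => f x - g x).
Proof. by move=> bf bg; exact: bmeasD bf (bmeasN bg). Qed.

Lemma bmeasX n f : bmeas f -> bmeas (fun x => f x ^+ n).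
Proof.
move=> bf; elim: n => [|n IH].
  by have := bmeas_cst 1; congr bmeas; apply/funext => x; rewrite expr0.
have := bmeasM bf IH; congr bmeas; apply/funext => x; rewrite exprS//.
Qed.

Lemma bmeas_sum (I : Type) (r : seq I) (F : I -> X -> R) :
  (forall i, bmeas (F i)) -> bmeas (fun x => \sum_(i <- r) F i x).
Proof.
move=> bF; elim: r => [|i r IH].
  have := bmeas_cst 0; congr bmeas; apply/funext => x; rewrite big_nil//.
have := bmeasD (bF i) IH; congr bmeas; apply/funext => x; rewrite big_cons//.
Qed.

Lemma bmeas_max f g : bmeas f -> bmeas g -> bmeas (fun x => Num.max (f x) (g x)).
Proof.
move=> [mf [M fM]] [mg [N gN]]; split; first exact: measurable_maxr.
exists (Num.max M N) => x; case: (leP (f x) (g x)) => _; rewrite le_max.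
  by rewrite gN orbT.
by rewrite fM.
Qed.

Lemma bmeas_min f g : bmeas f -> bmeas g -> bmeas (fun x => Num.min (f x) (g x)).
Proof.
move=> bf bg; have := bmeasN (bmeas_max (bmeasN bf) (bmeasN bg)).
by congr bmeas; apply/funext => x; rewrite oppr_max !opprK.
Qed.

Lemma bmeas_indic (A : set X) : measurable A -> bmeas (\1_A : X -> R).
Proof.
move=> mA; split; first exact: measurable_indic.
by exists 1 => x; rewrite indicE; case: (_ \in _); rewrite ?normr1 ?normr0.
Qed.

Variable P : probability X R.

Lemma bmeas_integrable f : bmeas f -> P.-integrable setT (EFin \o f).
Proof.
move=> [mf [M fM]]; apply: measurable_bounded_integrable => //.
  by rewrite -ge0_fin_numE ?fin_num_measure.
exists M; split; first by rewrite num_real.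
by move=> y My x _; exact: le_trans (fM x) (ltW My).
Qed.

Lemma expectD f g : bmeas f -> bmeas g ->
  \int[P]_x (f x + g x) = \int[P]_x f x + \int[P]_x g x.
Proof. by move=> bf bg; rewrite RintegralD//; exact: bmeas_integrable. Qed.

Lemma expectB f g : bmeas f -> bmeas g ->
  \int[P]_x (f x - g x) = \int[P]_x f x - \int[P]_x g x.
Proof. by move=> bf bg; rewrite RintegralB//; exact: bmeas_integrable. Qed.

Lemma expectZ c f : bmeas f -> \int[P]_x (c * f x) = c * \int[P]_x f x.
Proof. by move=> bf; rewrite RintegralZl//; exact: bmeas_integrable. Qed.

Lemma expect_cst c : \int[P]_x c = c :> R.
Proof. by rewrite Rintegral_cst// -[X in _ * fine X]/(P setT) probability_setT mulr1. Qed.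

Lemma expect_sum (I : Type) (r : seq I) (F : I -> X -> R) :
  (forall i, bmeas (F i)) ->
  \int[P]_x (\sum_(i <- r) F i x) = \sum_(i <- r) \int[P]_x F i x.
Proof.
move=> bF; elim: r => [|i r IH].
  rewrite big_nil -[RHS]expect_cst; apply: eq_Rintegral => x _.
  by rewrite big_nil.
rewrite big_cons -IH -expectD//; last exact: bmeas_sum.
by apply: eq_Rintegral => x _; rewrite big_cons.
Qed.

Lemma le_expect f g : bmeas f -> bmeas g -> (forall x, f x <= g x) ->
  \int[P]_x f x <= \int[P]_x g x.
Proof.
by move=> bf bg fg; apply: le_Rintegral => //; exact: bmeas_integrable.
Qed.

Lemma expect_ge0 f : (forall x, 0 <= f x) -> 0 <= \int[P]_x f x.
Proof. by move=> f0; apply: Rintegral_ge0 => x _. Qed.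

Lemma expect_indic (A : set X) : measurable A ->
  (\int[P]_x \1_A x)%:E = P A.
Proof.
move=> mA; rewrite /Rintegral integral_indic// setIT fineK//.
exact: fin_num_measure.
Qed.

Lemma expect_le_cst f c : bmeas f -> (forall x, f x <= c) -> \int[P]_x f x <= c.
Proof. by move=> bf fc; rewrite -[leRHS]expect_cst le_expect//; exact: bmeas_cst. Qed.

Lemma expect_norm_le f c : bmeas f -> (forall x, `|f x| <= c) ->
  `|\int[P]_x f x| <= c.
Proof.
move=> bf fc; rewrite ler_norml; apply/andP; split.
  rewrite -[leLHS]expect_cst; apply: le_expect => //; first exact: bmeas_cst.
  by move=> x; have := fc x; rewrite ler_norml => /andP[].
by apply: expect_le_cst => // x; have := fc x; rewrite ler_norml => /andP[].
Qed.

End bounded_measurable.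

Lemma bmeasT_comp {d d' : measure_display} {X : measurableType d}
    {Y : measurableType d'} {R : realType} (h : Y -> X) (f : X -> R) :
  measurable_fun setT h -> bmeas f -> bmeas (fun y => f (h y)).
Proof.
move=> mh [mf [M fM]]; split; first exact: (@measurableT_comp _ _ _ _ _ _ f).
by exists M => x /=.
Qed.

Section simple_approximation.
Context {disp : measure_display} {X : measurableType disp} {R : realType}.

(** The sum counts the positive multiples of M not exceeding u, so it equals M times the integer
    part of u / M. *)
Lemma staircase (M : R) (n : nat) (u : R) : 0 <= u -> u <= M * n%:R -> 0 < M ->
  u - M <= \sum_(i < n) M * (i.+1%:R * M <= u)%R%:R <= u.
Proof.
move=> u0 uM M0; pose k := Num.truncn (u / M).
have uM0 : 0 <= u / M by rewrite divr_ge0// ltW.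
have kn : (k <= n)%N.
  rewrite -(ler_nat R); have /andP[h _] := truncn_itv uM0.
  by rewrite (le_trans h)// ler_pdivrMr// mulrC.
have -> : \sum_(i < n) M * (i.+1%:R * M <= u)%R%:R = M * k%:R.
  rewrite -mulr_sumr -natr_sum; congr (_ * _%:R).
  rewrite (eq_bigr (fun i : 'I_n => nat_of_bool (i < k)%N)); last first.
    by move=> i _; rewrite -ler_pdivlMr// -truncn_gt_nat.
  rewrite -[RHS]card_ord -sum1_card (big_ord_widen_cond n xpredT (fun=> 1%N) kn).
  rewrite [RHS]big_mkcond/=.
  by apply: eq_bigr => i _; case: (i < k)%N.
have /andP[h1 h2] := truncn_itv uM0.
move: h1 h2; rewrite ler_pdivlMr// ltr_pdivrMr// -natr1 -/k => h1 h2.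
by apply/andP; split; lra.
Qed.

Lemma bmeas_approx (f : X -> R) (e : R) : bmeas f -> 0 < e ->
  exists (n : nat) (A : nat -> set X) (M : R), (forall i, measurable (A i)) /\
    forall x, let s := \sum_(i < n) e * \1_(A i) x - M in s <= f x <= s + e.
Proof.
move=> bf e0; have [M M0 fM] := bmeas_bound bf.
have fM1 x : - M <= f x <= M by rewrite -ler_norml.
exists (Num.truncn ((M + M) / e)).+1, (fun i => [set x | i.+1%:R * e <= f x + M]), M.
split=> [i|x].
  rewrite -[X in measurable X]setTI.
  have /measurable_EFinP := (bmeasD bf (bmeas_cst M)).1.
  by move=> /(emeasurable_fun_c_infty measurableT) => /(_ (i.+1%:R * e)%:E).
have := @staircase e (Num.truncn ((M + M) / e)).+1 (f x + M).
have /andP[f1 f2] := fM1 x.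
rewrite -lerBlDr sub0r f1 => /(_ isT).
have h : f x + M <= e * (Num.truncn ((M + M) / e)).+1%:R.
  rewrite (@le_trans _ _ (M + M)) ?lerD2r//.
  by rewrite -ler_pdivrMl// mulrC ltW// truncnS_gt.
move=> /(_ h e0).
rewrite (eq_bigr (fun i : 'I__ =>
    e * \1_[set x | i.+1%:R * e <= f x + M] x)); last first.
  move=> i _; rewrite indicE; congr (_ * (nat_of_bool _)%:R).
  by apply/idP/idP; rewrite inE.
by move=> /=; set S := \sum_(i < _) _ => /andP[? ?]; apply/andP; split; lra.
Qed.

(** Integrals, finite weighted sums and limits of integrals along an ultrafilter are all of this
    kind. Nothing is asked about limits of sequences of functions. *)
Definition pos_linear (L : (X -> R) -> R) := [/\
  forall f g, bmeas f -> bmeas g -> L (fun x => f x + g x) = L f + L g,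
  forall c f, bmeas f -> L (fun x => c * f x) = c * L f &
  forall f g, bmeas f -> bmeas g -> (forall x, f x <= g x) -> L f <= L g].

Lemma pos_linear_expect (P : probability X R) :
  pos_linear (fun f => \int[P]_x f x).
Proof. by split=> *; [exact: expectD|exact: expectZ|exact: le_expect]. Qed.

Lemma pos_linear_sum (L : (X -> R) -> R) (I : Type) (r : seq I) F :
  pos_linear L -> (forall i, bmeas (F i)) ->
  L (fun x => \sum_(i <- r) F i x) = \sum_(i <- r) L (F i).
Proof.
move=> [LD LZ _] bF; elim: r => [|i r IH].
  rewrite big_nil -[RHS](mul0r (L (fun=> 0))) -LZ; last exact: bmeas_cst.
  by congr L; apply/funext => x; rewrite big_nil mul0r.
rewrite big_cons -IH -LD//; last exact: bmeas_sum.
by congr L; apply/funext => x; rewrite big_cons.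
Qed.

(** A bounded measurable function lies uniformly within e of a combination of indicators, and
    positivity turns this into an error of e times the value at 1. Finite additivity is enough. *)
Lemma eq_pos_linear (L1 L2 : (X -> R) -> R) :
  pos_linear L1 -> pos_linear L2 ->
  (forall A, measurable A -> L1 \1_A = L2 \1_A) ->
  forall f, bmeas f -> L1 f = L2 f.
Proof.
move=> l1 l2 L12 f bf.
pose one : X -> R := fun=> 1.
have one1 : L1 one = L2 one.
  by have := L12 _ measurableT; rewrite indicT.
have Lcst L c : pos_linear L -> L (fun=> c) = c * L one.
  move=> [_ LZ _]; rewrite -LZ; last exact: bmeas_cst.
  by congr L; apply/funext => x; rewrite mulr1.
have one0 : 0 <= L1 one.
  rewrite -(mul0r (L1 one)) -Lcst//; case: l1 => _ _; apply; try exact: bmeas_cst.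
  by move=> x; exact: ler01.
have key e : 0 < e -> `|L1 f - L2 f| <= e * L1 one.
  move=> e0; have [n [A [M [mA fA]]]] := bmeas_approx bf e0.
  pose s x := \sum_(i < n) e * \1_(A i) x - M.
  have bs1 (i : 'I_n) : bmeas (fun x => e * (\1_(A i) x : R)).
    by apply: bmeasZ; exact: bmeas_indic.
  have bs : bmeas s by apply: bmeasD; [exact: bmeas_sum|exact: bmeas_cst].
  have Ls L : pos_linear L -> L s = \sum_(i < n) e * L \1_(A i) - M * L one.
    move=> lL; have [LD LZ _] := lL.
    rewrite /s LD; [|exact: bmeas_sum|exact: bmeas_cst].
    rewrite Lcst// mulNr; congr (_ - _); rewrite pos_linear_sum//.
    by apply: eq_bigr => i _; rewrite LZ//; exact: bmeas_indic.
  have s12 : L1 s = L2 s.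
    by rewrite !Ls// one1; under eq_bigr do rewrite L12//.
  have sL L : pos_linear L -> L s <= L f <= L s + e * L one.
    move=> lL; have [LD LZ Lle] := lL.
    rewrite Lle//; last by move=> x; have /andP[] := fA x.
    rewrite -Lcst// -LD//; last exact: bmeas_cst.
    apply: Lle => //; first by apply: bmeasD => //; exact: bmeas_cst.
    by move=> x; have /andP[] := fA x.
  have /andP[a1 a2] := sL _ l1; have /andP[b1 b2] := sL _ l2.
  by rewrite ler_norml -?one1 in b2 *; rewrite s12 in a1 a2; lra.
apply/eqP; rewrite -subr_eq0 -normr_eq0 eq_le normr_ge0 andbT.
apply/ler_addgt0Pl => e e0; rewrite addr0.
rewrite (le_trans (key (e / (L1 one + 1)) _))//.
  by rewrite divr_gt0// ltr_wpDl.
rewrite mulrAC ler_pdivrMr ?ltr_wpDl// ler_wpM2l ?(ltW e0)//.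
by rewrite lerDl.
Qed.

End simple_approximation.

(** * Densities and conditional expectations *)

Section densities.
Context {disp : measure_display} {X : measurableType disp} {R : realType}.

Lemma probability_of_set_function (m : set X -> \bar R) :
  m set0 = 0%E -> (forall A, 0 <= m A)%E -> semi_sigma_additive m ->
  m setT = 1%E -> exists P : probability X R, forall A, P A = m A.
Proof.
move=> m0 mge mS mT.
pose mu : {measure set X -> \bar R} := HB.pack m (isMeasure.Build _ _ _ m m0 mge mS).
pose P : probability X R :=
  HB.pack m (Measure.class mu) (Measure_isProbability.Build _ _ _ mu mT).
by exists P.
Qed.

Lemma integral_EFin_bmeas (P : probability X R) (f : X -> R) : bmeas f ->
  (\int[P]_x (f x)%:E = (\int[P]_x f x)%R%:E)%E.
Proof.
move=> bf; rewrite /Rintegral fineK//.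
by apply: integrable_fin_num => //; exact: bmeas_integrable.
Qed.

Lemma exists_density (P : probability X R) (g : X -> R) : bmeas g ->
  (forall x, 0 <= g x) -> \int[P]_x g x = 1 ->
  exists Q : probability X R, forall f, bmeas f ->
    \int[Q]_x f x = \int[P]_x (f x * g x).
Proof.
move=> bg g0 g1.
have [Q QE] : exists Q : probability X R, forall A,
    Q A = (\int[P]_(x in A) (g x)%:E)%E.
  apply: probability_of_set_function.
  - exact: integral_set0.
  - by move=> A; apply: integral_ge0 => x _; rewrite lee_fin.
  - apply: semi_sigma_additive_nng_induced => [|x]; last by rewrite lee_fin.
    by apply/measurable_EFinP; exact: bg.1.
  - by rewrite integral_EFin_bmeas// g1.
exists Q; apply: eq_pos_linear; first exact: pos_linear_expect.
  split=> [f h bf bh|c f bf|f h bf bh fh].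
  - rewrite -expectD; [|exact: bmeasM|exact: bmeasM].
    by apply: eq_Rintegral => x _; rewrite mulrDl.
  - rewrite -expectZ; last exact: bmeasM.
    by apply: eq_Rintegral => x _; rewrite mulrA.
  - by apply: le_expect; [exact: bmeasM|exact: bmeasM|move=> x; rewrite ler_wpM2r].
move=> A mA; apply: EFin_inj; rewrite expect_indic//.
rewrite -integral_EFin_bmeas; last by apply: bmeasM => //; exact: bmeas_indic.
rewrite [LHS]QE integral_mkcond; apply: eq_integral => x _.
by rewrite patchE indicE; case: ifP => _; rewrite ?mul1r ?mul0r.
Qed.

Lemma expect_distribution {d'} {Y : measurableType d'} (P : probability X R)
    (h : {mfun X >-> Y}) (f : Y -> R) : bmeas f ->
  \int[distribution P h]_y f y = \int[P]_x f (h x).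
Proof.
move=> bf; rewrite /Rintegral integral_distribution//.
  by apply/measurable_EFinP; exact: bf.1.
apply: (@bmeas_integrable _ _ _ P (f \o h)).
exact: bmeasT_comp.
Qed.

Lemma eq_expect (P Q : probability X R) (f : X -> R) :
  (forall A, measurable A -> P A = Q A) -> \int[P]_x f x = \int[Q]_x f x.
Proof.
by move=> PQ; congr fine; apply: eq_measure_integral => // A mA _; exact: PQ.
Qed.

Lemma integral_indicM (P : probability X R) (g : X -> R) (A : set X) :
  bmeas g -> measurable A ->
  (\int[P]_(x in A) (g x)%:E = (\int[P]_x (\1_A x * g x))%R%:E)%E.
Proof.
move=> bg mA; rewrite -integral_EFin_bmeas; last first.
  by apply: bmeasM => //; exact: bmeas_indic.
rewrite integral_mkcond; apply: eq_integral => x _.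
by rewrite patchE indicE; case: ifP => _; rewrite ?mul1r ?mul0r.
Qed.

(** Testing on the set where W < 0 forces the integral of |W| over that set to vanish. *)
Lemma ae_ge0_of_integrals (P : probability X R) (W : X -> R) :
  P.-integrable setT (EFin \o W) ->
  (forall A, measurable A -> (0 <= \int[P]_(x in A) (W x)%:E)%E) ->
  {ae P, forall x, 0 <= W x}.
Proof.
move=> iW W0; pose D := [set x | W x < 0].
have mW := measurable_int _ iW.
have mD : measurable D.
  rewrite -[D]setTI; have := emeasurable_fun_infty_o measurableT mW 0%E.
  by congr measurable; apply/seteqP; split=> x [? /= h]; split => //;
    rewrite /D/= in h *; rewrite ?lte_fin in h *.
have D0 : (\int[P]_(x in D) `|(EFin \o W) x| = 0)%E.
  apply/eqP; rewrite eq_le; apply/andP; split; last exact: integral_ge0.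
  rewrite (eq_integral (fun x => - (W x)%:E)%E); last first.
    by move=> x; rewrite inE => Dx; rewrite /= ltr0_norm.
  rewrite integralN/=; last first.
    have := integrableS measurableT mD (@subsetT _ D) iW.
    exact: integrable_add_def.
  by rewrite oppe_le0; exact: W0.
have := (ae_eq_integral_abs P mD (measurable_funTS mW)).1 D0.
apply: filterS => x /= h; rewrite leNgt; apply/negP => Wx.
by have := h Wx => -[]; apply/eqP; rewrite lt_eqF.
Qed.

End densities.

Section conditional_expectation.
Context {d d' : measure_display} {X : measurableType d} {Y : measurableType d'}.
Context {R : realType}.

(* Clipping the Radon-Nikodym derivative makes the bounds hold everywhere. *)
Lemma conditional_weight (P : probability X R) (h : {mfun X >-> Y}) (g : X -> R)
    (c : R) : bmeas g -> (forall x, 0 <= g x <= c) ->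
  exists w : Y -> R, [/\ bmeas w, forall y, 0 <= w y <= c &
    forall f, bmeas f ->
      \int[P]_x (f (h x) * g x) = \int[distribution P h]_y (f y * w y)].
Proof.
move=> bg gc; have ig := bmeas_integrable P bg.
have mh A : measurable A -> measurable (h @^-1` A).
  by move=> mA; rewrite -[X in measurable X]setTI; exact: (measurable_funPT h).
(* The weight is the conditional expectation of g given h, that is, the density of [nu] with respect
   to the law of h. *)
pose nu : set Y -> \bar R := fun A => (\int[P]_(x in h @^-1` A) (g x)%:E)%E.
have nu0 : nu set0 = 0%E by rewrite /nu preimage_set0 integral_set0.
have nufin A : measurable A -> nu A \is a fin_num.
  by move=> mA; rewrite /nu integral_indicM//; exact: mh.
have nuS : semi_sigma_additive nu.
  move=> F mF tF mUF; rewrite /nu preimage_bigcup.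
  apply: semi_sigma_additive_nng_induced.
  - by apply/measurable_EFinP; exact: bg.1.
  - by move=> x; rewrite lee_fin; have /andP[] := gc x.
  - by move=> n; exact: mh.
  - apply/trivIsetP => /= i j _ _ ij; rewrite -preimage_setI.
    by move/trivIsetP : tF => /(_ _ _ _ _ ij) ->//; rewrite preimage_set0.
  - by rewrite -preimage_bigcup; exact: mh.
pose nuC : {charge set Y -> \bar R} :=
  HB.pack nu (isCharge.Build _ _ _ nu nu0 nufin nuS).
pose mu : probability Y R := distribution P h.
have numu : nuC `<< mu.
  apply/null_content_dominatesP => A mA muA.
  rewrite -[nuC A]/(nu A) /nu; apply: null_set_integral => //; first exact: mh.
  by apply/measurable_EFinP/measurable_funTS; exact: bg.1.
pose w0 y := fine ((Radon_Nikodym nuC mu) y).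
have w0E y : (w0 y)%:E = (Radon_Nikodym nuC mu) y.
  by rewrite fineK//; exact: Radon_Nikodym_fin_num.
have iw0 : mu.-integrable setT (EFin \o w0).
  rewrite (_ : EFin \o w0 = Radon_Nikodym nuC mu); last exact/funext.
  exact: Radon_Nikodym_integrable.
have nuE A : measurable A -> nu A = (\int[mu]_(y in A) (w0 y)%:E)%E.
  move=> mA; rewrite -[nu A]/(nuC A) (Radon_Nikodym_integral numu mA).
  by apply: eq_integral => y _; rewrite w0E.
have mw0 : measurable_fun setT w0.
  by apply/measurable_EFinP; exact: measurable_int iw0.
pose w y := Num.max 0 (Num.min (w0 y) c).
(* X is inhabited by [point], which is what makes c nonnegative. *)
have c0 : 0 <= c by have /andP[h1 h2] := gc point; exact: le_trans h2.
have wc y : 0 <= w y <= c.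
  by rewrite /w le_max lexx/= ge_max c0 ge_min lexx orbT.
have bw : bmeas w.
  split; last by exists c => y; have /andP[w1 w2] := wc y; rewrite ger0_norm.
  by apply: measurable_maxr => //; apply: measurable_minr.
have ae_ww0 : {ae mu, forall y, w y = w0 y}.
  have h1 : {ae mu, forall y, 0 <= w0 y}.
    apply: ae_ge0_of_integrals => // A mA; rewrite -nuE//.
    by apply: integral_ge0 => x _; rewrite lee_fin; have /andP[] := gc x.
  have ic : mu.-integrable setT (EFin \o (fun=> c)).
    exact: bmeas_integrable (bmeas_cst c).
  have h2 : {ae mu, forall y, 0 <= c - w0 y}.
    apply: ae_ge0_of_integrals => [|A mA].
      exact: (integrableB measurableT ic iw0).
    have iA f : mu.-integrable setT f -> mu.-integrable A f.
      exact: (integrableS measurableT mA (@subsetT _ A)).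
    rewrite (integralB_EFin mA (iA _ ic) (iA _ iw0)).
    rewrite -nuE// integral_indicM//; last exact: bmeas_cst.
    rewrite /nu integral_indicM//; last exact: mh.
    rewrite -EFinB lee_fin subr_ge0 /mu expect_distribution; last first.
      by apply: bmeasM; [exact: bmeas_indic|exact: bmeas_cst].
    apply: le_expect.
    - by apply: bmeasM => //; apply: bmeas_indic; exact: mh.
    - apply: (@bmeasT_comp _ _ _ _ _ (h : X -> Y) (fun y => \1_A y * c)) => //.
      by apply: bmeasM; [exact: bmeas_indic|exact: bmeas_cst].
    - move=> x; rewrite !indicE.
      rewrite (_ : (x \in h @^-1` A) = (h x \in A)); last first.
        by apply/idP/idP; rewrite !inE.
      rewrite ler_wpM2l//.
      by have /andP[] := gc x.
  apply: filterS2 h1 h2 => y y1 y2; rewrite /w min_l ?max_r//.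
  by rewrite -subr_ge0.
exists w; split => //.
apply: eq_pos_linear.
- split=> [f k bf bk|a f bf|f k bf bk fk].
  + rewrite -expectD; try by apply: bmeasM => //; exact: bmeasT_comp.
    by apply: eq_Rintegral => x _; rewrite mulrDl.
  + rewrite -expectZ; last by apply: bmeasM => //; exact: bmeasT_comp.
    by apply: eq_Rintegral => x _; rewrite mulrA.
  + apply: le_expect; try by apply: bmeasM => //; exact: bmeasT_comp.
    by move=> x; rewrite ler_wpM2r//; have /andP[] := gc x.
- split=> [f k bf bk|a f bf|f k bf bk fk].
  + rewrite -expectD; try exact: bmeasM.
    by apply: eq_Rintegral => x _; rewrite mulrDl.
  + rewrite -expectZ; last exact: bmeasM.
    by apply: eq_Rintegral => x _; rewrite mulrA.
  + apply: le_expect; try exact: bmeasM.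
    by move=> x; rewrite ler_wpM2r//; have /andP[] := wc x.
move=> A mA; apply: EFin_inj; rewrite -integral_indicM//; last exact: mh.
transitivity (nu A); first by rewrite /nu integral_indicM//; exact: mh.
rewrite nuE//; transitivity (\int[mu]_(y in A) (w y)%:E)%E; last first.
  exact: integral_indicM.
apply: ae_eq_integral => //.
- exact/measurable_EFinP/measurable_funTS.
- by apply/measurable_EFinP/measurable_funTS; exact: bw.1.
- by apply: filterS ae_ww0 => y /= -> _.
Qed.

End conditional_expectation.

(** * Daniell representation *)

Section daniell.
Context {disp : measure_display} {X : measurableType disp} {R : realType}.
Variables (C : (X -> R) -> Prop) (L : (X -> R) -> R).
Hypothesis C_bmeas : forall f, C f -> bmeas f.
Hypothesis C_cst : forall c, C (fun=> c).
Hypothesis CD : forall f g, C f -> C g -> C (fun x => f x + g x).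
Hypothesis CM : forall f g, C f -> C g -> C (fun x => f x * g x).
Hypothesis C_max : forall f g, C f -> C g -> C (fun x => Num.max (f x) (g x)).
Hypothesis C_min : forall f g, C f -> C g -> C (fun x => Num.min (f x) (g x)).
Hypothesis L_pos : pos_linear L.
Hypothesis L1 : L (fun=> 1) = 1.
(** Compactness of the space enters the construction in this form only, as Dini's theorem. *)
Hypothesis C_dini : forall f : nat -> X -> R, (forall n, C (f n)) ->
  (forall n x, f n x <= f n.+1 x) -> (forall x, exists n, 1 <= f n x) ->
  forall e, 0 < e -> exists n, forall x, 1 - e <= f n x.
Hypothesis C_gen : (measurable : set (set X)) `<=`
  <<s [set A | exists h, [/\ C h, forall x, 0 <= h x & A = [set x | 0 < h x]]] >>.

Let LD f g : C f -> C g -> L (fun x => f x + g x) = L f + L g.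
Proof. by move=> /C_bmeas bf /C_bmeas bg; case: L_pos => h _ _; exact: h. Qed.

Let LZ c f : C f -> L (fun x => c * f x) = c * L f.
Proof. by move=> /C_bmeas bf; case: L_pos => _ h _; exact: h. Qed.

Let Lle f g : C f -> C g -> (forall x, f x <= g x) -> L f <= L g.
Proof. by move=> /C_bmeas bf /C_bmeas bg; case: L_pos => _ _; apply. Qed.

Let Lcst c : L (fun=> c) = c.
Proof.
rewrite -[RHS](mulr1) -[in RHS]L1 -LZ; last exact: C_cst.
by congr L; apply/funext => x; rewrite mulr1.
Qed.

Let CZ c f : C f -> C (fun x => c * f x).
Proof. by move=> Cf; exact: CM (C_cst c) Cf. Qed.

Let CB f g : C f -> C g -> C (fun x => f x - g x).
Proof.
move=> Cf Cg; have := CD Cf (CZ (-1) Cg); congr C.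
by apply/funext => x; rewrite mulN1r.
Qed.

Let LB f g : C f -> C g -> L (fun x => f x - g x) = L f - L g.
Proof.
move=> Cf Cg; rewrite -mulN1r -LZ// -LD//; last exact: CZ.
by congr L; apply/funext => x; rewrite mulN1r.
Qed.

(* Covers by increasing sequences instead of series make countable
   subadditivity a diagonal argument. *)
Definition daniell_cover (A : set X) (f : nat -> X -> R) (c : R) :=
  [/\ forall n, C (f n), forall n x, 0 <= f n x <= f n.+1 x,
      forall x, A x -> exists n, 1 <= f n x & forall n, L (f n) <= c].

Definition daniell_outer (A : set X) : R :=
  inf [set c | exists f, daniell_cover A f c].

Let cover_homo A f c : daniell_cover A f c ->
  forall m n x, (m <= n)%N -> f m x <= f n x.
Proof.
move=> [_ fS _ _] m n x mn; apply: (@homo_leq _ (fun n => f n x) <=%R) => //.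
- by move=> b a d; exact: le_trans.
- by move=> k; have /andP[] := fS k x.
Qed.

Let cover_ge0 A c : (exists f, daniell_cover A f c) -> 0 <= c.
Proof.
move=> [f [Cf fS _ fc]]; apply: le_trans (fc 0%N).
by rewrite -(Lcst 0); apply: Lle => // x; have /andP[] := fS 0%N x.
Qed.

Let cover_lb A : has_lbound [set c | exists f, daniell_cover A f c].
Proof. by exists 0 => c /= /cover_ge0. Qed.

Let cover1 A : exists f, daniell_cover A f 1.
Proof.
exists (fun _ _ => 1); split=> //.
- by move=> n x; rewrite ler01 lexx.
- by move=> x _; exists 0%N.
- by move=> _; rewrite Lcst.
Qed.

Let cover_inf A : has_inf [set c | exists f, daniell_cover A f c].
Proof. by split; [exists 1; exact: cover1|exact: cover_lb]. Qed.

Let outer_le A f c : daniell_cover A f c -> daniell_outer A <= c.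
Proof. by move=> Afc; apply: ge_inf => //; exists f. Qed.

Let outer_ge0 A : 0 <= daniell_outer A.
Proof. by apply: lb_le_inf => [|c /= /cover_ge0//]; exists 1; exact: cover1. Qed.

Let outer_adh A e : 0 < e -> exists f, daniell_cover A f (daniell_outer A + e).
Proof.
move=> e0; have [c [f fc] ce] := inf_adherent e0 (cover_inf A).
exists f; case: fc => h1 h2 h3 h4; split=> // n.
exact: le_trans (h4 n) (ltW ce).
Qed.

Let mu (A : set X) : \bar R := (daniell_outer A)%:E.

Let mu0 : mu set0 = 0%E.
Proof.
congr EFin; apply/eqP; rewrite eq_le outer_ge0 andbT.
apply: (@outer_le _ (fun _ _ => 0)); split=> //.
- by move=> n x; rewrite lexx.
- by move=> n; rewrite Lcst.
Qed.

Let mu_le : {homo mu : A B / A `<=` B >-> (A <= B)%E}.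
Proof.
move=> A B AB; rewrite lee_fin; apply: lb_le_inf; first by exists 1; exact: cover1.
move=> c [f [h1 h2 h3 h4]]; apply: (@outer_le _ f); split=> // x Ax.
exact: h3 (AB _ Ax).
Qed.

Let geom (e : R) n : \sum_(k < n) e / 2 ^+ k.+1 = e - e / 2 ^+ n.
Proof.
elim: n => [|n IH]; first by rewrite big_ord0 expr0 divr1 subrr.
by rewrite big_ord_recr/= IH exprS; field; rewrite expf_neq0.
Qed.

Let mu_sub : sigma_subadditive mu.
Proof.
move=> A; have [sfin|] := boolP ((\sum_(i <oo) mu (A i))%E \is a fin_num); last first.
  rewrite ge0_fin_numE; last by apply: nneseries_ge0 => *; rewrite lee_fin.
  by rewrite -leNgt leye_eq => /eqP ->; exact: leey.
rewrite -(fineK sfin); set s := fine _.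
have sums n : \sum_(k < n) daniell_outer (A k) <= s.
  rewrite -lee_fin /s fineK// -sumEFin -(big_mkord xpredT (fun i => mu (A i))).
  by apply: nneseries_lim_ge => *; rewrite lee_fin.
rewrite lee_fin; apply/ler_addgt0Pr => e e0.
have ek k : 0 < e / 2 ^+ k.+1 by rewrite divr_gt0// exprn_gt0.
pose f k := projT1 (cid (outer_adh (A k) (ek k))).
have fP k : daniell_cover (A k) (f k) (daniell_outer (A k) + e / 2 ^+ k.+1).
  by rewrite /f; case: cid.
pose F n x := \sum_(k < n) f k n x.
have f0 k n x : 0 <= f k n x by have [_ /(_ n x) /andP[]] := fP k.
have CF n (r : seq 'I_n) m : C (fun x => \sum_(k <- r) f k m x).
  elim: r => [|i r IH].
    have := C_cst 0; congr C; apply/funext => x; rewrite big_nil//.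
  have [h _ _ _] := fP i.
  by have := CD (h m) IH; congr C; apply/funext => x; rewrite big_cons.
apply: (@outer_le _ F); split.
- by move=> n; exact: CF.
- move=> n x; rewrite sumr_ge0//= /F big_ord_recr/= ler_wpDr//.
  apply: ler_sum => i _; have [_ /(_ n x) /andP[_]] := fP i; exact.
- move=> x [k _ Ax]; have [_ _ /(_ _ Ax)[n fn] _] := fP k.
  (* The index must exceed k, for the k-th cover to occur in the sum, and be at least n, for that
     cover to have reached 1 at x. *)
  exists (maxn k.+1 n); apply: le_trans fn _.
  apply: le_trans (cover_homo (fP k) x (leq_maxr k.+1 n)) _.
  have kn : (k < maxn k.+1 n)%N by exact: leq_maxl.
  rewrite /F (bigD1 (Ordinal kn))//= lerDl.
  by apply: sumr_ge0.
- move=> n; suff -> : L (F n) = \sum_(k < n) L (f k n).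
    apply: (@le_trans _ _ (\sum_(k < n) (daniell_outer (A k) + e / 2 ^+ k.+1))).
      by apply: ler_sum => i _; have [_ _ _] := fP i; exact.
    rewrite big_split/=; apply: lerD; first exact: sums.
    by rewrite geom gerBl divr_ge0 ?(ltW e0)// exprn_ge0.
  by apply: pos_linear_sum => // k; apply: C_bmeas; have [h _ _ _] := fP k.
Qed.

Let om : {outer_measure set X -> \bar R} :=
  HB.pack mu (isOuterMeasure.Build R X mu mu0
    (fun A => outer_ge0 A : (0 <= mu A)%E) mu_le mu_sub).

(** The functions th k = min(1, k h) increase to the indicator of h > 0. A nearly optimal cover f of
    E splits as f th + f (1 - th): the products f n * th n cover the part of E where h > 0, at cost
    at most their supremum S. For an m with L (f m * th m) close to S, the functions f (n + m) * (1
    - th m) cover the other part, at cost about that of E minus S. *)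
Let cozero_cara (h : X -> R) : C h -> (forall x, 0 <= h x) ->
  om.-caratheodory [set x | 0 < h x].
Proof.
move=> Ch h0; apply: le_caratheodory_measurable => E.
rewrite -EFinD lee_fin; apply/ler_addgt0Pr => e e0.
have [e20 e2] : 0 < e / 2 /\ e / 2 + e / 2 = e by split; lra.
have [f fE] := outer_adh E e20; have [Cf fS fcov fc] := fE.
pose th k x := Num.min 1 (k%:R * h x).
have Cth k : C (th k) by apply: C_min => //; exact: CZ.
have th01 k x : 0 <= th k x <= 1.
  by rewrite /th le_min ler01 mulr_ge0//= ge_min lexx.
have thS k x : th k x <= th k.+1 x.
  by rewrite /th le_min ge_min lexx/= ge_min ler_wpM2r ?ler_nat ?orbT.
have thhomo k l x : (k <= l)%N -> th k x <= th l x.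
  move=> kl; rewrite /th le_min ge_min lexx/= ge_min ler_wpM2r ?orbT//.
  by rewrite ler_nat.
have f0 n x : 0 <= f n x by have /andP[] := fS n x.
have Cft n k : C (fun x => f n x * th k x) by exact: CM.
pose S := sup [set L (fun x => f n x * th n x) | n in setT].
have supS : has_sup [set L (fun x => f n x * th n x) | n in setT].
  split; first by exists (L (fun x => f 0%N x * th 0%N x)), 0%N.
  exists (daniell_outer E + e / 2) => _ [n _ <-]; apply: le_trans (fc n).
  apply: Lle => // x; rewrite ler_piMr//; by have /andP[] := th01 n x.
have [_ [m _ <-] Sm] := sup_adherent e20 supS.
have O1 : daniell_outer (E `&` [set x | 0 < h x]) <= S.
  apply: (@outer_le _ (fun n x => f n x * th n x)); split=> //.
  - move=> n x; rewrite mulr_ge0//=; last by have /andP[] := th01 n x.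
    apply: ler_pM => //; first by have /andP[] := th01 n x.
    by have /andP[] := fS n x.
  - move=> x [Ex /= hx]; have [n fn] := fcov _ Ex.
    exists (maxn n (Num.truncn (h x)^-1).+1).
    rewrite -[leLHS]mulr1; apply: ler_pM => //.
      by apply: le_trans fn _; exact: cover_homo fE _ _ _ (leq_maxl _ _).
    rewrite /th le_min lexx/= -ler_pdivrMr// div1r.
    rewrite (le_trans (ltW (truncnS_gt _)))// ler_nat; exact: leq_maxr.
  - by move=> n; apply: ub_le_sup; [case: supS|exists n].
have O2 : daniell_outer (E `&` ~` [set x | 0 < h x]) <=
    daniell_outer E + e / 2 - (S - e / 2).
  apply: (@outer_le _ (fun n x => f (n + m)%N x - f (n + m)%N x * th m x)); split.
  - by move=> n; exact: CB.
  - move=> n x; rewrite -[X in X - _]mulr1 -mulrBr -[X in _ <= X - _]mulr1 -mulrBr.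
    have /andP[t0 t1] := th01 m x.
    rewrite mulr_ge0 ?subr_ge0//= ler_wpM2r ?subr_ge0// addSn.
    by have /andP[] := fS (n + m)%N x.
  - move=> x [Ex /= /negP]; rewrite -leNgt => hx; have [n fn] := fcov _ Ex.
    exists n; have -> : th m x = 0.
      have -> : th m x = Num.min 1 (m%:R * 0) by rewrite /th; congr (Num.min _ (_ * _));
        apply/eqP; rewrite eq_le hx h0.
      by rewrite mulr0 min_r.
    rewrite mulr0 subr0; apply: le_trans fn _.
    exact: cover_homo fE _ _ _ (leq_addr _ _).
  - move=> n; rewrite LB// lerB//.
    apply: le_trans (ltW Sm) _; apply: Lle => // x.
    rewrite ler_wpM2r//; first by have /andP[] := th01 m x.
    exact: cover_homo fE _ _ _ (leq_addl _ _).
rewrite -/(daniell_outer _) (le_trans (lerD O1 O2))//; lra.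
Qed.

Let measurable_cara (A : set X) : measurable A -> om.-caratheodory A.
Proof.
move=> /C_gen; apply: smallest_sub; last first.
  by move=> _ [h [Ch h0 ->]]; exact: cozero_cara.
split; first exact: caratheodory_measurable_set0.
  by move=> B; rewrite setTD; exact: caratheodory_measurable_setC.
by move=> F; exact: caratheodory_measurable_bigcup.
Qed.

(** The lower bound is where mass could be lost: by [C_dini], a cover of the whole space comes
    uniformly close to 1 at a finite stage. *)
Let outer_setT : daniell_outer setT = 1.
Proof.
apply/eqP; rewrite eq_le (outer_le (projT2 (cid (cover1 setT))))/=.
apply: lb_le_inf; first by exists 1; exact: cover1.
move=> c [f [Cf fS fcov fc]]; apply/ler_addgt0Pr => e e0.
have fS' n x : f n x <= f n.+1 x by have /andP[] := fS n x.
have [n fn] := C_dini Cf fS' (fun x => fcov x I) e0.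
rewrite -lerBlDr; apply: le_trans (fc n).
by rewrite -[leLHS]Lcst; exact: Lle.
Qed.

(** An upper bound for nonnegative f suffices: adding a constant extends it to all f, and applying
    it to - f reverses it. For that bound f is cut into horizontal slices [fi] of height e. The
    constant sequence e^-1 * fi i covers the level set A i, so e * P (A i) <= L (fi i), and the
    slices add up to at most f. *)
Lemma daniell_representation :
  exists P : probability X R, forall f, C f -> \int[P]_x f x = L f.
Proof.
have [P PE] : exists P : probability X R, forall A, P A = mu A.
  apply: probability_of_set_function => //.
  - move=> F mF tF mUF.
    apply: (@caratheodory_measure_sigma_additive _ _ om F) => //.
      by move=> i; exact: measurable_cara.
    exact: measurable_cara.
  - by rewrite /mu outer_setT.
exists P.
suff ub f : C f -> (forall x, 0 <= f x) -> \int[P]_x f x <= L f.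
  have ub' f : C f -> \int[P]_x f x <= L f.
    move=> Cf; have [M M0 fM] := bmeas_bound (C_bmeas Cf).
    have := ub _ (CD Cf (C_cst M)).
    rewrite expectD ?LD//; [|exact: C_bmeas|exact: bmeas_cst].
    rewrite expect_cst Lcst lerD2r; apply => x.
    by rewrite -lerBlDr sub0r; have := fM x; rewrite ler_norml => /andP[].
  move=> f Cf; apply/eqP; rewrite eq_le ub'//=.
  have := ub' _ (CZ (-1) Cf); rewrite expectZ; last exact: C_bmeas.
  by rewrite LZ// !mulN1r lerN2.
move=> Cf f0; apply/ler_addgt0Pl => e e0.
have [M M0 fM] := bmeas_bound (C_bmeas Cf).
pose n := (Num.truncn (M / e)).+1.
have fn x : f x <= e * n%:R.
  rewrite (le_trans (ler_norm _))// (le_trans (fM x))//.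
  by rewrite -ler_pdivrMl// mulrC ltW// truncnS_gt.
pose fi i x := Num.min (Num.max (f x - i%:R * e) 0) e.
have Cfi i : C (fi i).
  by apply: C_min => //; apply: C_max => //; apply: CB.
have fi0 i x : 0 <= fi i x by rewrite /fi le_min le_max lexx orbT ltW.
have fi1 i x : (i.+1%:R * e <= f x) = (1 <= e^-1 * fi i x).
  rewrite ler_pdivlMl// mulr1 /fi le_min lexx andbT le_max.
  by rewrite [e <= 0]leNgt e0 orbF lerBrDr -natr1 mulrDl mul1r [_ + e]addrC.
pose A i := [set x | 1 <= e^-1 * fi i x].
have mA i : measurable (A i).
  rewrite -[A i]setTI; have /measurable_EFinP := (C_bmeas (CZ e^-1 (Cfi i))).1.
  by move=> /(emeasurable_fun_c_infty measurableT) => /(_ 1%:E).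
have PA i : e * fine (P (A i)) <= L (fi i).
  rewrite -ler_pdivlMl// -LZ// PE /mu [leLHS]/=.
  apply: (@outer_le _ (fun _ x => e^-1 * fi i x)); split.
  - by move=> _; exact: CZ.
  - by move=> _ x; rewrite lexx andbT mulr_ge0// invr_ge0 ltW.
  - by move=> x Ax; exists 0%N.
  - by [].
clear PE.
have sumfi x k : \sum_(i < k) fi i x = Num.min (f x) (k%:R * e).
  elim: k => [|k IH]; first by rewrite big_ord0 mul0r min_r.
  rewrite big_ord_recr/= IH /fi -natr1 mulrDl mul1r.
  have [h1|h1] := leP (f x) (k%:R * e).
    rewrite max_r ?subr_le0// min_l ?(ltW e0)// addr0 min_l//.
    by rewrite (le_trans h1)// lerDl ltW.
  rewrite max_l ?subr_ge0 ?(ltW h1)//.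
  have [h2|h2] := leP (f x - k%:R * e) e.
    by rewrite addrC subrK min_l// -lerBlDl.
  by rewrite min_r// -lerBrDl ltW.
have bA (i : 'I_n) : bmeas (fun x => e * (\1_(A i) x : R)).
  by apply: bmeasZ; exact: bmeas_indic.
apply: (@le_trans _ _ (\int[P]_x (e + \sum_(i < n) e * (\1_(A i) x : R)))).
  apply: le_expect; first exact: C_bmeas.
    by apply: bmeasD; [exact: bmeas_cst|exact: bmeas_sum].
  move=> x; have /andP[+ _] := staircase (f0 x) (fn x) e0.
  rewrite lerBlDl => h; apply: le_trans h _; rewrite lerD2l.
  apply: ler_sum => i _; rewrite fi1 indicE ler_wpM2l ?(ltW e0)// ler_nat.
  by case: (boolP (1 <= _)) => [h1|_]; [rewrite mem_set|rewrite leq0n].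
rewrite expectD; [|exact: bmeas_cst|exact: bmeas_sum].
rewrite expect_cst lerD2l expect_sum//.
apply: (@le_trans _ _ (\sum_(i < n) L (fi i))).
  apply: ler_sum => i _; rewrite expectZ; last exact: bmeas_indic.
  apply: le_trans (PA i); rewrite -(expect_indic P (mA i))//.
rewrite -pos_linear_sum//; last by move=> i; exact: C_bmeas.
under eq_fun do rewrite sumfi.
by apply: Lle => // [|x]; [exact: C_min|rewrite ge_min lexx].
Qed.

End daniell.

Lemma continuous_dist {X : topologicalType} {R : realType} (f : X -> R) :
  (forall x e, 0 < e -> nbhs x [set y | `|f x - f y| < e]) <-> continuous f.
Proof.
split=> [h x|h x e e0]; first by apply/cvgrPdist_lt => e e0; exact: h.
by have /cvgrPdist_lt := h x; apply.
Qed.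

(** * Geometry of the torus *)

Section euclidean_theory.
Context {R : realType} {d : nat}.
Local Notation E := 'rV[R]_d.
Implicit Types u v w : E.

Lemma dotpDl u v w : dotp (u + v) w = dotp u w + dotp v w.
Proof. by rewrite -big_split; apply: eq_bigr => i _; rewrite mxE mulrDl. Qed.

Lemma dotpC u v : dotp u v = dotp v u.
Proof. by apply: eq_bigr => i _; rewrite mulrC. Qed.

Lemma dotpDr u v w : dotp w (u + v) = dotp w u + dotp w v.
Proof. by rewrite dotpC dotpDl !(dotpC w). Qed.

Lemma dotpZl c u v : dotp (c *: u) v = c * dotp u v.
Proof. by rewrite /dotp mulr_sumr; apply: eq_bigr => i _; rewrite mxE mulrA. Qed.

Lemma dotpNl u v : dotp (- u) v = - dotp u v.
Proof. by rewrite -scaleN1r dotpZl mulN1r. Qed.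

Lemma dotpNr u v : dotp u (- v) = - dotp u v.
Proof. by rewrite dotpC dotpNl dotpC. Qed.

Lemma dotp_ge0 u : 0 <= dotp u u.
Proof. by apply: sumr_ge0 => i _; rewrite -expr2 sqr_ge0. Qed.

Lemma enorm_ge0 u : 0 <= enorm u. Proof. exact: sqrtr_ge0. Qed.

Lemma enorm_sqr u : enorm u ^+ 2 = dotp u u.
Proof. by rewrite sqr_sqrtr// dotp_ge0. Qed.

Lemma enormN u : enorm (- u) = enorm u.
Proof. by rewrite /enorm dotpNl dotpNr opprK. Qed.

Lemma enorm0 : enorm (0 : E) = 0.
Proof. by rewrite /enorm /dotp big1 ?sqrtr0// => i _; rewrite mxE mul0r. Qed.

Lemma normr_coord_le u i : `|u ord0 i| <= enorm u.
Proof.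
rewrite -(@ler_pXn2r _ 2)// ?nnegrE ?enorm_ge0// enorm_sqr.
rewrite real_normK ?num_real// /dotp (bigD1 i)//= expr2 lerDl.
by apply: sumr_ge0 => j _; rewrite -expr2 sqr_ge0.
Qed.

(** Cauchy-Schwarz. The square of b u - a v is expanded for positive upper bounds a and b of the
    norms, since the norms themselves may vanish; the bounds are then lowered to the norms. With s
    as below, an excess of k / s over both norms changes their product by at most k. *)
Lemma dotp_le_enorm u v : dotp u v <= enorm u * enorm v.
Proof.
have h a b : 0 < a -> 0 < b -> dotp u u <= a ^+ 2 -> dotp v v <= b ^+ 2 ->
    dotp u v <= a * b.
  move=> a0 b0 ua vb.
  have := dotp_ge0 (b *: u - a *: v).
  rewrite dotpDl !dotpDr !dotpNl !dotpNr opprK !dotpZl ![dotp _ (_ *: _)]dotpC.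
  rewrite !dotpZl (dotpC v u) => h.
  rewrite -(ler_pM2l (mulr_gt0 a0 b0)).
  have h1 : b * (b * dotp u u) <= b * (b * a ^+ 2) by rewrite !ler_pM2l.
  have h2 : a * (a * dotp v v) <= a * (a * b ^+ 2) by rewrite !ler_pM2l.
  by nra.
have e e0 : 0 < e0 -> dotp u v <= (enorm u + e0) * (enorm v + e0).
  move=> e0p; apply: h; try by rewrite ltr_wpDl ?enorm_ge0.
    by rewrite -enorm_sqr ler_sqr ?nnegrE ?addr_ge0 ?enorm_ge0 ?ltW// ltrDl.
  by rewrite -enorm_sqr ler_sqr ?nnegrE ?addr_ge0 ?enorm_ge0 ?ltW// ltrDl.
apply/ler_addgt0Pr => k k0.
pose s := enorm u + enorm v + 1 + k; have s0 : 0 < s.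
  by rewrite /s ltr_wpDl// !addr_ge0 ?enorm_ge0.
apply: le_trans (e (k / s) (divr_gt0 k0 s0)) _.
have a := enorm_ge0 u; have b := enorm_ge0 v.
have ks : k / s * s = k by rewrite divfK// gt_eqF.
have k1 : k / s <= 1 by rewrite ler_pdivrMr// mul1r /s; lra.
have k2 : 0 < k / s by rewrite divr_gt0.
move: ks k1 k2; set t := k / s => ks k1 k2.
have : t * t <= t by rewrite ger_pMl.
rewrite -ks /s; nra.
Qed.

Lemma enormD u v : enorm (u + v) <= enorm u + enorm v.
Proof.
rewrite -(@ler_pXn2r _ 2)// ?nnegrE ?addr_ge0 ?enorm_ge0//.
rewrite enorm_sqr dotpDl !dotpDr (dotpC v u) sqrrD !enorm_sqr.
by have := dotp_le_enorm u v; lra.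
Qed.

Lemma enorm_le_sum u : enorm u <= \sum_i `|u ord0 i|.
Proof.
rewrite -(@ler_pXn2r _ 2)// ?nnegrE ?sumr_ge0 ?enorm_ge0//.
rewrite enorm_sqr expr2 mulr_suml; apply: ler_sum => i _.
rewrite (le_trans (ler_norm _))// normrM ler_wpM2l// (bigD1 i)//= lerDl.
exact: sumr_ge0.
Qed.

Lemma enorm_le_mx_norm u : enorm u <= d%:R * `|u|.
Proof.
apply: le_trans (enorm_le_sum u) _.
rewrite -[X in X%:R](card_ord d) -sum1_card natr_sum mulr_suml.
apply: ler_sum => i _; rewrite mul1r.
rewrite [leRHS]mx_normrE.
exact: (le_bigmax _ (fun ij : 'I_1 * 'I_d => `|u ij.1 ij.2|) (ord0, i)).
Qed.

Lemma enorm_dist u v : `|enorm u - enorm v| <= enorm (u - v).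
Proof.
rewrite ler_norml; apply/andP; split.
  have := enormD (v - u) u; rewrite subrK -(enormN (v - u)) opprB; lra.
by have := enormD (u - v) v; rewrite subrK; lra.
Qed.

Lemma enorm_continuous : continuous (@enorm R d).
Proof.
apply/continuous_dist => u e e0.
have h : 0 < e / (d%:R + 1) by rewrite divr_gt0// ltr_wpDl.
have := @nbhsx_ballx _ _ u _ h; apply: filterS => v.
rewrite -ball_normE/= => uv; apply: le_lt_trans (enorm_dist _ _) _.
apply: le_lt_trans (enorm_le_mx_norm _) _.
apply: le_lt_trans (_ : (d%:R + 1) * `|u - v| < e).
  by rewrite ler_wpM2r// lerDl.
by rewrite mulrC -ltr_pdivlMr// ltr_wpDl.
Qed.

Lemma continuous_measurable_rV (f : E -> R) :
  continuous f -> measurable_fun setT f.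
Proof.
move=> /continuousP cf; apply: (measurability _ (RGenOInfty.measurableE R)).
move=> _ [_ [x ->] <-]; rewrite setTI; apply: sub_sigma_algebra; apply: cf.
exact: rray_open.
Qed.

Lemma measurable_coord (i : 'I_d) : measurable_fun setT (fun v : E => v ord0 i).
Proof. by apply: continuous_measurable_rV; exact: coord_continuous. Qed.

Lemma measurable_enorm : measurable_fun setT (@enorm R d).
Proof. by apply: continuous_measurable_rV; exact: enorm_continuous. Qed.

End euclidean_theory.

Section torus_geometry.
Context {R : realType} {d : nat}.
Local Notation E := 'rV[R]_d.
Local Notation T := (torus R d).
Local Open Scope quotient_scope.
Implicit Types (x y z : T) (a b u v : E).

Lemma eq_piP a b : \pi_T a = \pi_T b <-> Zd_congr a b.
Proof.
exact: (rwP (@eqmodP _ (Zd_congr_equiv_rel R d) a b)).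
Qed.

Lemma pi_translate a b u : \pi_T a = \pi_T b -> \pi_T (a + u) = \pi_T (b + u).
Proof.
move=> /eq_piP /forallP ab; apply/eq_piP/forallP => i.
by rewrite (_ : _ - _ = b ord0 i - a ord0 i)// !mxE; ring.
Qed.

Lemma displacementsP x y v :
  displacements x y v <-> forall a, \pi_T a = x -> \pi_T (a + v) = y.
Proof.
split=> [[b by_ [a ax <-]] c cx|h].
  have := pi_translate (b - a) (etrans cx (esym ax)).
  by rewrite [X in _ = \pi X]addrC subrK => ->.
exists (repr x + v); first by apply: h; rewrite reprK.
by exists (repr x); [rewrite /= reprK|rewrite addrC addKr].
Qed.

Lemma displacements0 x : displacements x x 0.
Proof. by apply/displacementsP => a <-; rewrite addr0. Qed.

Lemma displacementsN x y v : displacements x y v -> displacements y x (- v).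
Proof.
move=> [b by_ [a ax <-]]; exists a => //; exists b => //.
by rewrite opprB.
Qed.

Lemma displacementsD x y z u v : displacements x y u -> displacements y z v ->
  displacements x z (u + v).
Proof.
move=> /displacementsP h1 /displacementsP h2; apply/displacementsP => a ax.
by rewrite addrA h2// h1.
Qed.

Lemma displacements_pi a b : displacements (\pi_T a) (\pi_T b) (b - a).
Proof. by exists b => //; exists a. Qed.

Lemma tdist_le x y v : displacements x y v -> tdist x y <= enorm v.
Proof.
move=> xyv; apply: ge_inf; last by exists v.
by exists 0 => _ [u _ <-]; exact: enorm_ge0.
Qed.

(** Each coordinate is reduced to its fractional part. This bounds the distance and exhibits the
    torus as the image of a cube. *)
Lemma small_displacement x y :
  exists v, displacements x y v /\ forall i, `|v ord0 i| <= 1.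
Proof.
pose v0 := repr y - repr x.
exists (\row_i (v0 ord0 i - (Num.floor (v0 ord0 i))%:~R)); split.
  apply/displacementsP => a ax; rewrite -(reprK y).
  apply/eq_piP; apply/forallP => i.
  have /eq_piP/forallP /(_ i) h : \pi_T (repr x) = \pi_T a by rewrite reprK ax.
  rewrite !mxE; set f := (Num.floor _)%:~R.
  rewrite (_ : _ - _ = f - (a ord0 i - (repr x : E) ord0 i)); last by ring.
  by apply: rpredB => //; exact: intr_int.
move=> i; rewrite mxE; have /andP[h1] := floor_itv (v0 ord0 i).
by rewrite intrD => h2; rewrite ger0_norm ?subr_ge0// lerBlDl ltW.
Qed.

Lemma tdist_lb x y : has_inf [set enorm v | v in displacements x y].
Proof.
split; last by exists 0 => _ [u _ <-]; exact: enorm_ge0.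
by have [v [xyv _]] := small_displacement x y; exists (enorm v), v.
Qed.

Lemma tdist_ge0 x y : 0 <= tdist x y.
Proof.
apply: lb_le_inf; first by have [] := tdist_lb x y.
by move=> _ [u _ <-]; exact: enorm_ge0.
Qed.

Lemma tdist_le_dim x y : tdist x y <= d%:R.
Proof.
have [v [xyv v1]] := small_displacement x y.
apply: le_trans (tdist_le xyv) _; apply: le_trans (enorm_le_sum v) _.
rewrite -[X in _ <= X%:R](card_ord d) -sum1_card natr_sum.
by apply: ler_sum.
Qed.

Lemma tdist_adh x y e : 0 < e ->
  exists2 v, displacements x y v & enorm v < tdist x y + e.
Proof.
by move=> e0; have [_ [v xyv <-] h] := inf_adherent e0 (tdist_lb x y); exists v.
Qed.

Lemma tdistxx x : tdist x x = 0.
Proof.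
apply/eqP; rewrite eq_le tdist_ge0 andbT -(@enorm0 R d).
exact/tdist_le/displacements0.
Qed.

Lemma tdist_triangle y x z : tdist x z <= tdist x y + tdist y z.
Proof.
apply/ler_addgt0Pr => e e0; have e20 : 0 < e / 2 by rewrite divr_gt0.
have [u xyu ul] := tdist_adh x y e20; have [v yzv vl] := tdist_adh y z e20.
have := tdist_le (displacementsD xyu yzv); have := enormD u v; lra.
Qed.

Lemma tdistC x y : tdist x y = tdist y x.
Proof.
suff h (s t : T) : tdist s t <= tdist t s by apply/eqP; rewrite eq_le !h.
apply/ler_addgt0Pr => e e0; have [u tsu ul] := tdist_adh t s e0.
by apply: le_trans (tdist_le (displacementsN tsu)) _; rewrite enormN ltW.
Qed.

Lemma tdist_lipschitz x y x' y' :
  `|tdist x y - tdist x' y'| <= tdist x x' + tdist y y'.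
Proof.
have h1 := tdist_triangle x' x y; have h2 := tdist_triangle y' x' y.
have h3 := tdist_triangle x x' y'; have h4 := tdist_triangle y x y'.
rewrite (tdistC y' y) (tdistC x' x) in h1 h2 h3 h4.
by rewrite ler_norml; apply/andP; split; lra.
Qed.

Lemma pi_torus_continuous : continuous (\pi_T : E -> T).
Proof. exact: pi_continuous. Qed.

(** Together with [open_tdist], this identifies the quotient topology with that of the distance. *)
Lemma nbhs_tdist x e : 0 < e -> \forall y \near x, tdist x y < e.
Proof.
move=> e0; suff oB : open [set y | tdist x y < e].
  by apply: open_nbhs_nbhs; split => //=; rewrite tdistxx.
rewrite /open/= /quotient_open openE => a /= ha.
have h : 0 < (e - tdist x (\pi_T a)) / (d%:R + 1).
  by rewrite divr_gt0 ?subr_gt0// ltr_wpDl.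
have := @nbhsx_ballx _ E a _ h; apply: (@filterS _ (nbhs a) (nbhs_filter a)) => b.
rewrite -ball_normE/= => ab.
have := tdist_triangle (\pi_T a) x (\pi_T b).
have := tdist_le (displacements_pi a b).
have := enorm_le_mx_norm (b - a); rewrite distrC.
have : (d%:R + 1) * `|a - b| < e - tdist x (\pi_T a).
  by rewrite mulrC -ltr_pdivlMr// ltr_wpDl.
by have : 0 <= `|a - b| by []; lra.
Qed.

Lemma open_tdist (O : set T) x : open O -> O x ->
  exists2 e, 0 < e & forall y, tdist x y < e -> O y.
Proof.
rewrite /open/= /quotient_open openE => oO Ox.
have : (\pi_T @^-1` O)^° (repr x) by apply: oO; rewrite /= reprK.
move=> /nbhs_ballP [e /= e0 eO].
exists e => // y xy; have e1 : 0 < e - tdist x y by rewrite subr_gt0.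
have [v /displacementsP xyv ve] := tdist_adh x y e1.
rewrite -(xyv _ (reprK x)); apply: eO; rewrite -ball_normE/=.
rewrite opprD addNKr normrN.
apply: le_lt_trans (_ : enorm v < e); last by lra.
rewrite [leLHS]mx_normrE; apply/bigmax_leP; split=> [|[i j] _]; first exact: enorm_ge0.
by rewrite ord1; exact: normr_coord_le.
Qed.

Lemma compact_torus : compact [set: T].
Proof.
have -> : [set: T] = \pi_T @` [set v : E | forall i, `[-1, 1]%classic (v ord0 i)].
  apply/seteqP; split=> // x _.
  have [v [/displacementsP h v1]] := small_displacement (\pi_T 0) x.
  exists v; last by rewrite -(h 0) ?add0r.
  by move=> i /=; rewrite in_itv/= -ler_norml.
apply: continuous_compact.
  by apply: continuous_subspaceT; exact: pi_torus_continuous.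
apply: (@rV_compact R d (fun=> `[-1, 1]%classic)) => _.
exact: segment_compact.
Qed.

Lemma continuous_measurable_torus (f : T -> R) :
  continuous f -> measurable_fun setT f.
Proof.
move=> /continuousP cf; apply: (measurability _ (RGenOInfty.measurableE R)).
move=> _ [_ [x ->] <-]; rewrite setTI; apply: sub_sigma_algebra; apply: cf.
exact: rray_open.
Qed.

Lemma continuous_bmeas_torus (f : T -> R) : continuous f -> bmeas f.
Proof.
move=> cf; split; first exact: continuous_measurable_torus.
have : compact (f @` [set: T]).
  apply: continuous_compact; last exact: compact_torus.
  exact: continuous_subspaceT.
move=> /compact_bounded [M [_ /(_ (M + 1))]].
rewrite ltrDl ltr01 => /(_ isT) h; exists (M + 1) => x.
by apply: h; exists x.
Qed.

Lemma lipschitz_continuous_torus (f : T -> R) :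
  (forall x y, `|f x - f y| <= tdist x y) -> continuous f.
Proof.
move=> lf; apply/continuous_dist => x e e0.
apply: (@filterS _ (nbhs x) (nbhs_filter x)) (nbhs_tdist x e0) => y.
exact: le_lt_trans.
Qed.

Lemma tdist_continuous : continuous (fun p : T * T => tdist p.1 p.2).
Proof.
apply/continuous_dist => -[x y] e e0.
have e20 : 0 < e / 2 by rewrite divr_gt0.
exists ([set z | tdist x z < e / 2], [set z | tdist y z < e / 2]).
  by split; exact: nbhs_tdist.
move=> [x' y'] [/= h1 h2]; apply: le_lt_trans (tdist_lipschitz _ _ _ _) _; lra.
Qed.

(** The function is the distance to the complement of O. The case O = setT is treated apart because
    [inf] of the empty set is 0. *)
Lemma open_cozero (O : set T) : open O -> exists h : T -> R,
  [/\ continuous h, forall x, 0 <= h x & O = [set x | 0 < h x]].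
Proof.
move=> oO; have [->|OT] := pselect (O = setT).
  exists (fun=> 1); split=> //; first exact: cst_continuous.
  by apply/seteqP; split=> // x _ /=; exact: ltr01.
pose h x := inf [set tdist x y | y in ~` O].
have nO : ~` O !=set0.
  by apply/set0P/negP => /eqP /(congr1 setC); rewrite setCK setC0.
have hlb x : has_inf [set tdist x y | y in ~` O].
  split; first by have [y Oy] := nO; exists (tdist x y), y.
  by exists 0 => _ [y _ <-]; exact: tdist_ge0.
have hle x x' : h x <= h x' + tdist x x'.
  rewrite -lerBlDr; apply: lb_le_inf; first by have [] := hlb x'.
  move=> _ [y Oy <-]; rewrite lerBlDr; apply: le_trans (_ : tdist x y <= _).
    by apply: ge_inf; [have [] := hlb x|exists y].
  by rewrite addrC; exact: tdist_triangle.
exists h; split.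
- apply: lipschitz_continuous_torus => x y.
  have := hle x y; have := hle y x; rewrite (tdistC y x) => h1 h2.
  by rewrite ler_norml; apply/andP; split; lra.
- move=> x; apply: lb_le_inf; first by have [] := hlb x.
  by move=> _ [y _ <-]; exact: tdist_ge0.
- apply/seteqP; split=> x.
    move=> Ox; have [e e0 eO] := open_tdist oO Ox; apply: lt_le_trans e0 _.
    apply: lb_le_inf; first by have [] := hlb x.
    by move=> _ [y Oy <-]; rewrite leNgt; apply/negP => /eO.
  move=> /= hx; apply: contrapT => Ox; suff : h x <= 0 by rewrite leNgt hx.
  by apply: ge_inf; [have [] := hlb x|exists x => //; exact: tdistxx].
Qed.

End torus_geometry.

Lemma cvg_pair_nbhs {U : Type} {X Y : topologicalType} (F : set_system U)
    (f : U -> X) (g : U -> Y) (x : X) (y : Y) : Filter F ->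
  f @ F --> x -> g @ F --> y -> (f u, g u) @[u --> F] --> (x, y).
Proof.
move=> FF fx gy A [[B C] /= [nB nC] BCA].
have FBC : F ((f @^-1` B) `&` (g @^-1` C)).
  by apply: filterI; [exact: fx|exact: gy].
apply: (@filterS _ F FF _ _ _ FBC) => u -[Bu Cu].
exact: (BCA (f u, g u) (conj Bu Cu)).
Qed.

Lemma cvg_initial {S : choiceType} {T : topologicalType} (f : S -> T)
    (F : set_system S) (s : S) : Filter F ->
  f @ F --> f s -> F --> (s : initial_topology f).
Proof.
move=> FF fs A /= [_ [[B oB <-] Bs BA]].
by apply: (@filterS _ F FF _ _ BA); apply: fs; exact: open_nbhs_nbhs.
Qed.

Lemma indistinguishable_initial {S : choiceType} {T : topologicalType} (f : S -> T)
    (s t : S) : f s = f t ->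
  nbhs (s : initial_topology f) = nbhs (t : initial_topology f).
Proof.
move=> st; apply/seteqP; split=> A /= [_ [[B oB <-] Bs BA]]; exists (f @^-1` B);
  by split=> //; [exists B|rewrite /= ?st// -st].
Qed.

(** * Compactness of transport plans *)

Section plans.
Context {R : realType} {d : nat}.
Local Notation T := (torus R d).
Local Notation P := (prob_torus R d).

Lemma cvg_prob_torus (U : Type) (F : set_system U) (mu : U -> P) (nu : P) :
  Filter F ->
  (forall f : T -> R, continuous f ->
    (\int[mu u]_x f x) @[u --> F] --> (\int[nu]_x f x : R)) ->
  mu @ F --> nu.
Proof.
move=> FF h; apply: cvg_initial; apply/cvg_sup => f.
by apply: cvg_initial; apply: h; exact: cts_fun.
Qed.

Lemma eq_nbhs_prob (mu nu : P) : (forall A, measurable A -> mu A = nu A) ->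
  nbhs mu = nbhs nu.
Proof.
move=> h; apply: indistinguishable_initial; apply/funext => f.
exact: eq_expect.
Qed.

Definition plan : Type := probability (T * T)%type R.

HB.instance Definition _ := Choice.on plan.

Definition fst_mfun : {mfun (T * T)%type >-> T} := mfun_Sub (mem_set measurable_fst).
Definition snd_mfun : {mfun (T * T)%type >-> T} := mfun_Sub (mem_set measurable_snd).

Definition marg1 (g : plan) : P := distribution g fst_mfun.
Definition marg2 (g : plan) : P := distribution g snd_mfun.

Definition plan_data (g : plan) : P * P * R := (marg1 g, marg2 g, transport_cost g).

(* Only the marginals and the cost enter the argument, so this coarse topology
   suffices, and it makes the cost continuous by construction. *)
HB.instance Definition _ := Topological.copy plan (initial_topology plan_data).

Lemma marg1E (g : plan) A : marg1 g A = g (A `*` setT).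
Proof.
have -> // : A `*` setT = fst_mfun @^-1` A :> set (T * T).
by apply/seteqP; split=> [[x y] []|[x y]].
Qed.

Lemma marg2E (g : plan) A : marg2 g A = g (setT `*` A).
Proof.
have -> // : setT `*` A = snd_mfun @^-1` A :> set (T * T).
by apply/seteqP; split=> [[x y] []|[x y]].
Qed.

Lemma expect_marg1 (g : plan) (f : T -> R) : bmeas f ->
  \int[marg1 g]_x f x = \int[g]_p f p.1.
Proof. exact: expect_distribution. Qed.

Lemma expect_marg2 (g : plan) (f : T -> R) : bmeas f ->
  \int[marg2 g]_x f x = \int[g]_p f p.2.
Proof. exact: expect_distribution. Qed.

Lemma bmeas_fst (f : T -> R) : bmeas f -> bmeas (fun p : T * T => f p.1).
Proof. by move=> bf; exact: bmeasT_comp. Qed.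

Lemma bmeas_snd (f : T -> R) : bmeas f -> bmeas (fun p : T * T => f p.2).
Proof. by move=> bf; exact: bmeasT_comp. Qed.

Lemma cvg_plan (U : Type) (F : set_system U) (mu : U -> plan) (nu : plan) :
  Filter F ->
  (forall f : T -> R, continuous f ->
    (\int[mu u]_p f p.1) @[u --> F] --> (\int[nu]_p f p.1 : R)) ->
  (forall f : T -> R, continuous f ->
    (\int[mu u]_p f p.2) @[u --> F] --> (\int[nu]_p f p.2 : R)) ->
  transport_cost (mu u) @[u --> F] --> (transport_cost nu : R) ->
  mu @ F --> nu.
Proof.
move=> FF h1 h2 h3; apply: cvg_initial.
suff : (marg1 (mu u), marg2 (mu u), transport_cost (mu u)) @[u --> F] -->
    (marg1 nu, marg2 nu, transport_cost nu) by [].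
apply: cvg_pair_nbhs => //; apply: cvg_pair_nbhs; apply: cvg_prob_torus => f cf.
  have bf := continuous_bmeas_torus cf.
  rewrite (expect_marg1 _ bf); under eq_fun do rewrite (expect_marg1 _ bf).
  exact: h1.
have bf := continuous_bmeas_torus cf.
rewrite (expect_marg2 _ bf); under eq_fun do rewrite (expect_marg2 _ bf).
exact: h2.
Qed.

End plans.

Lemma ultra_bounded_cvg {S : Type} {R : realType} (F : set_system S) (f : S -> R) M :
  UltraFilter F -> (forall s, `|f s| <= M) -> exists l : R, f @ F --> l.
Proof.
move=> FU fM; have PF : ProperFilter F := ultra_proper.
have := @segment_compact R (- M) M.
move=> /(_ (f @ F) _) [|l [_ cl]].
  apply: (@filterS _ F _ setT) filterT => s _ /=.
  by rewrite in_itv/= -ler_norml.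
exists l => A lA /=; have [//|FA] := in_ultra_setVsetC (f @^-1` A) FU.
have FA' : (f @ F) (~` A) by [].
by have [t []] := cl _ _ FA' lA.
Qed.

Section plans_compactness.
Context {R : realType} {d : nat}.
Local Notation T := (torus R d).
Variable delta : T * T -> 'rV[R]_d.
Hypothesis delta_min : min_displacement delta.

Lemma enorm_delta p : enorm (delta p) = tdist p.1 p.2.
Proof.
case: p => x y /=; have [_ /(_ x y)[xy dmin]] := delta_min.
apply/eqP; rewrite eq_le tdist_le// andbT.
apply: lb_le_inf; first by have [] := tdist_lb x y.
by move=> _ [v xyv <-]; exact: dmin.
Qed.

Lemma bmeas_tdist : bmeas (fun p : T * T => tdist p.1 p.2).
Proof.
split.
  rewrite (_ : (fun p => _) = @enorm R d \o delta); last first.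
    by apply/funext => p; rewrite /= enorm_delta.
  by apply: measurableT_comp; [exact: measurable_enorm|have [] := delta_min].
by exists d%:R => p; rewrite ger0_norm ?tdist_ge0// tdist_le_dim.
Qed.

Lemma bmeas_delta i : bmeas (fun p => delta p ord0 i).
Proof.
split.
  apply: (@measurableT_comp _ _ _ _ _ _ (fun v : 'rV[R]_d => v ord0 i)).
    exact: measurable_coord.
  by have [] := delta_min.
exists d%:R => p; apply: le_trans (normr_coord_le _ _) _.
by rewrite enorm_delta tdist_le_dim.
Qed.

Let C (f : T * T -> R) := continuous f /\ bmeas f.

Let C_fst (h : T -> R) : continuous h -> C (fun p => h p.1).
Proof.
move=> ch; split; last exact: bmeas_fst (continuous_bmeas_torus ch).
by move=> p; apply: continuous_comp; [exact: cvg_fst|exact: ch].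
Qed.

Let C_snd (h : T -> R) : continuous h -> C (fun p => h p.2).
Proof.
move=> ch; split; last exact: bmeas_snd (continuous_bmeas_torus ch).
by move=> p; apply: continuous_comp; [exact: cvg_snd|exact: ch].
Qed.

Let C_sqr_tdist : C (fun p => tdist p.1 p.2 ^+ 2).
Proof.
split; last exact: bmeasX bmeas_tdist.
rewrite (_ : (fun p => _) = fun p : T * T => tdist p.1 p.2 * tdist p.1 p.2).
  by move=> p; apply: cvgM; exact: tdist_continuous.
by apply/funext => p; rewrite expr2.
Qed.

Let compact_square : compact [set: T * T].
Proof. by rewrite -setXTT; apply: compact_setX; exact: compact_torus. Qed.

Let C_dini (f : nat -> T * T -> R) : (forall n, C (f n)) ->
  (forall n x, f n x <= f n.+1 x) -> (forall x, exists n, 1 <= f n x) ->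
  forall e, 0 < e -> exists n, forall x, 1 - e <= f n x.
Proof.
move=> Cf fS f1 e e0.
have fhomo m n x : (m <= n)%N -> f m x <= f n x.
  move=> mn; apply: (@homo_leq _ (fun n => f n x) <=%R) => //.
  by move=> b a c; exact: le_trans.
have /compact_near_coveringP/(_ nat \oo (fun n p => 1 - e <= f n p)) := compact_square.
case.
  move=> p _; have [n fn] := f1 p.
  have [/continuous_dist/(_ p e e0) cp _] := Cf n.
  exists ([set q | `|f n p - f n q| < e], [set m | (n <= m)%N]).
    by split => //; exists n.
  move=> [q m] [/= pq nm]; apply: le_trans (fhomo _ _ q nm).
  by move: pq; rewrite ltr_norml => /andP[? ?]; lra.
by move=> n _ /(_ n (leqnn n)) h; exists n => p; exact: h.
Qed.

(** The measurable structure on T * T is the product one, so it is enough to reach preimages of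
    Borel sets under each projection and their intersections. A cozero function of an open set of T,
    composed with a projection, lies in [C]. *)
Let C_gen : (measurable : set (set (T * T))) `<=`
  <<s [set A | exists h, [/\ C h, forall x, 0 <= h x & A = [set x | 0 < h x]]] >>.
Proof.
set S := <<s _ >>.
have SS : sigma_algebra setT S by exact: smallest_sigma_algebra.
have SI A B : S A -> S B -> S (A `&` B).
  move=> SA SB; have [_ Sc Su] := SS.
  rewrite -(setCK A) -(setCK B) -setCU -!setTD -bigcup2E; apply: (Sc).
  by apply: Su => -[|[|n]] /=; try exact: Sc; case: SS.
have Sfst (A : set T) : measurable A -> S (fst @^-1` A).
  suff h : <<s @open T >> `<=` [set A | S (fst @^-1` A)] by exact: h.
  apply: smallest_sub.
    have [S0 Sc Su] := SS; split=> [|B SB|F SF] /=; first by rewrite preimage_set0.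
      by rewrite setTD preimage_setC -setTD; exact: Sc.
    by rewrite preimage_bigcup; exact: Su.
  move=> O oO /=; have [h [ch h0 ->]] := open_cozero oO.
  apply: sub_sigma_algebra; exists (fun p => h p.1); split=> //.
  exact: C_fst.
have Ssnd (A : set T) : measurable A -> S (snd @^-1` A).
  suff h : <<s @open T >> `<=` [set A | S (snd @^-1` A)] by exact: h.
  apply: smallest_sub.
    have [S0 Sc Su] := SS; split=> [|B SB|F SF] /=; first by rewrite preimage_set0.
      by rewrite setTD preimage_setC -setTD; exact: Sc.
    by rewrite preimage_bigcup; exact: Su.
  move=> O oO /=; have [h [ch h0 ->]] := open_cozero oO.
  apply: sub_sigma_algebra; exists (fun p => h p.2); split=> //.
  exact: C_snd.
rewrite measurable_prod_measurableType; apply: smallest_sub => //.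
move=> _ [A mA] [B mB] <-.
exact: (SI _ _ (Sfst _ mA) (Ssnd _ mB)).
Qed.

Lemma compact_plan : compact [set: @plan R d].
Proof.
rewrite compact_ultra => F FU _.
pose L (f : T * T -> R) : R := lim ((fun g : @plan R d => \int[g]_p f p) @ F).
have PF : ProperFilter F by exact: ultra_proper.
have cvgL f : bmeas f -> (fun g : @plan R d => \int[g]_p f p) @ F --> L f.
  move=> bf; have [M M0 fM] := bmeas_bound bf.
  have [|l Fl] := @ultra_bounded_cvg _ _ F (fun g : @plan R d => \int[g]_p f p) M FU.
    by move=> g; exact: expect_norm_le.
  by rewrite /L (cvg_lim _ Fl).
have L1 : L (fun=> 1) = 1.
  rewrite /L (_ : (fun g => _) = fun=> 1).
    by apply: cvg_lim => //; exact: cvg_cst.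
  by apply/funext => g; rewrite expect_cst.
have L_pos : pos_linear L.
  split=> [f h bf bh|c f bf|f h bf bh fh].
  - rewrite {1}/L; under eq_fun do rewrite expectD//.
    by apply: cvg_lim => //; apply: cvgD; exact: cvgL.
  - rewrite {1}/L; under eq_fun do rewrite expectZ//.
    by apply: cvg_lim => //; apply: cvgMr; exact: cvgL.
  - apply: ler_cvg_to (cvgL _ bf) (cvgL _ bh) _.
    by apply: nearW => g; exact: le_expect.
(* L is defined on all bounded measurable functions, but g is only claimed to agree with it on [C].
   That is all the topology of plans tests: continuous functions of one coordinate, and the cost. *)
have [g gE] : exists g : plan, forall f, C f -> \int[g]_x f x = L f.
  apply: daniell_representation => //.
  - by move=> f [].
  - by move=> c; split; [exact: cst_continuous|exact: bmeas_cst].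
  - move=> f h [cf bf] [ch bh]; split; last exact: bmeasD.
    by move=> p; apply: cvgD; [exact: cf|exact: ch].
  - move=> f h [cf bf] [ch bh]; split; last exact: bmeasM.
    by move=> p; apply: cvgM; [exact: cf|exact: ch].
  - move=> f h [cf bf] [ch bh]; split; last exact: bmeas_max.
    by move=> p; apply: continuous_max; [exact: cf|exact: ch].
  - move=> f h [cf bf] [ch bh]; split; last exact: bmeas_min.
    by move=> p; apply: continuous_min; [exact: cf|exact: ch].
exists g; split=> //=.
apply: (@cvg_plan R d _ F idfun g) => [f cf|f cf|].
- by rewrite gE; [apply: cvgL; exact: (C_fst cf).2|exact: C_fst].
- by rewrite gE; [apply: cvgL; exact: (C_snd cf).2|exact: C_snd].
- by rewrite /transport_cost gE//; apply: cvgL; exact: C_sqr_tdist.2.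
Qed.

End plans_compactness.

(** * Upper semicontinuous functions *)

Section upper_semicontinuity.
Context {X : topologicalType} {R : realType}.
Implicit Types f g : X -> R.

Lemma uscP f :
  usc f <-> forall x a, f x < a -> nbhs x [set y | f y < a].
Proof.
split=> [h x a fa|h x a].
  have [] := h x (- a); first by rewrite lte_fin ltrN2.
  move=> V xV hV; apply: filterS xV => y Vy.
  by have := hV _ Vy; rewrite lte_fin ltrN2.
rewrite lte_fin ltrNr => fa; exists [set y | f y < - a]; first exact: h.
by move=> y /= fy; rewrite lte_fin ltrNr.
Qed.

Lemma usc_continuous f : continuous f -> usc f.
Proof.
move=> /continuous_dist cf; apply/uscP => x a fa.
have := cf x (a - f x); rewrite subr_gt0 => /(_ fa).
by apply: filterS => y /=; rewrite ltr_norml => /andP[]; lra.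
Qed.

Lemma uscD f g : usc f -> usc g -> usc (fun x => f x + g x).
Proof.
move=> /uscP uf /uscP ug; apply/uscP => x a fa.
pose e := (a - f x - g x) / 2.
have e0 : 0 < e by rewrite /e divr_gt0// ; lra.
have h1 : f x < f x + e by rewrite ltrDl.
have h2 : g x < g x + e by rewrite ltrDl.
apply: filterS (filterI (uf _ _ h1) (ug _ _ h2)) => y [/= y1 y2].
by rewrite /e in y1 y2; lra.
Qed.

(** The sets where f n < k are open and increase with n, so by compactness one of them contains K.
    This serves both to find maximizers and to keep them away from time 0. *)
Lemma usc_dini (K : set X) (f : nat -> X -> R) (k : R) : compact K ->
  (forall n, usc (f n)) -> (forall n x, f n.+1 x <= f n x) ->
  (forall x, K x -> exists n, f n x < k) ->
  exists n, forall m x, (n <= m)%N -> K x -> f m x < k.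
Proof.
move=> /compact_near_coveringP cK uf fS fk.
have fle m n x : (m <= n)%N -> f n x <= f m x.
  move=> mn; rewrite -(subnK mn); elim: (n - m)%N => // j IH.
  by rewrite addSn; exact: le_trans (fS _ _) IH.
have [|n _ h] := cK nat \oo (fun n x => f n x < k) _.
  move=> x Kx; have [n fn] := fk _ Kx.
  exists ([set y | f n y < k], [set m | (n <= m)%N]).
    by split; [move/uscP: (uf n); exact|exists n].
  by move=> [y m] [/= yk nm]; apply: le_lt_trans yk; exact: fle.
by exists n => m x nm; exact: h.
Qed.

Lemma usc_max (K : set X) f : compact K -> K !=set0 -> usc f ->
  exists2 x, K x & forall y, K y -> f y <= f x.
Proof.
move=> cK [x0 Kx0] uf.
have uc (c : R) : usc (fun x => f x + c).
  by apply: uscD => //; apply: usc_continuous; exact: cst_continuous.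
have [n ub] : exists n : nat, forall x, K x -> f x < n%:R.
  have [|n x|x _|n h] := @usc_dini K (fun n x => f x - n%:R) 0 cK.
  - by move=> n; exact: uc.
  - by rewrite lerD2l lerN2 ler_nat.
  - by exists (Num.truncn (f x)).+1; rewrite subr_lt0 truncnS_gt.
  - by exists n => x Kx; have := h n x (leqnn _) Kx; rewrite subr_lt0.
pose S := sup (f @` K).
have hS : has_sup (f @` K).
  by split; [exists (f x0), x0|exists n%:R => _ [x Kx <-]; exact/ltW/ub].
have fS x : K x -> f x <= S by move=> Kx; apply: ub_le_sup; [case: hS|exists x].
have [[x Kx fx]|noS] := pselect (exists2 x, K x & f x = S).
  by exists x => // y Ky; rewrite fx fS.
(* If the supremum S is not attained, f + 1 / (n + 1) gets below S at every point of K, hence on all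
   of K for a single n, and S is not the supremum. *)
have [|m x|x Kx|m h] := @usc_dini K (fun n x => f x + n.+1%:R^-1) S cK.
- by move=> m; exact: uc.
- by rewrite lerD2l lef_pV2 ?posrE// ler_nat.
- have fxS : 0 < S - f x.
    rewrite subr_gt0 lt_neqAle fS// andbT; apply/eqP => fxS.
    by apply: noS; exists x.
  exists (Num.truncn (S - f x)^-1); rewrite addrC -ltrBrDr.
  by rewrite invf_plt ?posrE// truncnS_gt.
- have m0 : 0 < m.+1%:R^-1 :> R by rewrite invr_gt0.
  have [_ [x Kx <-]] := sup_adherent m0 hS.
  have := h m x (leqnn _) Kx; rewrite -/S -ltrBrDr => h1 h2.
  by have := lt_trans h1 h2; rewrite ltxx.
Qed.

(** Local boundedness makes the [limf_esup] finite, so that [fine] does not send it to a default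
    value. *)
Lemma le_usc_envelope f x : locally_bounded f -> f x <= usc_envelope f x.
Proof.
move=> /(_ x)[M fM]; rewrite /usc_envelope; set L := limf_esup _ _.
have lb : ((f x)%:E <= L)%E.
  apply: le_ereal_inf_tmp => _ [V xV <-]; apply: ereal_sup_ubound.
  by exists x => //; exact: nbhs_singleton.
have ub : (L <= M%:E)%E.
  apply: ge_ereal_inf; exists (ereal_sup ((fun y => (f y)%:E) @` [set y | `|f y| <= M])).
    by exists [set y | `|f y| <= M].
  apply: ge_ereal_sup => _ [y /= fy <-]; rewrite lee_fin.
  exact: le_trans (ler_norm _) fy.
rewrite -lee_fin fineK// fin_numE; apply/andP; split.
  by rewrite -ltNye; exact: lt_le_trans (ltNyr _) lb.
by rewrite -ltey; exact: le_lt_trans ub (ltry _).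
Qed.

Lemma lsc_envelopeE f : lsc_envelope f = \- usc_envelope (\- f).
Proof. by apply/funext => x; rewrite /lsc_envelope /limf_einf fineN. Qed.

Lemma ge_lsc_envelope f x : locally_bounded f -> lsc_envelope f x <= f x.
Proof.
move=> bf; rewrite lsc_envelopeE/= lerNl; apply: le_usc_envelope => y.
by have [M fM] := bf y; exists M; apply: filterS fM => z; rewrite normrN.
Qed.

End upper_semicontinuity.

Lemma usc_comp {X Y : topologicalType} {R : realType} (f : Y -> R) (g : X -> Y) :
  usc f -> continuous g -> usc (fun x => f (g x)).
Proof.
move=> /uscP uf cg; apply/uscP => x a fa.
exact: (cg x [set y | f y < a] (uf _ _ fa)).
Qed.

Lemma continuous_time_val {R : realType} : continuous (@time_val R).
Proof. exact: initial_continuous. Qed.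

Lemma time_val_ge0 {R : realType} (t : time R) : 0 <= time_val t.
Proof. exact: set_mem (valP t). Qed.

Lemma compact_time {R : realType} (T : R) :
  compact [set t : time R | time_val t <= T].
Proof.
have h0 (r : R) : [set t : R | 0 <= t] (Num.max r 0) by rewrite /= le_max lexx orbT.
pose c (r : R) : time R := exist _ (Num.max r 0) (mem_set (h0 r)).
have cc : continuous c.
  apply: continuous_comp_initial => r.
  by apply: continuous_max; [exact: cvg_id|exact: cvg_cst].
have -> : [set t : time R | time_val t <= T] = c @` `[0, T]%classic.
  apply/seteqP; split=> t.
    move=> /= tT; exists (time_val t); first by rewrite /= in_itv/= time_val_ge0.
    by apply: val_inj; rewrite /= max_l// time_val_ge0.
  by move=> [r /=]; rewrite in_itv/= => /andP[r0 rT] <-; rewrite /time_val/= max_l.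
apply: continuous_compact; last exact: segment_compact.
exact: continuous_subspaceT.
Qed.

(** * Gluing of transport plans *)

Section gluing.
Context {d1 d2 : measure_display} {X1 : measurableType d1} {X2 : measurableType d2}.
Context {R : realType}.

Lemma exists_product (P1 : probability X1 R) (P2 : probability X2 R) :
  exists Q : probability (X1 * X2)%type R, forall u k, bmeas u -> bmeas k ->
    \int[Q]_w (u w.1 * k w.2) = (\int[P1]_x u x) * (\int[P2]_y k y).
Proof.
pose P12 : {measure set (X1 * X2)%type -> \bar R} := (P1 \x P2)%E.
have P12T : P12 setT = 1%E.
  have e : P12 (setT `*` setT) = (P1 setT * P2 setT)%E.
    exact: product_measure1E.
  by rewrite -setXTT e !probability_setT mule1.
have [Q QE] : exists Q : probability (X1 * X2)%type R, forall A, Q A = P12 A.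
  exact: (probability_of_set_function (measure0 P12) (measure_ge0 P12)
    (@measure_semi_sigma_additive _ _ _ P12) P12T).
exists Q => u k bu bk.
have bf : bmeas (fun w : X1 * X2 => u w.1 * k w.2).
  by apply: bmeasM; exact: bmeasT_comp.
have intf := bmeas_integrable Q bf.
apply: EFin_inj; rewrite -integral_EFin_bmeas//.
rewrite (eq_measure_integral P12); last by move=> A mA _; exact: QE.
have intf' : P12.-integrable setT (fun w => (u w.1 * k w.2)%:E).
  move/integrableP : intf => [mf ltf]; apply/integrableP; split=> //.
  rewrite (eq_measure_integral Q)//; by move=> A mA _; rewrite [RHS]QE.
rewrite -(integral12_prod_meas1 intf') /fubini_F/=.
have -> : (\int[P1]_x \int[P2]_y (u x * k y)%:E =
    \int[P1]_x ((\int[P2]_y k y)%R * u x)%:E)%E.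
  apply: eq_integral => x _; rewrite integral_EFin_bmeas; last exact: bmeasZ.
  by rewrite expectZ// mulrC.
rewrite (integral_EFin_bmeas P1 (bmeasZ (\int[P2]_y k y) bu)) (expectZ P1 _ bu).
by rewrite mulrC.
Qed.

Lemma label_decomposition {d} {X : measurableType d} (I : finType) (c : X -> I)
    (P : probability X R) (f : X -> R) : bmeas f ->
    (forall i, measurable (c @^-1` [set i])) ->
  \int[P]_x f x = \sum_i \int[P]_x (f x * \1_(c @^-1` [set i]) x).
Proof.
move=> bf mc; rewrite -expect_sum; last first.
  by move=> i; apply: bmeasM => //; exact: bmeas_indic.
apply: eq_Rintegral => x _; rewrite (bigD1 (c x))//= big1 => [|i ix].
  by rewrite indicE mem_set//= mulr1 addr0.
by rewrite indicE memNset ?mulr0//= => /esym/eqP; rewrite (negPf ix).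
Qed.

(* Two probabilities carrying finite labels with the same law are coupled by
   making them independent conditionally on the label. *)
Lemma exists_gluing (I : finType) (c1 : X1 -> I) (c2 : X2 -> I)
    (P1 : probability X1 R) (P2 : probability X2 R) (m : I -> R) :
    (forall i, measurable (c1 @^-1` [set i])) ->
    (forall i, measurable (c2 @^-1` [set i])) ->
    (forall i, \int[P1]_x \1_(c1 @^-1` [set i]) x = m i) ->
    (forall i, \int[P2]_x \1_(c2 @^-1` [set i]) x = m i) ->
  exists Q : probability (X1 * X2)%type R, forall u k, bmeas u -> bmeas k ->
    \int[Q]_w (u w.1 * k w.2) = \sum_i (m i)^-1 *
      (\int[P1]_x (u x * \1_(c1 @^-1` [set i]) x)) *
      (\int[P2]_x (k x * \1_(c2 @^-1` [set i]) x)).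
Proof.
move=> mc1 mc2 m1 m2; have [Q0 Q0E] := exists_product P1 P2.
pose i1 i : X1 -> R := \1_(c1 @^-1` [set i]).
pose i2 i : X2 -> R := \1_(c2 @^-1` [set i]).
have b1 i : bmeas (i1 i) by exact: bmeas_indic.
have b2 i : bmeas (i2 i) by exact: bmeas_indic.
have m_ge0 i : 0 <= m i.
  by rewrite -m1; apply: expect_ge0 => x; rewrite indicE.
(* The density of the gluing with respect to the product: the block where both labels are i is
   reweighted by 1 / m i. Null labels get weight 0, as 0^-1 = 0. *)
pose g w := \sum_i (m i)^-1 * (i1 i w.1 * i2 i w.2).
have bg1 i : bmeas (fun w : X1 * X2 => i1 i w.1 * i2 i w.2).
  by apply: bmeasM; exact: bmeasT_comp.
have bg : bmeas g by apply: bmeas_sum => i; exact: bmeasZ.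
have E1 i : \int[P1]_x i1 i x = m i := m1 i.
have E2 i : \int[P2]_x i2 i x = m i := m2 i.
have summ : \sum_i m i = 1.
  rewrite -(expect_cst P1 1) (label_decomposition P1 (bmeas_cst 1) mc1).
  apply: eq_bigr => i _; rewrite -m1; apply: eq_Rintegral => x _.
  by rewrite mul1r.
have [Q QE] : exists Q : probability (X1 * X2)%type R, forall f, bmeas f ->
    \int[Q]_x f x = \int[Q0]_x (f x * g x).
  apply: exists_density => //.
    move=> w; apply: sumr_ge0 => i _; rewrite mulr_ge0 ?invr_ge0//.
    by rewrite mulr_ge0// indicE.
  rewrite expect_sum; last by move=> i; exact: bmeasZ.
  rewrite -summ; apply: eq_bigr => i _; rewrite expectZ// Q0E// E1 E2.
  have [->|mi] := eqVneq (m i) 0; first by rewrite !mulr0.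
  by rewrite mulKf.
exists Q => u k bu bk; rewrite QE; last by apply: bmeasM; exact: bmeasT_comp.
have bu1 i : bmeas (fun x => u x * i1 i x) by exact: bmeasM.
have bk1 i : bmeas (fun x => k x * i2 i x) by exact: bmeasM.
transitivity (\int[Q0]_w (\sum_i (m i)^-1 *
    ((u w.1 * i1 i w.1) * (k w.2 * i2 i w.2)))).
  apply: eq_Rintegral => w _; rewrite /g mulr_sumr; apply: eq_bigr => i _.
  by ring.
rewrite expect_sum; last first.
  move=> i; apply: bmeasZ; apply: bmeasM.
    exact: (bmeasT_comp measurable_fst (bu1 i)).
  exact: (bmeasT_comp measurable_snd (bk1 i)).
apply: eq_bigr => i _; rewrite expectZ; last first.
  apply: bmeasM.
    exact: (bmeasT_comp measurable_fst (bu1 i)).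
  exact: (bmeasT_comp measurable_snd (bk1 i)).
by rewrite (Q0E _ _ (bu1 i) (bk1 i)) mulrA.
Qed.

End gluing.

(** The label of x records, for every j, the cell of a grid of mesh e that contains u j x.
    Boundedness leaves finitely many cells, and B bounds their number for all j at once. *)
Lemma exists_labels {disp : measure_display} {X : measurableType disp} {R : realType}
    (J : finType) (u : J -> X -> R) (e : R) : (forall j, bmeas (u j)) -> 0 < e ->
  exists (I : finType) (c : X -> I), (forall i, measurable (c @^-1` [set i])) /\
    forall x y, c x = c y -> forall j, `|u j x - u j y| <= e.
Proof.
move=> bu e0.
pose M j := sval (cid2 (bmeas_bound (bu j))).
have M0 j : 0 < M j by rewrite /M; case: cid2.
have uM j x : - M j <= u j x <= M j by rewrite -ler_norml /M; case: cid2.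
pose B := \sum_j (Num.truncn ((M j + M j) / e)).
pose lab j x := Num.truncn ((u j x + M j) / e).
have lab0 j x : 0 <= (u j x + M j) / e.
  by rewrite divr_ge0 ?(ltW e0)// -lerBlDr sub0r; have /andP[] := uM j x.
have labB j x : (lab j x < B.+1)%N.
  rewrite ltnS /B (bigD1 j)//= (leq_trans _ (leq_addr _ _))//.
  apply: le_truncn; rewrite ler_pM2r ?invr_gt0// lerD2r.
  by have /andP[] := uM j x.
exists {ffun J -> 'I_B.+1}, (fun x => [ffun j => Ordinal (labB j x)]); split.
  move=> i; rewrite (_ : _ @^-1` _ =
      \bigcap_(j in [set: J]) [set x | lab j x = i j]); last first.
    apply/seteqP; split=> x /=.
      by move=> /ffunP xi j _ /=; have := xi j; rewrite ffunE => <-.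
    by move=> xi; apply/ffunP => j; rewrite ffunE; apply: val_inj; exact: xi.
  apply: fin_bigcap_measurable => // j _.
  rewrite (_ : [set x | _] = [set x | (i j)%:R * e <= u j x + M j] `&`
      [set x | u j x + M j < (i j).+1%:R * e]); last first.
    apply/seteqP; split=> x /=.
      move=> <-; have /andP[] := truncn_itv (lab0 j x).
      by rewrite ler_pdivlMr// ltr_pdivrMr.
    move=> [h1 h2]; apply: truncn_def.
    by rewrite ler_pdivlMr// ltr_pdivrMr// h1.
  have /measurable_EFinP mu := (bmeasD (bu j) (bmeas_cst (M j))).1.
  apply: measurableI; rewrite -[X in measurable X]setTI.
    exact: (emeasurable_fun_c_infty measurableT mu ((i j)%:R * e)%:E).
  exact: (emeasurable_fun_infty_o measurableT mu ((i j).+1%:R * e)%:E).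
move=> x y /ffunP xy j; have := xy j; rewrite !ffunE => /(congr1 val)/= lxy.
have /andP[] := truncn_itv (lab0 j x); have /andP[] := truncn_itv (lab0 j y).
rewrite -/(lab j x) -/(lab j y) -lxy !ler_pdivlMr// !ltr_pdivrMr// -natr1.
by move=> h1 h2 h3 h4; rewrite ler_norml; apply/andP; split; lra.
Qed.

Section gluing_properties.
Context {d1 d2 : measure_display} {X1 : measurableType d1} {X2 : measurableType d2}.
Context {R : realType} (I : finType) (c1 : X1 -> I) (c2 : X2 -> I).
Context (P1 : probability X1 R) (P2 : probability X2 R) (m : I -> R).
Context (Q : probability (X1 * X2)%type R).
Hypothesis mc1 : forall i, measurable (c1 @^-1` [set i]).
Hypothesis mc2 : forall i, measurable (c2 @^-1` [set i]).
Hypothesis m1 : forall i, \int[P1]_x \1_(c1 @^-1` [set i]) x = m i.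
Hypothesis m2 : forall i, \int[P2]_x \1_(c2 @^-1` [set i]) x = m i.
Hypothesis QE : forall u k, bmeas u -> bmeas k ->
  \int[Q]_w (u w.1 * k w.2) = \sum_i (m i)^-1 *
      (\int[P1]_x (u x * \1_(c1 @^-1` [set i]) x)) *
      (\int[P2]_x (k x * \1_(c2 @^-1` [set i]) x)).

Let null_label {d} {X : measurableType d} (c : X -> I) (P : probability X R) u i :
  measurable (c @^-1` [set i]) -> bmeas u ->
  \int[P]_x \1_(c @^-1` [set i]) x = 0 ->
  \int[P]_x (u x * \1_(c @^-1` [set i]) x) = 0.
Proof.
move=> mc bu P0; have [M M0 uM] := bmeas_bound bu.
have bi := bmeas_indic mc : bmeas (\1_(c @^-1` [set i]) : X -> R).
have i0 x : 0 <= \1_(c @^-1` [set i]) x :> R by rewrite indicE.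
apply/eqP; rewrite eq_le; apply/andP; split.
  rewrite -(mulr0 M) -P0 -expectZ//; apply: le_expect; [exact: bmeasM|exact: bmeasZ|].
  by move=> x; rewrite ler_wpM2r// (le_trans (ler_norm _)).
rewrite -(mulr0 (- M)) -P0 -expectZ//; apply: le_expect; [exact: bmeasZ|exact: bmeasM|].
by move=> x; rewrite ler_wpM2r//; have := uM x; rewrite ler_norml => /andP[].
Qed.

Lemma gluing_fst u : bmeas u -> \int[Q]_w u w.1 = \int[P1]_x u x.
Proof.
move=> bu; have := QE bu (bmeas_cst 1).
under eq_Rintegral do rewrite mulr1.
move=> ->; rewrite (label_decomposition P1 bu mc1); apply: eq_bigr => i _.
under [X in _ * X = _]eq_Rintegral do rewrite mul1r.
rewrite m2; have [mi|mi] := eqVneq (m i) 0.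
  by rewrite mi mulr0 null_label// m1.
by rewrite mulrAC mulVf// mul1r.
Qed.

Lemma gluing_snd k : bmeas k -> \int[Q]_w k w.2 = \int[P2]_x k x.
Proof.
move=> bk; have := QE (bmeas_cst 1) bk.
under eq_Rintegral do rewrite mul1r.
move=> ->; rewrite (label_decomposition P2 bk mc2); apply: eq_bigr => i _.
under [X in _ * X * _ = _]eq_Rintegral do rewrite mul1r.
rewrite m1; have [mi|mi] := eqVneq (m i) 0.
  by rewrite mi mulr0 mul0r null_label// m2.
by rewrite mulVf// mul1r.
Qed.

(** Q is concentrated on pairs with equal labels: f is dominated by M times the indicator of unequal
    labels, whose integral is 1 - 1 = 0. *)
Lemma gluing_le0 (f : X1 * X2 -> R) : bmeas f ->
  (forall w, c1 w.1 = c2 w.2 -> f w <= 0) -> \int[Q]_w f w <= 0.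
Proof.
move=> bf f0; have [M M0 fM] := bmeas_bound bf.
pose i1 i : X1 -> R := \1_(c1 @^-1` [set i]).
pose i2 i : X2 -> R := \1_(c2 @^-1` [set i]).
have b1 i : bmeas (i1 i) by exact: bmeas_indic.
have b2 i : bmeas (i2 i) by exact: bmeas_indic.
have b12 i : bmeas (fun w : X1 * X2 => i1 i w.1 * i2 i w.2).
  by apply: bmeasM; exact: bmeasT_comp.
have i1E i x : i1 i x = (c1 x == i)%:R.
  by rewrite /i1 indicE; congr (nat_of_bool _)%:R; apply/idP/eqP; rewrite inE.
have i2E i x : i2 i x = (c2 x == i)%:R.
  by rewrite /i2 indicE; congr (nat_of_bool _)%:R; apply/idP/eqP; rewrite inE.
have bS : bmeas (fun w : X1 * X2 => \sum_i i1 i w.1 * i2 i w.2) by exact: bmeas_sum.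
apply: (@le_trans _ _ (\int[Q]_w (M * (1 - \sum_i i1 i w.1 * i2 i w.2)))).
  apply: le_expect => //; first by apply: bmeasZ; apply: bmeasB => //; exact: bmeas_cst.
  move=> w; under eq_bigr do rewrite i1E i2E.
  rewrite (bigD1 (c1 w.1))//= eqxx mul1r big1 ?addr0; last first.
    by move=> i; rewrite eq_sym => /negPf ->; rewrite mul0r.
  have [e|_] := eqVneq (c2 w.2) (c1 w.1); last first.
    by rewrite subr0 mulr1 (le_trans (ler_norm _)).
  by rewrite subrr mulr0; exact: f0.
rewrite expectZ; last by apply: bmeasB => //; exact: bmeas_cst.
rewrite expectB//; last exact: bmeas_cst.
rewrite expect_cst expect_sum//.
suff -> : \sum_i \int[Q]_w (i1 i w.1 * i2 i w.2) = 1 by rewrite subrr mulr0.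
rewrite -(expect_cst P1 1) (label_decomposition P1 (bmeas_cst 1) mc1).
apply: eq_bigr => i _; rewrite QE// (bigD1 i)//= big1 ?addr0; last first.
  move=> j ji; rewrite (_ : (fun x => i1 i x * _) = fun=> 0).
    by rewrite expect_cst mulr0 mul0r.
  apply/funext => x; rewrite -/(i1 j) !i1E.
  by case: eqP => [->|]; rewrite ?mul0r// eq_sym (negPf ji) mulr0.
rewrite (_ : (fun x => i1 i x * _) = i1 i); last first.
  by apply/funext => x; rewrite -/(i1 i) !i1E; case: eqP; rewrite ?mulr0 ?mulr1.
rewrite (_ : (fun x => i2 i x * _) = i2 i); last first.
  by apply/funext => x; rewrite -/(i2 i) !i2E; case: eqP; rewrite ?mulr0 ?mulr1.
under [RHS]eq_Rintegral do rewrite mul1r.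
rewrite -[RHS]/(\int[P1]_x i1 i x) /i1 /i2 m1 m2.
have [->|mi] := eqVneq (m i) 0; first by rewrite mulr0.
by rewrite mulVf// mul1r.
Qed.

End gluing_properties.

Lemma in_setXT {X Y : Type} (A : set X) (p : X * Y) :
  (p \in A `*` setT) = (p.1 \in A).
Proof.
by apply/idP/idP => /set_mem => [[Ap _]|Ap]; apply/mem_set => //; split.
Qed.

Lemma in_setTX {X Y : Type} (A : set Y) (p : X * Y) :
  (p \in setT `*` A) = (p.2 \in A).
Proof.
by apply/idP/idP => /set_mem => [[_ Ap]|Ap]; apply/mem_set => //; split.
Qed.

Section gluing_plans.
Context {R : realType} {d : nat}.
Local Notation T := (torus R d).
Local Notation E := 'rV[R]_d.
Variable delta : T * T -> E.
Hypothesis delta_min : min_displacement delta.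

(* Unlike [min_displacement], this is stable under D |-> ((x, y) |-> - D (y, x)),
   as the supersolution needs: [delta] need not be odd on the cut locus. *)
Definition optimal_field (D : T * T -> E) :=
  (forall i, bmeas (fun p => D p ord0 i)) /\
  forall p, displacements p.1 p.2 (D p) /\ enorm (D p) = tdist p.1 p.2.

Lemma optimal_delta : optimal_field delta.
Proof.
split=> [i|p]; first exact: bmeas_delta.
rewrite (enorm_delta delta_min); split=> //; case: p => x y.
by have [_ /(_ x y)[]] := delta_min.
Qed.

Lemma optimal_field_swap D : optimal_field D ->
  optimal_field (fun p => - D (p.2, p.1)).
Proof.
move=> [bD oD]; split=> [i|[x y] /=].
  have := bmeasN (bmeasT_comp (@measurable_swap _ _ T T) (bD i)); congr bmeas.
  by apply/funext => p; rewrite mxE.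
have [/= h1 h2] := oD (y, x); rewrite enormN h2 tdistC; split=> //.
exact: displacementsN.
Qed.

Lemma optimal_field_coord D p i : optimal_field D -> `|D p ord0 i| <= d%:R.
Proof.
move=> [_ /(_ p)[_ Dp]]; apply: le_trans (normr_coord_le _ _) _.
by rewrite Dp tdist_le_dim.
Qed.

(** The vector - u + r + v is a displacement from x' to y, hence bounds their distance, and its
    square is expanded. Coordinates of u and v are at most d, those of r at most e: the two cross
    terms with r cost 2 d^2 e each, and the square of r costs d e. *)
Lemma sqr_tdist_through (x x' x0 y : T) (u r v : E) (e : R) : 0 <= e -> e <= 1 ->
    displacements x x' u -> displacements x x0 r -> displacements x0 y v ->
    enorm u = tdist x x' -> enorm v = tdist x0 y ->
    (forall i, `|r ord0 i| <= e) ->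
  tdist x' y ^+ 2 <= tdist x x' ^+ 2 + tdist x0 y ^+ 2
    - 2 * dotp u v + (4 * d%:R ^+ 2 + d%:R) * e.
Proof.
move=> e0 e1 xu xr xv nu nv re.
have := tdist_le (displacementsD (displacementsD (displacementsN xu) xr) xv).
rewrite -(@ler_pXn2r _ 2)// ?nnegrE ?tdist_ge0 ?enorm_ge0// => h.
apply: (le_trans h); rewrite enorm_sqr -nu -nv !enorm_sqr.
have rr : dotp r r <= d%:R * e.
  rewrite -[X in _ <= X%:R * _](card_ord d) -sum1_card natr_sum mulr_suml.
  apply: ler_sum => i _; rewrite mul1r (le_trans (ler_norm _))// normrM.
  by rewrite -[leRHS]mulr1 ler_pM// (le_trans (re i)).
have rw (w : E) : (forall i, `|w ord0 i| <= d%:R) -> dotp r w <= d%:R ^+ 2 * e.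
  move=> wd; rewrite expr2 -mulrA.
  rewrite -[X in _ <= X%:R * _](card_ord d) -sum1_card natr_sum mulr_suml.
  apply: ler_sum => i _; rewrite mul1r (le_trans (ler_norm _))// normrM mulrC.
  by rewrite ler_pM.
have cu i : `|u ord0 i| <= d%:R.
  by rewrite (le_trans (normr_coord_le _ _))// nu tdist_le_dim.
have cv i : `|v ord0 i| <= d%:R.
  by rewrite (le_trans (normr_coord_le _ _))// nv tdist_le_dim.
have ru : dotp r (- u) <= d%:R ^+ 2 * e by apply: rw => i; rewrite mxE normrN.
have rv := rw _ cv.
rewrite !dotpDl !dotpDr !dotpNl !dotpNr in ru *.
rewrite (dotpC u r) (dotpC v r) (dotpC v u); lra.
Qed.

(* Gluing along the common first marginal, approximately: the labels are fine
   enough to almost determine both the base point and the barycentre [beta]. *)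
Lemma glue_plan (g g0 : @plan R d) (D : T * T -> E) (beta : T -> E) (eta : R) :
    (forall A : set T, measurable A -> g (A `*` setT) = g0 (A `*` setT)) ->
    optimal_field D -> (forall i, bmeas (fun x => beta x ord0 i)) ->
    (forall i (A : set T), measurable A -> \int[g0]_p (D p ord0 i * \1_A p.1) =
      \int[g0]_p (beta p.1 ord0 i * \1_A p.1)) ->
    0 < eta ->
  exists g' : @plan R d,
    [/\ forall A : set T, measurable A -> g' (A `*` setT) = g (setT `*` A),
        forall A : set T, measurable A -> g' (setT `*` A) = g0 (setT `*` A) &
        transport_cost g' <= transport_cost g + transport_cost g0
          - 2 * (\int[g]_p dotp (delta p) (beta p.1)) + eta].
Proof.
move=> gg0 oD bbeta bary eta0; have od := optimal_delta.
have [bD _] := oD; have [bd _] := od.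
(* The gluing error is (4 d^2 + d) e from [sqr_tdist_through] plus 2 d^2 e from comparing [beta] at
   two base points with equal labels; the 1 keeps N positive. *)
pose N : R := 6 * d%:R ^+ 2 + d%:R + 1.
have N0 : 0 < N by rewrite /N ltr_wpDl// addr_ge0// mulr_ge0// exprn_ge0.
pose e := Num.min 1 (eta / N).
have e0 : 0 < e by rewrite /e lt_min ltr01 divr_gt0.
have e1 : e <= 1 by rewrite /e ge_min lexx.
have eN : (6 * d%:R ^+ 2 + d%:R) * e <= eta.
  apply: (@le_trans _ _ (N * e)); first by rewrite ler_wpM2r ?(ltW e0)// lerDl.
  by rewrite mulrC -ler_pdivlMr// /e ge_min lexx orbT.
(* A point is located by its displacement from the class of 0. If these displacements are close for
   x and x0, their difference is a small displacement from x to x0; continuity of [delta] is not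
   involved. *)
pose u0 (j : 'I_d + 'I_d) (x : T) : R := match j with
  | inl i => delta (\pi_T 0, x)%qT ord0 i | inr i => beta x ord0 i end.
have bu0 j : bmeas (u0 j).
  case: j => i; last exact: bbeta.
  exact: (bmeasT_comp (pair1_measurable _) (bd i)).
have [I [c [mc cE]]] := exists_labels bu0 e0.
pose m i := \int[g]_p \1_((fun p => c p.1) @^-1` [set i]) p.
have mc1 i : measurable ((fun p : T * T => c p.1) @^-1` [set i]).
  by have := @measurable_fst _ _ T T measurableT _ (mc i); rewrite setTI.
have m2 i : \int[g0]_p \1_((fun p => c p.1) @^-1` [set i]) p = m i.
  apply: EFin_inj; rewrite /m !expect_indic//.
  have := gg0 _ (mc i); rewrite (_ : (c @^-1` [set i]) `*` setT =
    (fun p => c p.1) @^-1` [set i])//.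
  by apply/seteqP; split=> [p []|p].
have m1 i : \int[g]_p \1_((fun p => c p.1) @^-1` [set i]) p = m i by [].
have [Q QE] := exists_gluing mc1 mc1 m1 m2.
have Qfst := gluing_fst mc1 m1 m2 QE.
have Qsnd := gluing_snd mc1 m1 m2 QE.
have Qle := gluing_le0 mc1 mc1 m1 m2 QE.
(* The base points, nearly equal under Q, are dropped and the two far ends are kept. *)
pose h (w : (T * T) * (T * T)) : T * T := (w.1.2, w.2.2).
have mh : measurable_fun setT h.
  apply: measurable_fun_pair.
    exact: (measurableT_comp measurable_snd measurable_fst).
  exact: (measurableT_comp measurable_snd measurable_snd).
pose hm : {mfun ((T * T) * (T * T))%type >-> (T * T)%type} := mfun_Sub (mem_set mh).
exists (distribution Q hm : @plan R d); split.
- move=> A mA; have mA' : measurable (setT `*` A : set (T * T)).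
    exact: measurableX.
  have mA1 : measurable (A `*` setT : set (T * T)) by exact: measurableX.
  rewrite -!expect_indic//; congr EFin.
  rewrite expect_distribution; last exact: bmeas_indic.
  rewrite -Qfst; last exact: bmeas_indic.
  by apply: eq_Rintegral => w _; rewrite !indicE ?in_setXT ?in_setTX.
- move=> A mA; have mA' : measurable (setT `*` A : set (T * T)).
    exact: measurableX.
  rewrite -!expect_indic//; congr EFin.
  rewrite expect_distribution; last exact: bmeas_indic.
  rewrite -Qsnd; last exact: bmeas_indic.
  by apply: eq_Rintegral => w _; rewrite !indicE ?in_setXT ?in_setTX.
have bt2 : bmeas (fun p : T * T => tdist p.1 p.2 ^+ 2).
  exact: (bmeasX 2 (bmeas_tdist delta_min)).
have bt1' : bmeas (fun w : (T * T) * (T * T) => tdist w.1.1 w.1.2 ^+ 2).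
  exact: (bmeasT_comp measurable_fst bt2).
have bt2' : bmeas (fun w : (T * T) * (T * T) => tdist w.2.1 w.2.2 ^+ 2).
  exact: (bmeasT_comp measurable_snd bt2).
have bth : bmeas (fun w => tdist (h w).1 (h w).2 ^+ 2).
  exact: (bmeasT_comp mh bt2).
have bd1 i : bmeas (fun w : (T * T) * (T * T) => delta w.1 ord0 i).
  exact: (bmeasT_comp measurable_fst (bd i)).
have bD2 i : bmeas (fun w : (T * T) * (T * T) => D w.2 ord0 i).
  exact: (bmeasT_comp measurable_snd (bD i)).
have bb (i : 'I_d) : bmeas (fun p : T * T => beta p.1 ord0 i).
  exact: (bmeas_fst (bbeta i)).
have bb1 i : bmeas (fun w : (T * T) * (T * T) => beta w.1.1 ord0 i).
  exact: (bmeasT_comp measurable_fst (bb i)).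
have bb2 i : bmeas (fun w : (T * T) * (T * T) => beta w.2.1 ord0 i).
  exact: (bmeasT_comp measurable_snd (bb i)).
have bdD i : bmeas (fun w : (T * T) * (T * T) => delta w.1 ord0 i * D w.2 ord0 i).
  exact: bmeasM.
have bdD' : bmeas (fun w : (T * T) * (T * T) => dotp (delta w.1) (D w.2)).
  exact: bmeas_sum.
rewrite /transport_cost expect_distribution//.
pose k : R := (4 * d%:R ^+ 2 + d%:R) * e.
have step1 : \int[Q]_w tdist (h w).1 (h w).2 ^+ 2 <=
    transport_cost g + transport_cost g0
      - 2 * (\int[Q]_w dotp (delta w.1) (D w.2)) + k.
  have := Qle (fun w => tdist (h w).1 (h w).2 ^+ 2 -
    (tdist w.1.1 w.1.2 ^+ 2 + tdist w.2.1 w.2.2 ^+ 2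
     - 2 * dotp (delta w.1) (D w.2) + k)).
  have bA := bmeasD bt1' bt2'.
  have bB := bmeasB bA (bmeasZ 2 bdD').
  have bC := bmeasD bB (bmeas_cst k).
  rewrite (expectB Q bth bC) (expectD Q bB (bmeas_cst k)) (expectB Q bA (bmeasZ 2 bdD')).
  rewrite (expectD Q bt1' bt2') (expectZ Q _ bdD') (expect_cst Q).
  rewrite (Qfst (fun p => tdist p.1 p.2 ^+ 2) bt2).
  rewrite (Qsnd (fun p => tdist p.1 p.2 ^+ 2) bt2) -!/(transport_cost _).
  rewrite subr_le0; apply; first exact: bmeasB.
  move=> [[x x'] [x0 y]] /= cc; rewrite subr_le0 /h/=.
  have [_ /(_ (x, x'))[/= d1 d2]] := od.
  have [_ /(_ (x0, y))[/= D1 D2]] := oD.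
  have [_ od'] := od.
  have [/= a1 _] := od' (\pi_T 0, x)%qT.
  have [/= a2 _] := od' (\pi_T 0, x0)%qT.
  apply: (sqr_tdist_through (ltW e0) e1 d1
    (displacementsD (displacementsN a1) a2) D1 d2 D2) => i.
  by rewrite !mxE addrC; exact: (cE x0 x (esym cc) (inl i)).
(* By [QE] the second pair enters only through integrals over label sets of its base point, and
   there [bary] exchanges D and [beta] without error. *)
have step2 i : \int[Q]_w (delta w.1 ord0 i * D w.2 ord0 i) =
    \int[Q]_w (delta w.1 ord0 i * beta w.2.1 ord0 i).
  rewrite (QE _ _ (bd i) (bD i)) (QE _ _ (bd i) (bb i)); apply: eq_bigr => j _.
  by congr (_ * _); exact: (bary i _ (mc j)).
have bdb2 i : bmeas (fun w : (T * T) * (T * T) => delta w.1 ord0 i * beta w.2.1 ord0 i).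
  exact: bmeasM.
have bdb1 i : bmeas (fun w : (T * T) * (T * T) => delta w.1 ord0 i * beta w.1.1 ord0 i).
  exact: bmeasM.
have bdb i : bmeas (fun p : T * T => delta p ord0 i * beta p.1 ord0 i).
  exact: bmeasM.
(* Equal labels make [beta] at the two base points differ by at most e in each coordinate. *)
have step3 i : \int[g]_p (delta p ord0 i * beta p.1 ord0 i) <=
    \int[Q]_w (delta w.1 ord0 i * D w.2 ord0 i) + d%:R * e.
  have := Qle (fun w => delta w.1 ord0 i * beta w.1.1 ord0 i -
    (delta w.1 ord0 i * beta w.2.1 ord0 i + d%:R * e)).
  have bA := bmeasD (bdb2 i) (bmeas_cst (d%:R * e)).
  rewrite (expectB Q (bdb1 i) bA) (expectD Q (bdb2 i) (bmeas_cst (d%:R * e))).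
  rewrite (expect_cst Q).
  rewrite (Qfst (fun p => delta p ord0 i * beta p.1 ord0 i) (bdb i)) -step2 subr_le0.
  apply; first exact: bmeasB.
  move=> [[x x'] [x0 y]] /= cc; rewrite subr_le0 -lerBlDl -mulrBr.
  rewrite (le_trans (ler_norm _))// normrM ler_pM//.
    exact: optimal_field_coord.
  exact: (cE x x0 cc (inr i)).
have step4 : \int[g]_p dotp (delta p) (beta p.1) <=
    \int[Q]_w dotp (delta w.1) (D w.2) + d%:R ^+ 2 * e.
  rewrite /dotp (expect_sum Q)// (expect_sum g)// expr2 -mulrA.
  rewrite -[X in _ <= _ + X%:R * _](card_ord d) -sum1_card natr_sum mulr_suml.
  rewrite -big_split/=; apply: ler_sum => i _; rewrite mul1r; exact: step3.
move: step1 step4 eN; rewrite /k /transport_cost; lra.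
Qed.

End gluing_plans.

Lemma measurable_lt_set {d} {X : measurableType d} {R : realType} (f g : X -> R) :
  measurable_fun setT f -> measurable_fun setT g -> measurable [set x | f x < g x].
Proof.
move=> mf mg; have /measurable_EFinP h := measurable_funB mg mf.
have := emeasurable_fun_o_infty measurableT h 0%E; rewrite setTI.
by congr measurable; apply/seteqP; split=> x /=; rewrite lte_fin subr_gt0.
Qed.

(** * Superdifferentials at maximum points *)

Section finite_kernels.
Context {d1 d2 : measure_display} {X : measurableType d1} {Y : measurableType d2}.
Context {R : realType} (J : finType) (v : J -> Y).

Lemma exists_finite_measure (r : seq J) (w : J -> R) : (forall j, 0 <= w j) ->
  exists mu : {measure set Y -> \bar R},
    forall A, mu A = (\sum_(j <- r) w j * \1_A (v j))%:E.
Proof.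
move=> w0; elim: r => [|j r [mu muE]].
  exists (@mzero _ Y R) => A; rewrite big_nil//.
exists (measure_add (mscale (NngNum (w0 j)) (dirac (v j))) mu) => A.
transitivity (mscale (NngNum (w0 j)) (dirac (v j)) A + mu A)%E.
  exact: measure_addE.
by rewrite muE big_cons EFinD /mscale/= diracE indicE EFinM.
Qed.

Lemma exists_finite_kernel (w : J -> X -> R) :
    (forall j, measurable_fun setT (w j)) -> (forall j x, 0 <= w j x) ->
    (forall x, \sum_j w j x = 1) ->
  exists psi : R.-pker X ~> Y,
    forall x A, psi x A = (\sum_j w j x * \1_A (v j))%:E.
Proof.
move=> mw w0 w1.
pose k x : {measure set Y -> \bar R} :=
  sval (cid (exists_finite_measure (index_enum J) (fun j => w0 j x))).
have kE x A : k x A = (\sum_j w j x * \1_A (v j))%:E by rewrite /k; case: cid.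
have mk U : measurable U -> measurable_fun setT (k ^~ U).
  move=> mU; under eq_fun do rewrite kE; apply/measurable_EFinP.
  apply: measurable_sum => j; apply: measurable_funM => //.
have k1 x : k x setT = 1%E.
  by rewrite kE -(w1 x); congr EFin; apply: eq_bigr => j _; rewrite indicT mulr1.
pose k' : R.-ker X ~> Y := HB.pack k (isKernel.Build _ _ _ _ _ k mk).
pose psi : R.-pker X ~> Y :=
  HB.pack k (Kernel.class k') (Kernel_isProbability.Build _ _ _ _ _ k' k1).
by exists psi.
Qed.

(** f may be unbounded, as the Hamiltonian is in its momentum. Clipping it at a bound for its values
    on the atoms changes it on a null set only. *)
Lemma expect_finite (mu : {measure set Y -> \bar R}) (w : J -> R) (f : Y -> R) :
    (forall j, 0 <= w j) -> \sum_j w j = 1 ->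
    (forall A, mu A = (\sum_j w j * \1_A (v j))%:E) -> measurable_fun setT f ->
  \int[mu]_y f y = \sum_j w j * f (v j).
Proof.
move=> w0 w1 muE mf.
have mu1 : mu setT = 1%E.
  by rewrite muE -w1; congr EFin; apply: eq_bigr => j _; rewrite indicT mulr1.
have [P PE] := probability_of_set_function (measure0 mu) (measure_ge0 mu)
    (@measure_semi_sigma_additive _ _ _ mu) mu1.
have PE' A : P A = (\sum_j w j * \1_A (v j))%:E by rewrite PE; exact: muE.
pose M := \sum_j `|f (v j)|.
have fM j : `|f (v j)| <= M.
  by rewrite /M (bigD1 j)//= lerDl; apply: sumr_ge0.
pose f' y := Num.max (- M) (Num.min (f y) M).
have M0 : 0 <= M by apply: sumr_ge0.
have bf' : bmeas f'.
  split.
    by apply: measurable_maxr => //; apply: measurable_minr.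
  exists M => y; rewrite ler_norml /f' le_max lexx/= ge_max ge_min lexx orbT.
  by rewrite andbT (le_trans _ M0)// oppr_le0.
have f'v j : f' (v j) = f (v j).
  have := fM j; rewrite ler_norml => /andP[h1 h2].
  by rewrite /f' min_l// max_r.
transitivity (\int[P]_y f' y); last first.
  transitivity (\sum_j w j * f' (v j)); last by apply: eq_bigr => j _; rewrite f'v.
  apply: (@eq_pos_linear _ _ _ (fun f => \int[P]_x f x)
    (fun f => \sum_j w j * f (v j)) (pos_linear_expect P) _ _ f' bf').
    split=> [f1 f2 _ _|c f1 _|f1 f2 _ _ f12].
    - by rewrite -big_split; apply: eq_bigr => j _; rewrite mulrDr.
    - by rewrite mulr_sumr; apply: eq_bigr => j _; rewrite mulrCA.
    - by apply: ler_sum => j _; rewrite ler_wpM2l.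
  by move=> A mA; apply: EFin_inj; rewrite expect_indic// PE'.
rewrite /Rintegral; congr fine.
transitivity (\int[P]_x (f x)%:E)%E.
  by apply: eq_measure_integral => A mA _; exact: esym (PE A).
apply: ae_eq_integral => //.
- exact/measurable_EFinP.
- by apply/measurable_EFinP; exact: bf'.1.
have mN : measurable [set y | f y <> f' y].
  have -> : [set y | f y <> f' y] = [set y | f y < f' y] `|` [set y | f' y < f y].
    apply/seteqP; split=> y /=.
      by move=> /eqP; rewrite neq_lt => /orP[]; [left|right].
    by move=> h; apply/eqP; rewrite neq_lt; apply/orP.
  apply: measurableU.
    exact: measurable_lt_set mf bf'.1.
  exact: measurable_lt_set bf'.1 mf.
exists [set y | f y <> f' y]; split=> //.
  transitivity (P [set y | f y <> f' y]) => //.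
  rewrite PE'; congr EFin; apply: big1 => j _.
  by rewrite indicE memNset ?mulr0//= f'v.
by move=> y /= h e; apply: h => _; rewrite /= e.
Qed.

End finite_kernels.

Lemma sum_option {V : nmodType} (J : finType) (F : option J -> V) :
  \sum_j F j = F None + \sum_j F (Some j).
Proof.
rewrite (bigD1 None)//=; congr (_ + _).
rewrite (reindex_omap Some id)/=; last by case.
by apply: eq_bigl => j; rewrite eqxx.
Qed.

Section conditional_weights.
Context {d1 d2 : measure_display} {X : measurableType d1} {Y : measurableType d2}.
Context {R : realType} (J : finType).

(** The extra index [None] carries the mass missing from 1. *)
Definition complete_weights {S : Type} (phi : J -> S -> R) (j : option J) (s : S) : R :=
  if j is Some j then phi j s else 1 - \sum_j phi j s.

Lemma bmeas_complete_weights {d} {S : measurableType d} (phi : J -> S -> R) j :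
  (forall j, bmeas (phi j)) -> bmeas (complete_weights phi j).
Proof.
move=> bphi; case: j => [j|] /=; first exact: bphi.
by apply: bmeasB; [exact: bmeas_cst|exact: bmeas_sum].
Qed.

Lemma sum_complete_weights {S : Type} (phi : J -> S -> R) s :
  \sum_j complete_weights phi j s = 1.
Proof. by rewrite sum_option/= subrK. Qed.

Lemma complete_weights_ge0 {S : Type} (phi : J -> S -> R) c j s :
  c * #|J|%:R <= 1 -> (forall j s, 0 <= phi j s <= c) ->
  0 <= complete_weights phi j s.
Proof.
move=> cJ phic; case: j => [j|] /=; first by have /andP[] := phic j s.
rewrite subr_ge0; apply: le_trans cJ; rewrite -sum1_card natr_sum mulr_sumr.
by apply: ler_sum => j _; rewrite mulr1; have /andP[] := phic j s.
Qed.

(** Only the weights indexed by J are conditioned; that of [None] is again the complement. The sum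
    is thus 1 everywhere and not just almost everywhere, and the pointwise bound c, kept by
    conditioning, makes the complement nonnegative. *)
Lemma exists_conditional_weights (P : probability X R) (h : {mfun X >-> Y})
    (phi : J -> X -> R) (c : R) :
    (forall j, bmeas (phi j)) -> (forall j x, 0 <= phi j x <= c) ->
    c * #|J|%:R <= 1 ->
  exists w : option J -> Y -> R, [/\ forall j, bmeas (w j),
    forall j y, 0 <= w j y, forall y, \sum_j w j y = 1 &
    forall j f, bmeas f -> \int[P]_x (f (h x) * complete_weights phi j x) =
      \int[distribution P h]_y (f y * w j y)].
Proof.
move=> bphi phic cJ.
have w0P j := cid (conditional_weight P h (bphi j) (phic j)).
pose w0 j := sval (w0P j).
have bw0 j : bmeas (w0 j) by rewrite /w0; case: (w0P j) => ? [].
have w0c j y : 0 <= w0 j y <= c by rewrite /w0; case: (w0P j) => ? [].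
have w0E j f : bmeas f -> \int[P]_x (f (h x) * phi j x) =
    \int[distribution P h]_y (f y * w0 j y).
  by have [_ _ wE] := svalP (w0P j); exact: wE.
exists (complete_weights w0); split.
- by move=> j; exact: bmeas_complete_weights.
- by move=> j y; exact: complete_weights_ge0 cJ w0c.
- exact: sum_complete_weights.
move=> [j|] f bf /=; first exact: w0E.
have bfh : bmeas (fun x => f (h x)) by exact: bmeasT_comp.
have bfp j : bmeas (fun x => f (h x) * phi j x) by exact: bmeasM.
have bfw j : bmeas (fun y => f y * w0 j y) by exact: bmeasM.
transitivity (\int[P]_x (f (h x) - \sum_j f (h x) * phi j x)).
  by apply: eq_Rintegral => x _; rewrite mulrBr mulr1 mulr_sumr.
rewrite (expectB P bfh (bmeas_sum _ bfp)) (expect_sum P _ bfp).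
transitivity (\int[distribution P h]_y (f y - \sum_j f y * w0 j y)); last first.
  by apply: eq_Rintegral => x _; rewrite mulrBr mulr1 mulr_sumr.
rewrite (expectB (distribution P h) bf (bmeas_sum _ bfw)).
rewrite (expect_sum (distribution P h) _ bfw) (expect_distribution P h bf).
by congr (_ - _); apply: eq_bigr => j _; exact: w0E.
Qed.

End conditional_weights.

Section superdifferential.
Context {R : realType} {d : nat}.
Local Notation T := (torus R d).
Local Notation P := (prob_torus R d).
Local Notation E := 'rV[R]_d.
Variable delta : T * T -> E.
Hypothesis delta_min : min_displacement delta.

(* Measures are functions on all of [set T]; only their Borel values matter. *)
Definition respects_borel (A : time R * P -> R) :=
  forall s (mu nu : P), (forall B, measurable B -> mu B = nu B) -> A (s, mu) = A (s, nu).

Section kernel.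
Context (J : finType) (v : J -> E) (w : J -> T -> R) (psi : R.-pker T ~> E).
Hypothesis bw : forall j, bmeas (w j).
Hypothesis w_ge0 : forall j x, 0 <= w j x.
Hypothesis w_sum : forall x, \sum_j w j x = 1.
Hypothesis psiE : forall x B, psi x B = (\sum_j w j x * \1_B (v j))%:E.

Lemma kernel_support : exists2 r, 0 < r &
  forall x, msupport (psi x) `<=` [set z | enorm z < r].
Proof.
pose r := 1 + \sum_j enorm (v j); exists r.
  by rewrite ltr_pwDl// sumr_ge0// => j _; exact: enorm_ge0.
move=> x z /= hz; rewrite ltNge; apply/negP => rz.
(* Every atom has norm at most r - 1, so this open set has measure zero, yet it contains z. *)
have oV : open [set y : E | r - 1 < enorm y].
  have /continuousP cE := @enorm_continuous R d.
  rewrite (_ : [set y | _] = @enorm R d @^-1` `](r - 1), +oo[%classic).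
    by apply: cE; exact: rray_open.
  by apply/seteqP; split=> y /=; rewrite in_itv/= andbT.
have := hz _ oV; rewrite psiE big1 ?ltxx.
  have rz' : r - 1 < enorm z by rewrite (lt_le_trans _ rz)// ltrBlDr ltrDl.
  by move=> /(_ rz').
move=> j _; rewrite indicE memNset ?mulr0//=; apply/negP.
rewrite -leNgt /r addrC addKr (bigD1 j)//= lerDl.
by apply: sumr_ge0 => k _; exact: enorm_ge0.
Qed.

Lemma kernel_expect x (f : E -> R) : measurable_fun setT f ->
  \int[psi x]_z f z = \sum_j w j x * f (v j).
Proof. by move=> mf; exact: expect_finite. Qed.

Definition barycenter (x : T) : E := \sum_j w j x *: v j.

Lemma barycenterE x i : barycenter x ord0 i = \sum_j w j x * v j ord0 i.
Proof. by rewrite /barycenter summxE; apply: eq_bigr => j _; rewrite mxE. Qed.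

Lemma bmeas_barycenter i : bmeas (fun x => barycenter x ord0 i).
Proof.
under eq_fun do rewrite barycenterE.
by apply: bmeas_sum => j; apply: bmeasM => //; exact: bmeas_cst.
Qed.

Lemma measurable_dotp (u : E) : measurable_fun setT (fun z : E => dotp z u).
Proof.
apply: measurable_sum => i; apply: measurable_funM; first exact: measurable_coord.
exact: measurable_cst.
Qed.

Lemma kernel_dotp x u : \int[psi x]_z dotp z u = dotp (barycenter x) u.
Proof.
rewrite (kernel_expect _ (measurable_dotp u)) /dotp.
under [RHS]eq_bigr do rewrite barycenterE mulr_suml.
rewrite exchange_big/=; apply: eq_bigr => j _; rewrite mulr_sumr.
by apply: eq_bigr => i _; rewrite mulrA.
Qed.

(** A competitor g from the first marginal of g0 to mu' is glued to g0 into a plan from mu' to the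
    second marginal of g0, where the maximality hypothesis applies. The cost of the glued plan is
    cost g + cost g0 minus twice the correlation of [delta] with [beta]; after multiplication by K,
    that correlation is the integral in [superdiff]. *)
Lemma superdiff_of_max (A : time R * P -> R) (t : time R) (g0 : @plan R d)
    (D : T * T -> E) (K theta : R) :
    respects_borel A -> 0 < K -> optimal_field D ->
    (forall i (B : set T), measurable B ->
      \int[g0]_p (- (2 * K) * D p ord0 i * \1_B p.1) =
      \int[g0]_p (barycenter p.1 ord0 i * \1_B p.1)) ->
    (forall (s : time R) (g : @plan R d), time_val s <= time_val t ->
      (forall B : set T, measurable B -> g (setT `*` B) = g0 (setT `*` B)) ->
      A (s, marg1 g) - K * transport_cost g <=
      A (t, marg1 g0) - K * transport_cost g0 + theta * (time_val s - time_val t)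
        + K * (time_val s - time_val t) ^+ 2) ->
  superdiff delta A t (marg1 g0) theta psi.
Proof.
move=> bA K0 oD bary Amax; split; first exact: kernel_support.
(* The remainder is K cost + K |s - t|^2, at most K (|s - t| + sqrt cost)^2. *)
exists (fun h => K * h ^+ 2).
  have : K * h @[h --> 0^'+] --> (K * 0 : R).
    apply: cvgMr; apply: cvg_at_right_filter; exact: cvg_id.
  rewrite mulr0; apply: cvg_trans; apply: near_eq_cvg.
  apply: filterS (nbhs_right_gt 0) => h h0.
  by rewrite expr2 mulrA mulfK// gt_eqF.
move=> s mu' g st cpl.
have bt2 := bmeasX 2 (bmeas_tdist delta_min).
have cost0 : 0 <= transport_cost g by apply: expect_ge0 => p; exact: sqr_ge0.
have [bD _] := oD; have [bd _] := optimal_delta delta_min.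
have bb i : bmeas (fun p : T * T => barycenter p.1 ord0 i).
  exact: (bmeas_fst (bmeas_barycenter i)).
(* The atoms average to - 2 K times the conditional mean of D, and [beta] undoes this factor. *)
pose k := - (2 * K)^-1; pose beta x := k *: barycenter x.
have bbeta i : bmeas (fun x => beta x ord0 i).
  by under eq_fun do rewrite mxE; apply: bmeasZ; exact: bmeas_barycenter.
have kK : k * - (2 * K) = 1 by rewrite /k mulrNN mulVf// mulf_neq0// gt_eqF.
have bary' i (B : set T) : measurable B -> \int[g0]_p (D p ord0 i * \1_B p.1) =
    \int[g0]_p (beta p.1 ord0 i * \1_B p.1).
  move=> mB; have bB : bmeas (fun p : T * T => \1_B p.1 : R).
    exact: (bmeas_fst (bmeas_indic mB)).
  transitivity (\int[g0]_p (k * (- (2 * K) * D p ord0 i * \1_B p.1))).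
    by apply: eq_Rintegral => p _; rewrite !mulrA kK mul1r.
  rewrite (expectZ g0 k (bmeasM (bmeasZ _ (bD i)) bB)) bary//.
  rewrite -(expectZ g0 k (bmeasM (bb i) bB)).
  by apply: eq_Rintegral => p _; rewrite mxE mulrA.
have gg0 (B : set T) : measurable B -> g (B `*` setT) = g0 (B `*` setT).
  by move=> mB; have [-> _] := cpl B mB; rewrite marg1E.
have bdb : bmeas (fun p => dotp (barycenter p.1) (delta p)).
  by apply: bmeas_sum => i; exact: bmeasM.
have IE : \int[g]_p dotp (delta p) (beta p.1) =
    k * (\int[g]_p \int[psi p.1]_z dotp z (delta p)).
  under [in RHS]eq_Rintegral do rewrite kernel_dotp.
  rewrite -(expectZ g k bdb); apply: eq_Rintegral => p _.
  by rewrite /beta dotpC dotpZl.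
set I := \int[g]_p \int[psi p.1]_z dotp z (delta p) in IE *.
apply/ler_addgt0Pr => e e0.
(* The cost is multiplied by K in the end, which turns a gluing error e / K into e. *)
have eK : 0 < e / K by rewrite divr_gt0.
have [g' [g'1 g'2 g'c]] := glue_plan delta_min gg0 oD bbeta bary' eK.
have Amu : A (s, mu') = A (s, marg1 g').
  apply: bA => B mB; rewrite marg1E g'1//.
  by have [_ ->] := cpl B mB.
have := Amax s g' st g'2; rewrite -Amu.
set a := A (s, mu'); set a0 := A (t, marg1 g0).
have g'cK : K * transport_cost g' <= K * transport_cost g + K * transport_cost g0
    + I + e.
  have := g'c; rewrite -(ler_pM2l K0) !mulrDr mulrN IE.
  rewrite (mulrC e) mulVKf ?gt_eqF// mulrCA !mulrA.
  have -> : 2 * K * k = -1.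
    by move: kK; rewrite mulrN => h; rewrite (mulrC _ k) -[LHS]opprK h.
  by rewrite mulN1r opprK.
have hh : K * transport_cost g + K * (time_val s - time_val t) ^+ 2 <=
    K * (`|time_val s - time_val t| + Num.sqrt (transport_cost g)) ^+ 2.
  rewrite -mulrDr ler_pM2l// [leRHS]sqrrD sqr_sqrtr// real_normK ?num_real//.
  have : 0 <= `|time_val s - time_val t| * Num.sqrt (transport_cost g).
    by rewrite mulr_ge0// sqrtr_ge0.
  by lra.
lra.
Qed.

End kernel.
End superdifferential.

Lemma pos_part_sub {R : realDomainType} (z : R) :
  Num.max z 0 - Num.max (- z) 0 = z.
Proof.
by have /orP[h|h] := le_total 0 z; [rewrite max_l// max_r ?oppr_le0// subr0|
  rewrite max_r// max_l ?oppr_ge0// sub0r opprK].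
Qed.

Lemma pos_part_add {R : realDomainType} (z : R) :
  Num.max z 0 + Num.max (- z) 0 = `|z|.
Proof.
by have /orP[h|h] := le_total 0 z; [rewrite max_l// max_r ?oppr_le0// addr0 ger0_norm|
  rewrite max_r// max_l ?oppr_ge0// add0r ler0_norm].
Qed.

(** * Finitely supported laws with prescribed mean *)

Section discretization.
Context {R : realType} {d : nat}.
Local Notation T := (torus R d).
Local Notation E := 'rV[R]_d.
Variable delta : T * T -> E.
Hypothesis delta_min : min_displacement delta.

(* Only the barycentres of the kernel enter the superdifferential, so the
   displacement may be replaced by a random point of a fixed finite set (the
   origin and points on the coordinate axes) with the same conditional mean. *)
Lemma exists_discretization (K : R) : 0 < K ->
  exists (J : finType) (phi : J -> T * T -> R) (v : option J -> E) (c : R),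
    [/\ forall j, bmeas (phi j), forall j p, 0 <= phi j p <= c,
        c * #|J|%:R <= 1,
        forall p i, \sum_j complete_weights phi j p * v j ord0 i =
          - (2 * K) * delta p ord0 i &
        forall p, \sum_j complete_weights phi j p * enorm (v j) <=
          2 * K * d%:R * tdist p.1 p.2].
Proof.
move=> K0; pose Z (i : 'I_d) p := - (2 * K) * delta p ord0 i.
have K20 : 0 <= 2 * K by rewrite mulr_ge0// ltW.
have bZ i : bmeas (Z i) by apply: bmeasZ; exact: bmeas_delta.
have ZB i p : `|Z i p| <= 2 * K * tdist p.1 p.2.
  rewrite /Z normrM normrN (ger0_norm K20); apply: ler_wpM2l => //.
  by rewrite -(enorm_delta delta_min); exact: normr_coord_le.
have ZB' i p : `|Z i p| <= 2 * K * d%:R.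
  by rewrite (le_trans (ZB i p))// ler_wpM2l// tdist_le_dim.
(* The atoms are N and - N times the basis vectors, weighted by the positive and negative parts of Z
   i over N. There are 2 d of them, each of weight at most 2 K d / N, and N makes the total at most
   1. It cancels in the mean and in the mean norm, so the latter is still controlled by the
   distance. *)
pose N : R := 2 * K * d%:R * (2 * d%:R) + 1.
have N0 : 0 < N by rewrite ltr_wpDl// !mulr_ge0// ltW.
pose sg (s : bool) : R := if s then 1 else -1.
pose phi (j : 'I_d * bool) p := Num.max (sg j.2 * Z j.1 p) 0 / N.
pose v (j : option ('I_d * bool)) : E :=
  if j is Some (i, s) then (sg s * N) *: delta_mx 0 i else 0.
exists ('I_d * bool)%type, phi, v, (2 * K * d%:R / N); split.
- move=> j; have := bmeasZ N^-1 (bmeas_max (bmeasZ (sg j.2) (bZ j.1)) (bmeas_cst 0)).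
  by congr bmeas; apply/funext => p; rewrite mulrC.
- move=> [i s] p; rewrite /phi/=; apply/andP; split.
    by rewrite divr_ge0 ?(ltW N0)// le_max lexx orbT.
  rewrite ler_pM2r ?invr_gt0// ge_max mulr_ge0// andbT.
  apply: le_trans (ZB' i p); apply: le_trans (ler_norm _) _.
  by rewrite normrM /sg; case: s; rewrite ?normrN normr1 mul1r.
- rewrite card_prod card_ord card_bool natrM mulrAC ler_pdivrMr// mul1r.
  by rewrite [d%:R * 2]mulrC lerDl.
- move=> p i; rewrite sum_option/= mxE mulr0 add0r.
  rewrite (eq_bigr (fun j : 'I_d * bool =>
      (Num.max (sg j.2 * Z j.1 p) 0) * sg j.2 * (i == j.1)%:R)); last first.
    move=> [k s] _; rewrite /phi/v/= !mxE eqxx/= -/(Z k p).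
    rewrite mulrA; congr (_ * _); rewrite [sg s * N]mulrC mulrA divfK//.
    by rewrite gt_eqF.
  rewrite -(pair_bigA _ (fun k s => (Num.max (sg s * Z k p) 0) * sg s * (i == k)%:R)).
  rewrite /= (bigD1 i)//= [X in _ + X]big1 ?addr0; last first.
    move=> k ki; apply: big1 => s _; rewrite eq_sym (negPf ki) mulr0//.
  rewrite big_bool/= eqxx !mulr1 mul1r mulN1r mulrN1 /Z.
  exact: pos_part_sub.
move=> p; rewrite sum_option/= enorm0 mulr0 add0r.
apply: (@le_trans _ _ (\sum_i `|Z i p|)); last first.
  rewrite [leRHS]mulrAC mulrC.
  rewrite -[X in _ <= X%:R * _](card_ord d) -sum1_card natr_sum mulr_suml.
  by apply: ler_sum => i _; rewrite mul1r.
rewrite (@le_trans _ _ (\sum_(j : 'I_d * bool) Num.max (sg j.2 * Z j.1 p) 0))//.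
  apply: ler_sum => -[k s] _; rewrite /phi/v/=.
  have enN : enorm ((sg s * N) *: delta_mx 0 k) <= N.
    apply: le_trans (enorm_le_sum _) _; rewrite (bigD1 k)//= big1 ?addr0.
      rewrite !mxE !eqxx/= mulr1 normrM (gtr0_norm N0) /sg.
      by case: s; rewrite ?normrN normr1 mul1r.
    by move=> i ik; rewrite !mxE (negPf ik) andbF mulr0 normr0.
  rewrite mulrAC ler_pdivrMr// ler_wpM2l// le_max lexx orbT//.
rewrite -(pair_bigA _ (fun k s => Num.max (sg s * Z k p) 0))/=.
apply: ler_sum => i _; rewrite big_bool/= mul1r mulN1r.
by rewrite pos_part_add.
Qed.

End discretization.

(** * Reversed plans and diagonal plans *)

Section swapped_plans.
Context {R : realType} {d : nat}.
Local Notation T := (torus R d).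
Local Notation P := (prob_torus R d).

Definition swap_mfun : {mfun (T * T)%type >-> (T * T)%type} :=
  mfun_Sub (mem_set (@measurable_swap _ _ T T)).

Definition swap_plan (g : @plan R d) : @plan R d := distribution g swap_mfun.

Lemma swap_planE (g : @plan R d) (A B : set T) :
  swap_plan g (A `*` B) = g (B `*` A).
Proof.
have e : swap_mfun @^-1` (A `*` B) = B `*` A.
  by apply/seteqP; split=> [[x y] []|[x y] []].
by rewrite -e.
Qed.

Lemma expect_swap (g : @plan R d) (f : T * T -> R) : bmeas f ->
  \int[swap_plan g]_p f p = \int[g]_p f (p.2, p.1).
Proof. exact: expect_distribution. Qed.

Lemma bmeas_swap (f : T * T -> R) : bmeas f -> bmeas (fun p => f (p.2, p.1)).
Proof. by move=> bf; exact: (bmeasT_comp (@measurable_swap _ _ T T) bf). Qed.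

Lemma transport_cost_swap (delta : T * T -> 'rV[R]_d) (g : @plan R d) :
  min_displacement delta -> transport_cost (swap_plan g) = transport_cost g.
Proof.
move=> dm; rewrite /transport_cost expect_swap.
  by apply: eq_Rintegral => p _ /=; rewrite tdistC.
exact: bmeasX (bmeas_tdist dm).
Qed.

Definition diag_mfun : {mfun T >-> (T * T)%type} :=
  mfun_Sub (mem_set (measurable_fun_pair (@measurable_id _ T setT)
    (@measurable_id _ T setT))).

Definition diag_plan (mu : P) : @plan R d :=
  distribution (mu : probability T R) diag_mfun.

Lemma diag_planE1 (mu : P) (A : set T) : diag_plan mu (A `*` setT) = mu A.
Proof.
have e : diag_mfun @^-1` (A `*` setT) = A by apply/seteqP; split=> [x []|x].
by rewrite -[in RHS]e.
Qed.

Lemma diag_planE2 (mu : P) (A : set T) : diag_plan mu (setT `*` A) = mu A.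
Proof.
have e : diag_mfun @^-1` (setT `*` A) = A by apply/seteqP; split=> [x []|x].
by rewrite -[in RHS]e.
Qed.

Lemma transport_cost_diag (delta : T * T -> 'rV[R]_d) (mu : P) :
  min_displacement delta -> transport_cost (diag_plan mu) = 0.
Proof.
move=> dm; rewrite /transport_cost expect_distribution.
  rewrite -[RHS](expect_cst (mu : probability T R)); apply: eq_Rintegral => x _ /=.
  by rewrite tdistxx expr0n.
exact: bmeasX (bmeas_tdist dm).
Qed.

Lemma tdist_eq0 (delta : T * T -> 'rV[R]_d) (x y : T) :
  min_displacement delta -> tdist x y = 0 -> x = y.
Proof.
move=> dm; rewrite -(enorm_delta dm (x, y)) => d0.
have [_ /(_ x y)[/displacementsP xy _]] := dm.
have dz : delta (x, y) = 0.
  apply/rowP => i; rewrite mxE; apply/eqP; rewrite -normr_eq0 eq_le normr_ge0.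
  by rewrite andbT -d0 normr_coord_le.
by rewrite -(reprK x) -(xy _ (reprK x)) dz addr0.
Qed.

(** Zero cost makes the distance vanish almost everywhere, so the plan lives on the diagonal. *)
Lemma transport_cost0 (delta : T * T -> 'rV[R]_d) (g : @plan R d) :
  min_displacement delta -> transport_cost g = 0 ->
  forall A, measurable A -> marg1 g A = marg2 g A.
Proof.
move=> dm g0 A mA; rewrite marg1E marg2E.
have bt := bmeasX 2 (bmeas_tdist dm).
have mE : measurable_fun setT (EFin \o (fun p : T * T => tdist p.1 p.2 ^+ 2)).
  by apply/measurable_EFinP; exact: bt.1.
have ae0 : {ae g, forall p : T * T, p.1 = p.2}.
  have := (ae_eq_integral_abs g measurableT mE).1.
  have I0 : (\int[g]_p `|(EFin \o (fun p : T * T => (tdist p.1 p.2 ^+ 2)%R)) p| = 0)%E.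
    transitivity (\int[g]_p (tdist p.1 p.2 ^+ 2)%:E)%E.
      by apply: eq_integral => p _; rewrite /= ger0_norm// sqr_ge0.
    by rewrite (integral_EFin_bmeas g bt) -/(transport_cost g) g0.
  move=> /(_ I0); apply: filterS => p /= h.
  have /eqP : tdist p.1 p.2 ^+ 2 = 0 by apply: EFin_inj; exact: h.
  by rewrite expf_eq0/= => /eqP; exact: tdist_eq0 dm.
have mA1 : measurable (A `*` setT : set (T * T)) by exact: measurableX.
have mA2 : measurable (setT `*` A : set (T * T)) by exact: measurableX.
rewrite -(expect_indic g mA1) -(expect_indic g mA2).
rewrite -(integral_EFin_bmeas g (bmeas_indic mA1)).
rewrite -(integral_EFin_bmeas g (bmeas_indic mA2)).
apply: ae_eq_integral => //.
- by apply/measurable_EFinP; exact: (bmeas_indic mA1).1.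
- by apply/measurable_EFinP; exact: (bmeas_indic mA2).1.
by apply: filterS ae0 => p pp _; rewrite /= !indicE in_setXT in_setTX pp.
Qed.

End swapped_plans.

Section maximizers.
Context {R : realType} {d : nat}.
Local Notation T := (torus R d).
Local Notation P := (prob_torus R d).
Local Notation E := 'rV[R]_d.
Variable delta : T * T -> E.
Hypothesis delta_min : min_displacement delta.

(** The weights are produced first, and any kernel built on them qualifies: the supersolution needs
    the same weights a second time, with reflected atoms. *)
Lemma superdiff_maximizer (A : time R * P -> R) (t : time R) (g0 : @plan R d)
    (D : T * T -> E) (K theta c : R) (J : finType) (phi : J -> T * T -> R)
    (v : option J -> E) :
    respects_borel A -> 0 < K -> optimal_field D ->
    (forall j, bmeas (phi j)) -> (forall j p, 0 <= phi j p <= c) ->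
    c * #|J|%:R <= 1 ->
    (forall p i, \sum_j complete_weights phi j p * v j ord0 i =
      - (2 * K) * D p ord0 i) ->
    (forall (s : time R) (g : @plan R d), time_val s <= time_val t ->
      (forall B : set T, measurable B -> g (setT `*` B) = g0 (setT `*` B)) ->
      A (s, marg1 g) - K * transport_cost g <=
      A (t, marg1 g0) - K * transport_cost g0 + theta * (time_val s - time_val t)
        + K * (time_val s - time_val t) ^+ 2) ->
  exists w : option J -> T -> R, [/\
    forall j, bmeas (w j), forall j x, 0 <= w j x, forall x, \sum_j w j x = 1,
    forall j f, bmeas f -> \int[g0]_p (f p.1 * complete_weights phi j p) =
      \int[marg1 g0]_x (f x * w j x) &
    forall psi : R.-pker T ~> E,
      (forall x B, psi x B = (\sum_j w j x * \1_B (v j))%:E) ->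
      superdiff delta A t (marg1 g0) theta psi].
Proof.
move=> bA K0 oD bphi phic cJ bary Amax.
have [w [bw w0 w1 wE]] :=
  exists_conditional_weights (g0 : probability _ _) fst_mfun bphi phic cJ.
exists w; split=> // psi psiE.
apply: (superdiff_of_max delta_min bw w0 w1 psiE bA K0 oD) => // i B mB.
have bB : bmeas (\1_B : T -> R) by exact: bmeas_indic.
have bbc : bmeas (fun x => barycenter v w x ord0 i * \1_B x).
  by apply: bmeasM => //; exact: bmeas_barycenter.
rewrite -(expect_marg1 g0 bbc).
have bwj j : bmeas (fun x => v j ord0 i * \1_B x * w j x).
  by apply: bmeasM => //; exact: bmeasZ.
have bcw j : bmeas (fun p : T * T => v j ord0 i * \1_B p.1 * complete_weights phi j p).
  apply: bmeasM; last exact: bmeas_complete_weights.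
  exact: (bmeas_fst (bmeasZ (v j ord0 i) bB)).
transitivity (\int[g0]_p \sum_j (v j ord0 i * \1_B p.1 * complete_weights phi j p)).
  apply: eq_Rintegral => p _; rewrite -bary mulr_suml; apply: eq_bigr => j _.
  by ring.
rewrite (expect_sum g0 _ bcw).
transitivity (\int[marg1 g0]_x \sum_j (v j ord0 i * \1_B x * w j x)); last first.
  apply: eq_Rintegral => x _; rewrite barycenterE mulr_suml; apply: eq_bigr => j _.
  by ring.
rewrite (expect_sum (marg1 g0 : probability T R) _ bwj); apply: eq_bigr => j _.
exact: (wE j (fun x => v j ord0 i * \1_B x) (bmeasZ (v j ord0 i) bB)).
Qed.

(** This undoes the conditioning. The mean over one marginal becomes an integral over g0 with
    weights depending on the whole pair, so means over the two marginals become comparable. *)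
Lemma mean_finite_kernel (g0 : @plan R d) (J : finType) (phi : J -> T * T -> R)
    (v : option J -> E) (w : option J -> T -> R) (psi : R.-pker T ~> E)
    (h : T -> E -> R) :
    (forall j, bmeas (w j)) -> (forall j x, 0 <= w j x) ->
    (forall x, \sum_j w j x = 1) ->
    (forall x B, psi x B = (\sum_j w j x * \1_B (v j))%:E) ->
    (forall j f, bmeas f -> \int[g0]_p (f p.1 * complete_weights phi j p) =
      \int[marg1 g0]_x (f x * w j x)) ->
    (forall x, measurable_fun setT (h x)) ->
    (forall z, bmeas (fun x => h x z)) ->
  \int[marg1 g0]_x \int[psi x]_z h x z =
    \sum_j \int[g0]_p (h p.1 (v j) * complete_weights phi j p).
Proof.
move=> bw w0 w1 psiE wE mh bh.
have bhw j : bmeas (fun x => h x (v j) * w j x) by exact: bmeasM.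
transitivity (\int[marg1 g0]_x \sum_j (h x (v j) * w j x)).
  apply: eq_Rintegral => x _; rewrite (kernel_expect w0 w1 psiE _ (mh x)).
  by apply: eq_bigr => j _; rewrite mulrC.
rewrite (expect_sum (marg1 g0 : probability T R) _ bhw).
by apply: eq_bigr => j _; rewrite (wE j (fun x => h x (v j)) (bh _)).
Qed.

End maximizers.

Lemma continuous_compose {X Y Z : topologicalType} (f : X -> Y) (g : Y -> Z) :
  continuous f -> continuous g -> continuous (fun x => g (f x)).
Proof. by move=> cf cg x S nS; exact: (cf x _ (cg (f x) S nS)). Qed.

Lemma continuous_pair_nbhs {X Y Z : topologicalType} (f : X -> Y) (g : X -> Z) :
  continuous f -> continuous g -> continuous (fun x => (f x, g x)).
Proof. by move=> cf cg x; apply: cvg_pair_nbhs; [exact: cf|exact: cg]. Qed.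

(* With maxima of [Phi - K_n pen] for [K_n] doubling at each step, the penalty
   [K_n pen] cannot stay above [r]: each step would lower the maximum by [r / 2]. *)
Lemma penalty_vanishes {R : realType} (X : Type) (S : set X) (Phi pen : X -> R)
    (x : nat -> X) (k r : R) (n0 : nat) : 0 < r ->
    (forall n, S (x n)) ->
    (forall n y, S y -> Phi y - 2 ^+ n * pen y <= Phi (x n) - 2 ^+ n * pen (x n)) ->
    (forall n, k <= Phi (x n) - 2 ^+ n * pen (x n)) ->
  exists n, (n0 <= n)%N /\ 2 ^+ n * pen (x n) <= r.
Proof.
move=> r0 Sx xmax xk; apply: contrapT => /forallNP noN.
pose M n := Phi (x n) - 2 ^+ n * pen (x n).
have dec n : (n0 <= n)%N -> M n.+1 <= M n - r / 2.
  move=> n0n; have := noN n.+1; rewrite not_andP => -[].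
    by rewrite (leq_trans n0n).
  move=> /negP; rewrite -ltNge exprS => rn.
  have := xmax n _ (Sx n.+1); rewrite /M exprS.
  by move: rn; rewrite -!mulrA; lra.
have decs j : M (n0 + j)%N <= M n0 - j%:R * (r / 2).
  elim: j => [|j IH]; first by rewrite addn0 mul0r subr0.
  rewrite addnS -natr1 mulrDl mul1r.
  by have := dec (n0 + j)%N (leq_addr _ _); lra.
(* After j steps of at least r / 2 the maximum would be below k. *)
pose j := (Num.truncn ((M n0 - k) / (r / 2))).+1.
have := decs j; have := xk (n0 + j)%N; rewrite -/(M _).
have : (M n0 - k) / (r / 2) < j%:R by exact: truncnS_gt.
rewrite ltr_pdivrMr ?divr_gt0//; lra.
Qed.

(** * Comparison principle *)

Section comparison.
Context {R : realType} {d : nat}.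
Local Notation T := (torus R d).
Local Notation P := (prob_torus R d).
Local Notation E := 'rV[R]_d.
Variable delta : T * T -> E.
Hypothesis delta_min : min_displacement delta.
Variable H : time R -> T -> P -> E -> R.
Hypothesis H_continuous : continuous
  (fun q : time R * T * P * E => H q.1.1.1 q.1.1.2 q.1.2 q.2).
Variable C : R.
Hypothesis C_gt0 : 0 < C.
Hypothesis H_lipschitz : forall (p : E) (s t : time R) (mu nu : P) (x y : T),
  `|H t x mu p - H s y nu p| <=
    C * (1 + enorm p) * (`|time_val t - time_val s| + W2 mu nu + tdist x y).

Lemma measurable_H t mu x : measurable_fun setT (H t x mu).
Proof.
apply: continuous_measurable_rV.
have c : continuous (fun z : E => (t, x, mu, z)).
  by apply: continuous_pair_nbhs; [exact: cst_continuous|move=> z; exact: cvg_id].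
exact: (continuous_compose c H_continuous).
Qed.

Lemma bmeas_H t mu z : bmeas (fun x => H t x mu z).
Proof.
apply: continuous_bmeas_torus.
have c : continuous (fun x : T => (t, x, mu, z)).
  apply: continuous_pair_nbhs; last exact: cst_continuous.
  apply: continuous_pair_nbhs; last exact: cst_continuous.
  by apply: continuous_pair_nbhs; [exact: cst_continuous|move=> x; exact: cvg_id].
exact: (continuous_compose c H_continuous).
Qed.

Lemma W2_le_cost (mu nu : P) (g : @plan R d) :
  coupling mu nu g -> W2 mu nu <= Num.sqrt (transport_cost g).
Proof.
move=> cpl; apply: ler_wsqrtr; apply: ge_inf; last by exists g.
by exists 0 => _ [g' _ <-]; apply: expect_ge0 => p; exact: sqr_ge0.
Qed.

Variables A B : time R * P -> R.
Hypothesis A_usc : usc A.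
Hypothesis B_usc : usc B.
Hypothesis A_borel : respects_borel A.
Hypothesis B_borel : respects_borel B.
Hypothesis A_sub : forall t mu theta (psi : R.-pker T ~> E), 0 < time_val t ->
  superdiff delta A t mu theta psi -> theta + mean_hamiltonian H t mu psi <= 0.
Hypothesis B_super : forall t mu theta (psi psi' : R.-pker T ~> E), 0 < time_val t ->
  superdiff delta B t mu theta psi' ->
  (forall x (F : set E), measurable F ->
    psi x F = pushforward (psi' x) (fun z : E => - z) F) ->
  0 <= - theta + mean_hamiltonian H t mu psi.

Let sqd (t s : time R) := (time_val t - time_val s) ^+ 2.

(* Both kernels come from one discretization of the same displacement: the sum
   of the two viscosity inequalities bounds [2 lam] by an integral over [g0] of
   differences of [H] at equal momenta. *)
Lemma doubling_estimate (T0 K lam : R) (t0 s0 : time R) (g0 : @plan R d) :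
    0 < K -> time_val t0 <= T0 -> time_val s0 <= T0 ->
    0 < time_val t0 -> 0 < time_val s0 ->
    (forall (t s : time R) (g : @plan R d), time_val t <= T0 -> time_val s <= T0 ->
      A (t, marg1 g) + B (s, marg2 g) - lam * (time_val t + time_val s)
        - K * (transport_cost g + sqd t s) <=
      A (t0, marg1 g0) + B (s0, marg2 g0) - lam * (time_val t0 + time_val s0)
        - K * (transport_cost g0 + sqd t0 s0)) ->
  2 * lam <= C * (\int[g0]_p ((1 + 2 * K * d%:R * tdist p.1 p.2) *
    (`|time_val t0 - time_val s0| + Num.sqrt (transport_cost g0) + tdist p.1 p.2))).
Proof.
move=> K0 tT sT t_gt0 s_gt0 hmax.
have [J [phi [v [c [bphi phic cJ bary phiv]]]]] := exists_discretization delta_min K0.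
pose g1 := swap_plan g0.
have od := optimal_delta delta_min.
have marg12 (F : set T) : measurable F -> marg1 g1 F = marg2 g0 F.
  by move=> mF; rewrite marg1E marg2E swap_planE.
(* The slope is that of lam t + K (t - s0)^2 at t0, and the expansion of the square is exact. The
   slopes for A and B add up to 2 lam, as the terms 2 K (t0 - s0) cancel. *)
have Amax (s : time R) (g : @plan R d) : time_val s <= time_val t0 ->
    (forall F : set T, measurable F -> g (setT `*` F) = g0 (setT `*` F)) ->
    A (s, marg1 g) - K * transport_cost g <=
    A (t0, marg1 g0) - K * transport_cost g0
      + (lam + 2 * K * (time_val t0 - time_val s0)) * (time_val s - time_val t0)
      + K * (time_val s - time_val t0) ^+ 2.
  move=> st gg; have := hmax s s0 g (le_trans st tT) sT.
  have -> : B (s0, marg2 g) = B (s0, marg2 g0).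
    by apply: B_borel => F mF; rewrite !marg2E gg.
  by rewrite /sqd; lra.
have [w [bw w0 w1 wE wS]] := superdiff_maximizer delta_min A_borel K0 od bphi phic cJ
  bary Amax.
(* The displacement from y to x is taken as minus that from x to y, so the second family has the
   same weights at opposite atoms. *)
pose phi' j p := phi j (p.2, p.1).
pose v' j := - v j.
have bphi' j : bmeas (phi' j) by exact: bmeas_swap.
have cw' j p : complete_weights phi' j p = complete_weights phi j (p.2, p.1).
  by case: j.
have bary' p i : \sum_j complete_weights phi' j p * v' j ord0 i =
    - (2 * K) * (- delta (p.2, p.1)) ord0 i.
  under eq_bigr do rewrite cw' mxE mulrN.
  by rewrite sumrN bary mxE mulrN.
have Bmax (s : time R) (g : @plan R d) : time_val s <= time_val s0 ->
    (forall F : set T, measurable F -> g (setT `*` F) = g1 (setT `*` F)) ->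
    B (s, marg1 g) - K * transport_cost g <=
    B (s0, marg1 g1) - K * transport_cost g1
      + (lam + 2 * K * (time_val s0 - time_val t0)) * (time_val s - time_val s0)
      + K * (time_val s - time_val s0) ^+ 2.
  move=> st gg; have := hmax t0 s (swap_plan g) tT (le_trans st sT).
  have -> : A (t0, marg1 (swap_plan g)) = A (t0, marg1 g0).
    by apply: A_borel => F mF; rewrite !marg1E swap_planE gg// swap_planE.
  have -> : B (s, marg2 (swap_plan g)) = B (s, marg1 g).
    by apply: B_borel => F mF; rewrite marg1E marg2E swap_planE.
  have -> : B (s0, marg2 g0) = B (s0, marg1 g1).
    by apply: B_borel => F mF; rewrite marg12.
  rewrite /g1 !(transport_cost_swap _ delta_min) /sqd; lra.
have [w' [bw' w0' w1' wE' wS']] := superdiff_maximizer delta_min B_borel K0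
  (optimal_field_swap od) bphi' (fun j p => phic j (p.2, p.1)) cJ bary' Bmax.
have mw j : measurable_fun setT (w j) by exact: (bw j).1.
have mw' j : measurable_fun setT (w' j) by exact: (bw' j).1.
have [psi psiE] := exists_finite_kernel v mw w0 w1.
have [psi' psiE'] := exists_finite_kernel v' mw' w0' w1'.
(* The reflection of psi': its atoms are the original v, those of the subsolution. *)
have [psi2 psi2E] := exists_finite_kernel v mw' w0' w1'.
have subA := A_sub t_gt0 (wS psi psiE).
have supB := B_super s_gt0 (wS' psi' psiE').
have {supB} := supB psi2.
have -> : (forall x (F : set E), measurable F ->
    psi2 x F = pushforward (psi' x) (fun z : E => - z) F) = True.
  apply/propext; split=> // _ x F mF; rewrite psi2E /pushforward psiE'.
  congr EFin; apply: eq_bigr => j _; congr (_ * _); rewrite !indicE.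
  by congr (nat_of_bool _)%:R; apply/idP/idP => /set_mem h; apply/mem_set;
    rewrite /= /v' opprK in h *.
move=> /(_ I) supB.
have meanA : mean_hamiltonian H t0 (marg1 g0) psi = \sum_j
    \int[g0]_p (H t0 p.1 (marg1 g0) (v j) * complete_weights phi j p).
  exact: (mean_finite_kernel (h := fun x z => H t0 x (marg1 g0) z) bw w0 w1 psiE wE
    (measurable_H t0 (marg1 g0)) (bmeas_H t0 (marg1 g0))).
have bcw j : bmeas (complete_weights phi j) by exact: bmeas_complete_weights.
have bcw' j : bmeas (complete_weights phi' j) by exact: bmeas_complete_weights.
have meanB : mean_hamiltonian H s0 (marg1 g1) psi2 = \sum_j
    \int[g0]_p (H s0 p.2 (marg1 g1) (v j) * complete_weights phi j p).
  rewrite /mean_hamiltonian.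
  rewrite (mean_finite_kernel (h := fun x z => H s0 x (marg1 g1) z) bw' w0' w1' psi2E wE'
    (measurable_H s0 (marg1 g1)) (bmeas_H s0 (marg1 g1))).
  apply: eq_bigr => j _.
  rewrite (expect_swap g0 (bmeasM (bmeas_fst (bmeas_H s0 (marg1 g1) (v j))) (bcw' j))).
  by apply: eq_Rintegral => p _; rewrite cw'/=; case: p.
set tau := `|_ - _|; set q := transport_cost g0.
have bt := bmeas_tdist delta_min.
have W2q : W2 (marg1 g1) (marg1 g0) <= Num.sqrt q.
  rewrite /q -(transport_cost_swap g0 delta_min); apply: W2_le_cost => F mF.
  by split; [rewrite marg1E|rewrite marg1E swap_planE].
have e1 : 2 * lam <= mean_hamiltonian H s0 (marg1 g1) psi2 -
    mean_hamiltonian H t0 (marg1 g0) psi by lra.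
apply: (le_trans e1); rewrite meanA meanB -sumrB.
pose L (p : T * T) := tau + Num.sqrt q + tdist p.1 p.2.
have bL : bmeas L by apply: bmeasD => //; exact: bmeas_cst.
have bB j : bmeas (fun p => H s0 p.2 (marg1 g1) (v j) * complete_weights phi j p).
  by apply: bmeasM => //; exact: (bmeas_snd (bmeas_H _ _ _)).
have bA j : bmeas (fun p => H t0 p.1 (marg1 g0) (v j) * complete_weights phi j p).
  by apply: bmeasM => //; exact: (bmeas_fst (bmeas_H _ _ _)).
have bF j : bmeas (fun p => C * (1 + enorm (v j)) * L p * complete_weights phi j p).
  by apply: bmeasM => //; exact: bmeasZ.
(* For each j both Hamiltonians are taken at the momentum v j with the same weight, so [H_lipschitz]
   applies under the integral. *)
apply: (@le_trans _ _ (\sum_j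
    \int[g0]_p (C * (1 + enorm (v j)) * L p * complete_weights phi j p))).
  apply: ler_sum => j _; rewrite -(expectB g0 (bB j) (bA j)).
  apply: (le_expect g0 (bmeasB (bB j) (bA j)) (bF j)) => p.
  rewrite -mulrBl ler_wpM2r//; first exact: complete_weights_ge0 cJ phic.
  apply: le_trans (ler_norm _) _; apply: le_trans (H_lipschitz _ _ _ _ _ _ _) _.
  rewrite ler_wpM2l// ?mulr_ge0 ?addr_ge0 ?enorm_ge0 ?(ltW C_gt0)//.
  by rewrite /L /tau distrC tdistC lerD2r lerD2l.
rewrite -(expect_sum g0 _ bF).
have bM : bmeas (fun p => (1 + 2 * K * d%:R * tdist p.1 p.2) * L p).
  by apply: bmeasM => //; apply: bmeasD; [exact: bmeas_cst|exact: bmeasZ].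
rewrite -(expectZ g0 C bM); apply: (le_expect g0 (bmeas_sum _ bF) (bmeasZ C bM)) => p.
have -> : \sum_j C * (1 + enorm (v j)) * L p * complete_weights phi j p =
    C * L p * (1 + \sum_j complete_weights phi j p * enorm (v j)).
  rewrite -[in RHS](sum_complete_weights phi p) -big_split/= mulr_sumr.
  by apply: eq_bigr => j _; ring.
have L0 : 0 <= L p.
  apply: addr_ge0; last exact: tdist_ge0.
  by apply: addr_ge0; [exact: normr_ge0|exact: sqrtr_ge0].
rewrite -mulrA ler_pM2l// [leLHS]mulrC; apply: ler_wpM2r => //.
by rewrite lerD2l.
Qed.

Lemma usc_doubled (K lam : R) :
  usc (fun p : time R * time R * @plan R d =>
    A (p.1.1, marg1 p.2) + B (p.1.2, marg2 p.2)
      - lam * (time_val p.1.1 + time_val p.1.2)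
      - K * (transport_cost p.2 + sqd p.1.1 p.1.2)).
Proof.
have cdata : continuous (@plan_data R d) by exact: initial_continuous.
have c1 : continuous (fun p : time R * time R * @plan R d => p.1.1).
  by move=> p; apply: cvg_comp; [exact: cvg_fst|exact: cvg_fst].
have c2 : continuous (fun p : time R * time R * @plan R d => p.1.2).
  by move=> p; apply: cvg_comp; [exact: cvg_fst|exact: cvg_snd].
have c3 : continuous (fun p : time R * time R * @plan R d => plan_data p.2).
  apply: (continuous_compose _ cdata) => p; exact: cvg_snd.
have m1 : continuous (fun p : time R * time R * @plan R d => marg1 p.2).
  apply: (continuous_compose (Z := P) c3 (g := fun q => q.1.1)) => q.
  by apply: cvg_comp; [exact: cvg_fst|exact: cvg_fst].
have m2 : continuous (fun p : time R * time R * @plan R d => marg2 p.2).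
  apply: (continuous_compose (Z := P) c3 (g := fun q => q.1.2)) => q.
  by apply: cvg_comp; [exact: cvg_fst|exact: cvg_snd].
have m3 : continuous (fun p : time R * time R * @plan R d => transport_cost p.2).
  apply: (continuous_compose (Z := R) c3 (g := fun q => q.2)) => q; exact: cvg_snd.
have t1 := continuous_compose c1 (@continuous_time_val R).
have t2 := continuous_compose c2 (@continuous_time_val R).
apply: uscD; [apply: uscD; [apply: uscD|]|].
- exact: (usc_comp A_usc (continuous_pair_nbhs c1 m1)).
- exact: (usc_comp B_usc (continuous_pair_nbhs c2 m2)).
- apply: usc_continuous => p; apply: cvgN; apply: cvgMr; apply: cvgD;
    [exact: t1|exact: t2].
- apply: usc_continuous => p; apply: cvgN; apply: cvgMr; apply: cvgD;
    [exact: m3|rewrite /sqd].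
  under eq_fun do rewrite expr2.
  by rewrite expr2; apply: cvgM; apply: cvgB; [exact: t1|exact: t2|exact: t1|exact: t2].
Qed.

(** With a the distance, a <= r + a^2 / r, and products such as a tau are at most a^2 + tau^2. The
    integrand is thus below c0 + c1 a^2, and a^2 integrates to the cost q. The terms tau, sqrt q, r
    and q / r give 4 r; those with a factor K give 2 d r and 6 d r. *)
Lemma doubling_error (K tau r : R) (g : @plan R d) : 1 <= K -> 0 <= tau ->
    0 < r -> r <= 1 -> K * (transport_cost g + tau ^+ 2) <= r ^+ 2 ->
  \int[g]_p ((1 + 2 * K * d%:R * tdist p.1 p.2) *
    (tau + Num.sqrt (transport_cost g) + tdist p.1 p.2)) <= (4 + 8 * d%:R) * r.
Proof.
move=> K1 tau0 r0 r1; set q := transport_cost g => Kq.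
have K0 : 0 < K by exact: lt_le_trans ltr01 K1.
have q0 : 0 <= q by apply: expect_ge0 => p; exact: sqr_ge0.
have q2 : q + tau ^+ 2 <= r ^+ 2.
  by apply: le_trans Kq; rewrite ler_peMl// addr_ge0// sqr_ge0.
have qr : q <= r ^+ 2 by apply: le_trans q2; rewrite lerDl sqr_ge0.
have sr : Num.sqrt q <= r.
  by rewrite -(ler_pXn2r (n := 2))// ?nnegrE ?sqrtr_ge0 ?(ltW r0)// sqr_sqrtr.
have tr : tau <= r.
  rewrite -(ler_pXn2r (n := 2))// ?nnegrE ?(ltW r0)//.
  by apply: le_trans q2; rewrite lerDr.
set s := Num.sqrt q in sr *; have s0 : 0 <= s by exact: sqrtr_ge0.
have ss : s ^+ 2 = q by rewrite sqr_sqrtr.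
have bt := bmeas_tdist delta_min; have bt2 := bmeasX 2 bt.
pose c0 := tau + s + r + 2 * K * d%:R * (tau ^+ 2 + q).
pose c1 := r^-1 + 6 * K * d%:R.
have bI : bmeas (fun p : T * T =>
    (1 + 2 * K * d%:R * tdist p.1 p.2) * (tau + s + tdist p.1 p.2)).
  apply: bmeasM; first by apply: bmeasD; [exact: bmeas_cst|exact: bmeasZ].
  by apply: bmeasD => //; exact: bmeas_cst.
have Kd : 0 <= 2 * K * d%:R by rewrite !mulr_ge0// ltW.
have h := le_expect g bI (bmeasD (bmeas_cst c0) (bmeasZ c1 bt2)).
apply: (le_trans (h _)) => {h}.
  move=> p; have a0 := tdist_ge0 p.1 p.2; move: (tdist p.1 p.2) a0 => a a0.
  have ar : a <= r + r^-1 * a ^+ 2.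
    have [ar|ar] := leP a r.
      by apply: (le_trans ar); rewrite lerDl mulr_ge0 ?invr_ge0 ?(ltW r0)// sqr_ge0.
    apply: (@le_trans _ _ (r^-1 * a ^+ 2)); last by rewrite lerDr ltW.
    by rewrite ler_pdivlMl// expr2 ler_wpM2r// ltW.
  have at1 : a * tau <= a ^+ 2 + tau ^+ 2.
    by have := sqr_ge0 (a - tau); have := mulr_ge0 a0 tau0; rewrite sqrrB; lra.
  have as1 : a * s <= a ^+ 2 + q.
    by rewrite -ss; have := sqr_ge0 (a - s); have := mulr_ge0 a0 s0; rewrite sqrrB; lra.
  have := ler_wpM2l Kd (_ : a * tau + a * s + a ^+ 2 <= 3 * a ^+ 2 + tau ^+ 2 + q).
  rewrite /c0 /c1; move=> /(_ ltac:(lra)); lra.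
rewrite (expectD g (bmeas_cst c0) (bmeasZ c1 bt2)) (expect_cst g) (expectZ g c1 bt2).
rewrite -/(transport_cost g) -/q /c0 /c1.
have qrr : r^-1 * q <= r by rewrite ler_pdivrMl// -expr2.
have r2 : r ^+ 2 <= r by rewrite expr2 ger_pMl.
have KK : 2 * d%:R * (K * (q + tau ^+ 2)) <= 2 * d%:R * r.
  by rewrite ler_wpM2l//; exact: le_trans Kq r2.
have Kq0 : 6 * d%:R * (K * q) <= 6 * d%:R * r.
  rewrite ler_wpM2l//; apply: le_trans (le_trans Kq r2).
  by rewrite ler_pM2l// lerDl sqr_ge0.
lra.
Qed.

Lemma comparison_principle :
  (forall mu, A (time0 R, mu) + B (time0 R, mu) <= 0) ->
  forall t mu, A (t, mu) + B (t, mu) <= 0.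
Proof.
move=> init t1 mu1; rewrite leNgt; apply/negP; set a := _ + _ => a0.
pose T0 := time_val t1; have T00 : 0 <= T0 := time_val_ge0 t1.
(* The term lam (t + s) is at most a / 2 at t = s = t1, so the maximum stays above a / 2. *)
pose lam := a / (4 * (T0 + 1)).
have T1 : 0 < 4 * (T0 + 1) by lra.
have lam0 : 0 < lam by rewrite divr_gt0.
have lamE : lam * (4 * (T0 + 1)) = a by rewrite divfK// gt_eqF.
pose X := (time R * time R * @plan R d)%type.
pose Phi (p : X) := A (p.1.1, marg1 p.2) + B (p.1.2, marg2 p.2)
  - lam * (time_val p.1.1 + time_val p.1.2).
pose pen (p : X) := transport_cost p.2 + sqd p.1.1 p.1.2.
pose F n (p : X) := Phi p - 2 ^+ n * pen p.
have uF n : usc (F n) by exact: usc_doubled.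
have pen0 p : 0 <= pen p.
  by rewrite addr_ge0 ?sqr_ge0//; apply: expect_ge0 => x; exact: sqr_ge0.
have pow0 n : 0 < 2 ^+ n :> R by rewrite exprn_gt0.
pose tset := [set t : time R | time_val t <= T0].
pose S : set X := (tset `*` tset) `*` setT.
have cplan := compact_plan delta_min.
have ct : compact tset by exact: compact_time.
have cS : compact S by do 2! apply: compact_setX => //.
have S0 : S !=set0 by exists (t1, t1, diag_plan mu1); repeat split; exact: lexx.
pose x n := sval (cid2 (usc_max cS S0 (uF n))).
have Sx n : S (x n) by rewrite /x; case: cid2.
have xmax n y : S y -> F n y <= F n (x n) by rewrite /x; case: cid2 => /= z _; exact.
have kx n : a / 2 <= F n (x n).
  apply: le_trans (xmax n (t1, t1, diag_plan mu1) _); last first.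
    by repeat split; exact: lexx.
  rewrite /F /Phi /pen /= (transport_cost_diag mu1 delta_min) /sqd subrr expr0n/=.
  rewrite addr0 mulr0 subr0.
  have -> : A (t1, marg1 (diag_plan mu1)) = A (t1, mu1).
    by apply: A_borel => G mG; rewrite marg1E diag_planE1.
  have -> : B (t1, marg2 (diag_plan mu1)) = B (t1, mu1).
    by apply: B_borel => G mG; rewrite marg2E diag_planE2.
  by rewrite -/a -/T0; move: lamE; lra.
pose K0 : set X :=
  ([set time0 R] `*` tset) `*` setT `|` (tset `*` [set time0 R]) `*` setT.
have cK0 : compact K0.
  by apply: compactU; do 2! apply: compact_setX => //; exact: compact_set1.
have K0P p : K0 p -> p.1.1 = time0 R \/ p.1.2 = time0 R.
  by move=> [[[/= ? _] _]|[[_ /= ?] _]]; [left|right].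
(* Where one of the times is 0, the functional eventually stays below a / 2, by [usc_dini], so
   maximizers avoid this set. *)
have [n0 hn0] : exists n, forall m p, (n <= m)%N -> K0 p -> F m p < a / 2.
  apply: (usc_dini cK0 uF) => [n p|p Kp].
    rewrite lerD2l lerN2 ler_wpM2r// exprS ler_peMl ?(ltW (pow0 n))//; lra.
  (* A positive penalty wins as n grows. If it vanishes, both times are 0 and the two marginals
     agree on Borel sets, so [init] applies. *)
  have [p0|pn0] := eqVneq (pen p) 0; last first.
    have pp : 0 < pen p by rewrite lt_neqAle eq_sym pn0 pen0.
    exists (Num.truncn ((Phi p - a / 2) / pen p)).+1; rewrite /F.
    rewrite ltrBlDr -ltrBlDl -ltr_pdivrMr//.
    apply: lt_le_trans (truncnS_gt _) _.
    by rewrite -natrX ler_nat ltnW// ltn_expl.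
  exists 0%N; rewrite /F p0 mulr0 subr0.
  case: p Kp p0 => -[t s] g /K0P /= ts; rewrite /pen /Phi /= => /eqP.
  rewrite paddr_eq0 ?sqr_ge0//; last by apply: expect_ge0 => y; exact: sqr_ge0.
  move=> /andP[/eqP g0]; rewrite /sqd sqrf_eq0 subr_eq0 => /eqP ts'.
  have tE : t = time0 R by case: ts => // se; apply: val_inj; rewrite -se; exact: ts'.
  have sE : s = time0 R by apply: val_inj; rewrite -tE; exact: esym ts'.
  rewrite tE sE /time_val/= addr0 mulr0 subr0.
  rewrite (@B_borel _ (marg2 g) (marg1 g)); last first.
    by move=> G mG; rewrite (transport_cost0 delta_min g0).
  by apply: le_lt_trans (init _) _; rewrite divr_gt0.
have D0 : 0 < C * (4 + 8 * d%:R) by rewrite mulr_gt0// ltr_wpDr// mulr_ge0.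
(* Chosen so that the bound on 2 lam from [doubling_estimate] and [doubling_error] is at most
   lam. *)
pose r := Num.min 1 (lam / (C * (4 + 8 * d%:R))).
have r0 : 0 < r by rewrite lt_min ltr01 divr_gt0.
have r1 : r <= 1 by rewrite ge_min lexx.
have rlam : C * ((4 + 8 * d%:R) * r) <= lam.
  by rewrite mulrA mulrC -ler_pdivlMr// ge_min lexx orbT.
have [n [n0n npen]] := @penalty_vanishes R X S Phi pen x (a / 2) (r ^+ 2) n0
  (exprn_gt0 2 r0) Sx xmax kx.
have nK0 : ~ K0 (x n) by move=> /(hn0 _ _ n0n); rewrite ltNge kx.
have := Sx n; case xE : (x n) => [[t0 s0] g0] [[/= tT sT] _].
have gt0 (u : time R) : u <> time0 R -> 0 < time_val u.
  move=> u0; rewrite lt_neqAle time_val_ge0 andbT; apply/eqP => uu.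
  by apply: u0; apply: val_inj; exact: esym uu.
have t_gt0 : 0 < time_val t0.
  by apply: gt0 => tE; apply: nK0; rewrite xE tE; left.
have s_gt0 : 0 < time_val s0.
  by apply: gt0 => sE; apply: nK0; rewrite xE sE; right.
have hmax (t s : time R) (g : @plan R d) : time_val t <= T0 -> time_val s <= T0 ->
    F n (t, s, g) <= F n (t0, s0, g0).
  by move=> tT' sT'; have := xmax n (t, s, g); rewrite xE; apply; repeat split.
have := @doubling_estimate T0 (2 ^+ n) lam t0 s0 g0 (pow0 n) tT sT t_gt0 s_gt0 hmax.
apply/negP; rewrite -ltNge.
move: npen; rewrite xE /pen/= /sqd -real_normK ?num_real// => npen.
have n1 : 1 <= 2 ^+ n :> R by rewrite exprn_ege1// ler1n.
have := doubling_error n1 (normr_ge0 _) r0 r1 npen.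
rewrite -(ler_pM2l C_gt0) => h; apply: le_lt_trans h _.
by apply: le_lt_trans rlam _; lra.
Qed.

End comparison.

(** * Uniqueness of viscosity solutions *)

Section borel_envelopes.
Context {R : realType} {d : nat}.

(** U itself may tell apart measures that agree on Borel sets; its envelope depends only on
    neighbourhoods, which coincide for such measures. *)
Lemma usc_envelope_borel (U : time R * prob_torus R d -> R) :
  respects_borel (usc_envelope U).
Proof.
move=> t mu nu munu; rewrite /usc_envelope.
suff -> : nbhs (t, mu) = nbhs (t, nu) by [].
by rewrite /nbhs/= (eq_nbhs_prob munu).
Qed.

Lemma lsc_envelope_borel (U : time R * prob_torus R d -> R) :
  respects_borel (\- lsc_envelope U).
Proof.
move=> t mu nu munu; rewrite lsc_envelopeE /= !opprK.
exact: usc_envelope_borel.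
Qed.

End borel_envelopes.

Lemma viscosity_comparison (R : realType) (d : nat)
    (delta : torus R d * torus R d -> 'rV[R]_d)
    (H : time R -> torus R d -> prob_torus R d -> 'rV[R]_d -> R)
    (U V : time R * prob_torus R d -> R) :
    min_displacement delta ->
    continuous (fun q : time R * torus R d * prob_torus R d * 'rV[R]_d =>
      H q.1.1.1 q.1.1.2 q.1.2 q.2) ->
    (exists2 C : R, 0 < C &
      forall (p : 'rV[R]_d) (s t : time R) (mu nu : prob_torus R d)
        (x y : torus R d),
        `|H t x mu p - H s y nu p| <=
          C * (1 + enorm p) * (`|time_val t - time_val s| + W2 mu nu + tdist x y)) ->
    viscosity_solution delta H U -> viscosity_solution delta H V ->
    (forall mu, usc_envelope U (time0 R, mu) <= lsc_envelope V (time0 R, mu)) ->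
  forall p, U p <= V p.
Proof.
move=> delta_min cH [C C0 HC] [lU [uU subU] _] [lV _ [lscV supV]] init [t mu].
(* The chain is U <= [usc_envelope U] <= [lsc_envelope V] <= V; the middle inequality is comparison
   with B minus the lower envelope of V. *)
suff h : usc_envelope U (t, mu) + (\- lsc_envelope V) (t, mu) <= 0.
  apply: le_trans (le_usc_envelope _ lU) _; apply: le_trans (ge_lsc_envelope _ lV).
  by rewrite -subr_le0.
apply: (comparison_principle delta_min cH C0 HC uU _ (@usc_envelope_borel _ _ U)
  (@lsc_envelope_borel _ _ V) subU).
- rewrite /usc; suff -> : \- (\- lsc_envelope V) = lsc_envelope V by [].
  by apply/funext => x; exact: opprK.
- move=> s nu theta psi psi' s0 sd pE; apply: supV => //.
  by exists theta, psi'.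
- by move=> nu; rewrite subr_le0.
Qed.

Theorem theorem2p14 (R : realType) (d : nat)
    (delta : torus R d * torus R d -> 'rV[R]_d)
    (delta_min : min_displacement delta)
    (H : time R -> torus R d -> prob_torus R d -> 'rV[R]_d -> R)
    (H_continuous : continuous
      (fun q : time R * torus R d * prob_torus R d * 'rV[R]_d =>
         H q.1.1.1 q.1.1.2 q.1.2 q.2))
    (H_lipschitz : exists2 C : R, 0 < C &
      forall (p : 'rV[R]_d) (s t : time R) (mu nu : prob_torus R d)
        (x y : torus R d),
        `|H t x mu p - H s y nu p| <=
          C * (1 + enorm p) * (`|time_val t - time_val s| + W2 mu nu + tdist x y))
    (U0 : prob_torus R d -> R) (U0_continuous : continuous U0)
    (U V : time R * prob_torus R d -> R)
    (U_solution : viscosity_solution delta H U)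
    (U_initial : forall mu,
      usc_envelope U (time0 R, mu) = U0 mu /\
      lsc_envelope U (time0 R, mu) = U0 mu)
    (V_solution : viscosity_solution delta H V)
    (V_initial : forall mu,
      usc_envelope V (time0 R, mu) = U0 mu /\
      lsc_envelope V (time0 R, mu) = U0 mu) :
  U = V.
Proof.
apply/funext => p; apply/eqP; rewrite eq_le; apply/andP; split.
- apply: (viscosity_comparison delta_min H_continuous H_lipschitz U_solution V_solution).
  by move=> mu; rewrite (U_initial mu).1 (V_initial mu).2.
- apply: (viscosity_comparison delta_min H_continuous H_lipschitz V_solution U_solution).
  by move=> mu; rewrite (V_initial mu).1 (U_initial mu).2.
Qed.
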